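(* Let $(M,F)$ be a Finsler manifold of dimension $m\ge 2$ which is of scalar flag curvature, in the sense that there is a smooth function $\lambda$ on $T_0M$ such that the curvature of its Cartan nonlinear connection satisfies $R^i_{jk}=\lambda(\delta^i_ky_j-\delta^i_jy_k)$ for all $i,j,k$. Then $\left(D_F=(\mathrm{span}\{S_F,\Gamma\})^{\perp G_F},\ J_F=\Psi_F|_{D_F}\right)$ is a CR-structure on $T_0M$.
   Context: Summation over repeated indices is used throughout; $\delta^i_j$ is the Kronecker symbol. CR-structure: let $N$ be a smooth manifold of dimension $2n+s$ with $n,s\ge 1$, $D$ a distribution on $N$ of dimension $2n$, $\Gamma(D)$ the module of its sections, and $J:D\to D$ a vector bundle morphism with $J^2=-I$. The pair $(D,J)$ is a CR-structure on $N$ if for all $X,Y\in\Gamma(D)$: (i) $[JX,JY]-[X,Y]\in\Gamma(D)$, and (ii) $[JX,JY]-[X,Y]-J([X,JY]+[JX,Y])=0$. Here $N=T_0M$, $s=2$, $n=m-1$. Finsler setting: $M$ is a smooth $m$-dimensional manifold, $m\ge 2$, with tangent bundle $\pi:TM\to M$, induced local coordinates $(x^i,y^i)$ on $TM$, and slit tangent bundle $T_0M=TM\setminus O$, where $O$ is the null section. A Finsler fundamental function is a map $F:TM\to\mathbb{R}_+$ that is smooth on $T_0M$ and continuous on $O$, satisfies $F(x,\lambda y)=\lambda F(x,y)$ for all $\lambda>0$, and for which the matrix $g_{ij}=\frac12\frac{\partial^2F^2}{\partial y^i\partial y^j}$ is invertible with positive definite associated quadratic form (on $T_0M$). $(M,F)$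 is then called a Finsler manifold. Put $y_i=g_{ij}y^j$, so $F^2=y_iy^i$. Cartan nonlinear connection: $\gamma^i_{jk}=\frac12 g^{ia}\left(\frac{\partial g_{ak}}{\partial x^j}+\frac{\partial g_{ja}}{\partial x^k}-\frac{\partial g_{jk}}{\partial x^a}\right)$, $\gamma^i_{00}=\gamma^i_{jk}y^jy^k$, $N^i_j=\frac12\frac{\partial\gamma^i_{00}}{\partial y^j}$, $\frac{\delta}{\delta x^i}=\frac{\partial}{\partial x^i}-N^j_i\frac{\partial}{\partial y^j}$, $\delta y^i=dy^i+N^i_jdx^j$. The fields $\{\frac{\delta}{\delta x^i},\frac{\partial}{\partial y^i}\}$ form a local frame on $T_0M$ with dual frame $\{dx^i,\delta y^i\}$. The curvature of the Cartan nonlinear connection is $R^i_{jk}=\frac{\delta N^i_j}{\delta x^k}-\frac{\delta N^i_k}{\delta x^j}$, so that $[\frac{\delta}{\delta x^j},\frac{\delta}{\delta x^k}]=R^i_{jk}\frac{\partial}{\partial y^i}$. The almost complex structure $\Psi_F$ on $T_0M$ is defined by $\Psi_F(\frac{\delta}{\delta x^i})=-\frac{\partial}{\partial y^i}$, $\Psi_F(\frac{\partial}{\partial y^i})=\frac{\delta}{\delta x^i}$. $S_F=y^i\frac{\delta}{\delta x^i}$ is the geodesic spray, $\Gamma=y^i\frac{\partial}{\partial y^i}$ is the Liouville vector field, and $G_F=g_{ij}dx^i\otimes dx^j+g_{ij}\delta y^i\otimes\delta y^j$ is the Sasaki type metric on $T_0M$. $D_F=(\mathrm{span}\{S_F,\Gamma\})^{\perp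 G_F}$ is the $G_F$-orthogonal complement, a distribution of dimension $2m-2$ on $T_0M$. *)

(* Defs.v *)
From HB Require Import structures.
From mathcomp Require Import all_boot all_order all_algebra.
From mathcomp Require Import all_classical all_reals all_analysis.

Set Implicit Arguments.
Unset Strict Implicit.
Unset Printing Implicit Defensive.

Import Order.TTheory GRing.Theory Num.Theory numFieldNormedType.Exports.

Local Open Scope classical_set_scope.
Local Open Scope ring_scope.

(* U is meant to be open: the derivatives are those of the total function f,
   which at points of an open U depend only on the restriction of f to U. *)
Section Smooth.
Context {R : realType} {d : nat} {W : normedModType R}.

Fixpoint Ck (k : nat) (U : set 'rV[R]_d) (f : 'rV[R]_d -> W) : Prop :=
  if k is k'.+1 then
    (forall x, U x -> differentiable f x) /\
    (forall v : 'rV[R]_d, Ck k' U (fun x => 'D_v f x))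
  else forall x, U x -> {for x, continuous f}.

Definition smooth_on (U : set 'rV[R]_d) (f : 'rV[R]_d -> W) : Prop :=
  forall k, Ck k U f.

End Smooth.

(* Raw data of an atlas on the set [carrier], which lives in an ambient type of
   points.  The chart a is the bijection [coord a] from [dom a] onto its image
   in R^d, with inverse [coord_inv a]; the values of these functions elsewhere
   are irrelevant.  The axioms of a smooth manifold are in [smooth_manifold]. *)
Record atlas (R : realType) (d : nat) := Atlas {
  point_of : Type;
  chart : Type;
  carrier : set point_of;
  dom : chart -> set point_of;
  coord : chart -> point_of -> 'rV[R]_d;
  coord_inv : chart -> 'rV[R]_d -> point_of
}.
Arguments carrier {R d} a.

Section Manifold.
Context {R : realType} {d : nat}.
Variable N : atlas R d.
Implicit Types (a b : chart N) (p q : point_of N) (U : set (point_of N)).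

(* The topology of N is the one determined by its atlas. *)
Definition open_in U : Prop :=
  U `<=` carrier N /\ forall a, open (coord a @` (dom a `&` U)).

Definition transition a b : 'rV[R]_d -> 'rV[R]_d :=
  fun x => coord b (coord_inv a x).

Definition smooth_atlas : Prop :=
  [/\ \bigcup_a dom (a : chart N) = carrier N,
      (forall a p, dom a p -> coord_inv a (coord a p) = p),
      (forall a b, open (coord a @` (dom a `&` dom b)))
    & (forall a b, smooth_on (coord a @` (dom a `&` dom b)) (transition a b))].

Definition hausdorff_manifold : Prop :=
  forall p q, carrier N p -> carrier N q -> p <> q ->
    exists A B, [/\ open_in A, open_in B, A p, B q & A `&` B = set0].

Definition second_countable_manifold : Prop :=
  exists B : nat -> set (point_of N), (forall i, open_in (B i)) /\
    forall A p, open_in A -> A p -> exists2 i, B i p & B i `<=` A.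

Definition smooth_manifold : Prop :=
  [/\ smooth_atlas, hausdorff_manifold & second_countable_manifold].

Definition smooth_function (f : point_of N -> R) : Prop :=
  forall a, smooth_on (coord a @` dom a)
              ((fun x => f (coord_inv a x)) : 'rV[R]_d -> R^o).

(* A tangent vector at p is the family of its component vectors in all the
   charts around p, transforming by the differentials of the transition maps.
   The entries at charts which do not contain p are set to 0, so that equality
   of tangent vectors is equality of families, and T_pN is a subspace of the
   vector space of all families. *)
Definition tvec : Type := chart N -> 'rV[R]_d.

Definition tangent p (v : tvec) : Prop :=
  (forall a, ~ dom a p -> v a = 0) /\
  (forall a b, dom a p -> dom b p ->
     v b = 'D_(v a) (transition a b) (coord a p)).

(* The family of tangent components given in each chart a by f a. *)
Definition chartwise (f : chart N -> 'rV[R]_d) p : tvec :=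
  fun a => if `[< dom a p >] then f a else 0.

Definition field : Type := point_of N -> tvec.

Definition local_rep (X : field) a : 'rV[R]_d -> 'rV[R]_d :=
  fun x => X (coord_inv a x) a.

Definition smooth_field_on U (X : field) : Prop :=
  (forall p, U p -> tangent p (X p)) /\
  (forall a, smooth_on (coord a @` (dom a `&` U)) (local_rep X a)).

Definition bracket (X Y : field) : field := fun p =>
  chartwise (fun a => 'D_(X p a) (local_rep Y a) (coord a p)
                      - 'D_(Y p a) (local_rep X a) (coord a p)) p.

Definition smooth_distribution (r : nat) (D : point_of N -> set tvec) : Prop :=
  forall p, carrier N p ->
    exists U (E : 'I_r -> field),
      [/\ open_in U, U p, (forall i, smooth_field_on U (E i)),
          (forall q, U q -> forall c : 'I_r -> R,
             \sum_i c i *: E i q = 0 -> forall i, c i = 0)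
        & (forall q, U q ->
             D q = [set v | exists c : 'I_r -> R, v = \sum_i c i *: E i q])].

(* Sections of D over U; [section D (carrier N)] is the module Gamma(D). *)
Definition section (D : point_of N -> set tvec) U (X : field) : Prop :=
  smooth_field_on U X /\ (forall p, U p -> D p (X p)).

(* Vector bundle morphisms D -> D over the identity of N; the values of J p
   outside D p are irrelevant. *)
Definition bundle_morphism (D : point_of N -> set tvec)
    (J : point_of N -> tvec -> tvec) : Prop :=
  [/\ (forall p v, carrier N p -> D p v -> D p (J p v)),
      (forall p (c : R) v w, carrier N p -> D p v -> D p w ->
         J p (c *: v + w) = c *: J p v + J p w)
    & (forall U X, open_in U -> section D U X ->
         section D U (fun p => J p (X p)))].

(* Given the first integrability condition, [X, JY] + [JX, Y] is a section of D, so that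
   J is applied to an element of D in the second one. *)
Definition cr_structure (n s : nat) (D : point_of N -> set tvec)
    (J : point_of N -> tvec -> tvec) : Prop :=
  [/\ smooth_manifold,
      [/\ d = (2 * n + s)%N, (1 <= n)%N & (1 <= s)%N],
      smooth_distribution (2 * n) D,
      bundle_morphism D J /\
        (forall p v, carrier N p -> D p v -> J p (J p v) = - v)
    & forall X Y, section D (carrier N) X -> section D (carrier N) Y ->
        let JX : field := fun p => J p (X p) in
        let JY : field := fun p => J p (Y p) in
        section D (carrier N) (bracket JX JY - bracket X Y) /\
        (forall p, carrier N p ->
           bracket JX JY p - bracket X Y p
           - J p (bracket X JY p + bracket JX Y p) = 0)].

Definition open_restriction (A : set (point_of N)) : atlas R d :=
  @Atlas R d (point_of N) (chart N) (carrier N `&` A)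
    (fun a => dom a `&` A) (@coord R d N) (@coord_inv R d N).

End Manifold.

(* TM with the charts (x, y) = (x^1, .., x^m, y^1, .., y^m) induced by those of
   M; its points are the pairs (p, v) with v tangent to M at p. *)
Definition tangent_bundle (R : realType) (m : nat) (M : atlas R m) :
    atlas R (m + m) :=
  @Atlas R (m + m) (point_of M * tvec M)%type (chart M)
    [set u | carrier M u.1 /\ tangent u.1 u.2]
    (fun a => [set u | dom a u.1 /\ tangent u.1 u.2])
    (fun a u => row_mx (coord a u.1) (u.2 a))
    (fun a z =>
       let p := coord_inv a (lsubmx z) in
       (p, chartwise (fun b => 'D_(rsubmx z) (transition a b) (lsubmx z)) p)).

Definition slit_tangent_bundle (R : realType) (m : nat) (M : atlas R m) :
    atlas R (m + m) :=
  @open_restriction R (m + m) (tangent_bundle M) [set u | u.2 <> 0].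

(* In this section f is the local expression of the fundamental function F in
   a chart of TM, and z = (x, y) are the coordinates in that chart. *)
Section LocalFinsler.
Context {R : realType} {m : nat}.
Implicit Types (h : 'rV[R]_(m + m) -> R) (z w : 'rV[R]_(m + m)).
Implicit Types i j k : 'I_m.

Definition dx_ i h z : R :=
  'D_(delta_mx 0 (lshift m i)) (h : 'rV[R]_(m + m) -> R^o) z.
Definition dy_ i h z : R :=
  'D_(delta_mx 0 (rshift m i)) (h : 'rV[R]_(m + m) -> R^o) z.

Definition ycoord i z : R := z 0 (rshift m i).

Variable f : 'rV[R]_(m + m) -> R.

Definition gmat z : 'M[R]_m :=
  \matrix_(i, j) (2^-1 * dy_ i (dy_ j (fun t => f t ^+ 2)) z).
Definition glow i j z : R := gmat z i j.
Definition gup i j z : R := invmx (gmat z) i j.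

Definition ylow i z : R := \sum_j glow i j z * ycoord j z.

Definition christoffel i j k z : R :=
  2^-1 * \sum_l gup i l z *
    (dx_ j (glow l k) z + dx_ k (glow j l) z - dx_ l (glow j k) z).

Definition christoffel00 i z : R :=
  \sum_j \sum_k christoffel i j k z * ycoord j z * ycoord k z.

Definition nlconn i j z : R := 2^-1 * dy_ j (christoffel00 i) z.

Definition delta_x i h z : R := dx_ i h z - \sum_j nlconn j i z * dy_ j h z.

Definition curvature i j k z : R :=
  delta_x k (nlconn i j) z - delta_x j (nlconn i k) z.

(* hframe i = delta/delta x^i, vframe i = d/dy^i; hcoframe i = dx^i,
   vcoframe i = delta y^i. *)
Definition hframe i z : 'rV[R]_(m + m) :=
  row_mx (delta_mx 0 i) (- \row_j nlconn j i z).
Definition vframe i : 'rV[R]_(m + m) := row_mx 0 (delta_mx 0 i).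
Definition hcoframe i w : R := w 0 (lshift m i).
Definition vcoframe i z w : R :=
  w 0 (rshift m i) + \sum_j nlconn i j z * w 0 (lshift m j).

Definition loc_spray z : 'rV[R]_(m + m) := \sum_i ycoord i z *: hframe i z.
Definition loc_liouville z : 'rV[R]_(m + m) := \sum_i ycoord i z *: vframe i.

Definition loc_sasaki z w w' : R :=
  \sum_i \sum_j (glow i j z * hcoframe i w * hcoframe j w'
                 + glow i j z * vcoframe i z w * vcoframe j z w').

(* This is the linear map with delta/delta x^i |-> - d/dy^i and
   d/dy^i |-> delta/delta x^i, written through the dual frame. *)
Definition loc_Psi z w : 'rV[R]_(m + m) :=
  \sum_i (hcoframe i w *: (- vframe i) + vcoframe i z w *: hframe i z).

End LocalFinsler.

Section Finsler.
Context {R : realType} {m : nat} {M : atlas R m}.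
Local Notation TM := (tangent_bundle M).
Local Notation T0M := (slit_tangent_bundle M).
Variable F : point_of TM -> R.

Definition loc_F (a : chart M) (z : 'rV[R]_(m + m)) : R :=
  F (@coord_inv R (m + m) TM a z).

Definition finsler_function : Prop :=
  [/\ (forall u, carrier TM u -> 0 <= F u),
      @smooth_function R (m + m) T0M F,
      (forall (a : chart M) x, (coord a @` dom a) x ->
         {for (row_mx x 0 : 'rV[R]_(m + m)),
            continuous (loc_F a : 'rV[R]_(m + m) -> R^o)}),
      (forall p v (c : R), carrier TM (p, v) -> 0 < c ->
         F (p, c *: v) = c * F (p, v))
    & (forall (a : chart T0M) z, (coord a @` dom a) z ->
         gmat (loc_F a) z \in unitmx /\
         (forall w : 'rV[R]_m, w != 0 ->
            0 < \sum_i \sum_j glow (loc_F a) i j z * w 0 i * w 0 j))].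

Definition scalar_flag_curvature : Prop :=
  exists2 lam : point_of T0M -> R, smooth_function lam &
    forall (a : chart T0M) z, (coord a @` dom a) z -> forall i j k : 'I_m,
      curvature (loc_F a) i j k z =
      lam (coord_inv a z) *
        ((i == k)%:R * ylow (loc_F a) j z - (i == j)%:R * ylow (loc_F a) k z).

Definition spray : field T0M := fun u =>
  chartwise (fun a : chart T0M => loc_spray (loc_F a) (coord a u)) u.

Definition liouville : field T0M := fun u =>
  chartwise (fun a : chart T0M => loc_liouville (coord a u)) u.

(* G_F(v, w) at u, evaluated in the coordinates of the chart a around u; its
   value does not depend on a. *)
Definition sasaki (a : chart T0M) (u : point_of T0M) (v w : tvec T0M) : R :=
  loc_sasaki (loc_F a) (coord a u) (v a) (w a).

Definition Psi_F (u : point_of T0M) (v : tvec T0M) : tvec T0M :=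
  chartwise (fun a : chart T0M => loc_Psi (loc_F a) (coord a u) (v a)) u.

Definition span_SG (u : point_of T0M) : set (tvec T0M) :=
  [set v | exists b c : R, v = b *: spray u + c *: liouville u].

Definition D_F (u : point_of T0M) : set (tvec T0M) :=
  [set w | tangent u w /\
     forall v, span_SG u v ->
       forall a : chart T0M, dom a u -> sasaki a u w v = 0].

Definition J_F (u : point_of T0M) : tvec T0M -> tvec T0M :=
  Psi_F u \_ (D_F u).

End Finsler.

(* Main.v *)
From HB Require Import structures.
From mathcomp Require Import all_boot all_order all_algebra.
From mathcomp Require Import all_classical all_reals all_analysis.
From mathcomp Require Import ring lra zify.
Require Import Defs.

(* Put E = F^2/2 and, for v in R^m, let flat(v) = v^i dE/dy^i = y_i v^i.  By
   Euler's theorem the Cartan connection satisfies delta E/delta x^i = 0 and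
   delta y_i/delta x^j = delta y_j/delta x^i, and dN^i_j/dy^k is symmetric in j
   and k.  Write h and v for the horizontal and vertical components of a vector,
   so that D_F is given by flat(h) = flat(v) = 0, and Psi(h, v) = (v, -h).
   The form flat(v) is dE, so it kills brackets of sections of D_F; the exterior
   derivative of flat(h) is g_ij (delta y^i /\ dx^j), which is invariant under
   Psi; hence [JX,JY] - [X,Y] is in D_F.  The Nijenhuis tensor of Psi involves
   only the terms R^i_jk h^j k^k with h, k in ker flat, and they vanish when
   R^i_jk = lambda (delta^i_k y_j - delta^i_j y_k).
   That all this is independent of the chart follows from the geodesic equation
   g_ij gamma^j_00 = y^k d^2E/(dx^k dy^i) - dE/dx^i, whose vertical derivative
   gives the transformation law of N^i_j.  *)
Set Implicit Arguments.
Unset Strict Implicit.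
Unset Printing Implicit Defensive.

Import Order.TTheory GRing.Theory Num.Theory numFieldNormedType.Exports.

Local Open Scope classical_set_scope.
Local Open Scope ring_scope.

(** * Derivatives of maps between normed modules *)

Section Derivatives.
Context {R : realType} {V W : normedModType R}.
Implicit Types (U : set V) (f g : V -> W) (x v w : V).

(** Homogeneity of F enters only through Euler's identity, y_i y^i = 2E; differentiating it in the x
    and y directions yields the relations between y_i, g_ij and E. Contractions whose coefficients
    depend on the point are treated as families of linear maps, so that differentiating them is a
    single Leibniz rule; index sums serve mainly to meet the coordinate definitions.

    In the adapted frame, the bracket sees N only through its derivatives along the two vectors.
    Splitting these directions gives R and dN/dy. Since Psi exchanges horizontal and vertical
    components up to sign, the symmetry of dN/dy makes its contributions to the Nijenhuis tensor
    cancel, and R contracted with h and k is lambda (flat(h) k - flat(k) h), which vanishes on ker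
    flat.

    The identity [JX,JY] - [X,Y] = Psi([X,JY] + [JX,Y]) is proved for Psi, which is defined on all
    tangent vectors. As [J_F] is known to agree with Psi only on D_F, the argument must still be
    shown to lie in D_F: apply Psi to the identity and use Psi^2 = -I. *)

Lemma derive_eq_on U f g x v : open U -> U x -> (forall y, U y -> f y = g y) ->
  'D_v f x = 'D_v g x.
Proof.
move=> oU Ux fg; apply: near_eq_derive.
by apply: filterS (open_nbhs_nbhs (conj oU Ux)).
Qed.

Lemma continuous_eq_on U f g x : open U -> U x ->
  (forall y, U y -> f y = g y) -> {for x, continuous f} -> {for x, continuous g}.
Proof.
move=> oU Ux fg cf; change (g @ x --> g x); rewrite -(fg _ Ux).
apply: (cvg_trans _ cf); apply: near_eq_cvg.
by apply: filterS (open_nbhs_nbhs (conj oU Ux)) => y Uy; rewrite fg.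
Qed.

Lemma differentiable_eq_on U f g x : open U -> U x ->
  (forall y, U y -> f y = g y) -> differentiable f x -> differentiable g x.
Proof.
move=> oU Ux fg df; have [dfc fE] := (diff_locallyP _ _).1 df.
have gE : g \o shift x = cst (g x) + 'd f x +o_ 0 id.
  have Uh : \forall h \near (0 : V), U (h + x).
    have := near_shift 0 x U; rewrite subr0 /= => <-.
    exact: open_nbhs_nbhs (conj oU Ux).
  apply/eqaddoP => e e0; have /eqaddoP/(_ _ e0) := fE.
  by apply: filterS2 Uh => h /= /fg gh; rewrite !fctE /= gh (fg x Ux).
(* The expansion of g has the linear part of f; uniqueness of the differential identifies that part
   with the differential of g. *)
have dgE := diff_unique dfc gE.
by apply/diff_locallyP; rewrite dgE.
Qed.

Lemma derive_dirP f x v w (c : R) : differentiable f x ->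
  'D_(c *: v + w) f x = c *: 'D_v f x + 'D_w f x.
Proof. by move=> df; rewrite !deriveE// linearP. Qed.

Lemma derive_dirD f x v w : differentiable f x ->
  'D_(v + w) f x = 'D_v f x + 'D_w f x.
Proof. by move=> df; rewrite !deriveE// linearD. Qed.

Lemma derive_dirN f x v : differentiable f x -> 'D_(- v) f x = - 'D_v f x.
Proof. by move=> df; rewrite !deriveE// linearN. Qed.

Lemma derive_dirB f x v w : differentiable f x ->
  'D_(v - w) f x = 'D_v f x - 'D_w f x.
Proof. by move=> df; rewrite !deriveE// linearB. Qed.

Lemma derive_dirZ f x v (c : R) : differentiable f x ->
  'D_(c *: v) f x = c *: 'D_v f x.
Proof. by move=> df; rewrite !deriveE// linearZ. Qed.

Lemma derive_dir_sum f x n (v : 'I_n -> V) : differentiable f x ->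
  'D_(\sum_i v i) f x = \sum_i 'D_(v i) f x.
Proof. by move=> df; rewrite deriveE// linear_sum; apply: eq_bigr => i _; rewrite deriveE. Qed.

Lemma deriveDE f g x v : differentiable f x -> differentiable g x ->
  'D_v (fun y => f y + g y) x = 'D_v f x + 'D_v g x.
Proof. by move=> df dg; apply: deriveD; apply: diff_derivable. Qed.

Lemma deriveBE f g x v : differentiable f x -> differentiable g x ->
  'D_v (fun y => f y - g y) x = 'D_v f x - 'D_v g x.
Proof. by move=> df dg; apply: deriveB; apply: diff_derivable. Qed.

Lemma deriveNE f x v : differentiable f x ->
  'D_v (fun y => - f y) x = - 'D_v f x.
Proof. by move=> df; apply: deriveN; apply: diff_derivable. Qed.

Lemma deriveZE f x v (c : R) : differentiable f x ->
  'D_v (fun y => c *: f y) x = c *: 'D_v f x.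
Proof. by move=> df; apply: deriveZ; apply: diff_derivable. Qed.

End Derivatives.

Section Chain.
Context {R : realType} {V V' W : normedModType R}.

Lemma derive_comp (f : V -> V') (g : V' -> W) x v :
  differentiable f x -> differentiable g (f x) ->
  'D_v (fun y => g (f y)) x = 'D_('D_v f x) g (f x).
Proof.
move=> df dg; rewrite !deriveE//; last exact: differentiable_comp.
by rewrite (diff_comp df dg).
Qed.

End Chain.

Section Scale.
Context {R : realType} {V W : normedModType R}.

(** Scaling is packed as a continuous bilinear map, so that the product rule becomes an instance of
    the chain rule. *)
Let scale2 (a : R^o) (w : W) : W := a *: w.
Let scale2_bilin : bilinear_for
  (GRing.Scale.Law.clone _ _ ( *:%R ) _) (GRing.Scale.Law.clone _ _ ( *:%R ) _)
  scale2.
Proof.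
split=> [u|u] c p q; rewrite /scale2 /=; first by rewrite scalerDl scalerA.
by rewrite scalerDr !scalerA mulrC.
Qed.

HB.instance Definition _ := bilinear_isBilinear.Build R _ _ _ _ _ scale2 scale2_bilin.

Lemma is_diff_scale (f : V -> R^o) (g : V -> W) x :
  differentiable f x -> differentiable g x ->
  differentiable (fun y => f y *: g y) x /\
  forall v, 'D_v (fun y => f y *: g y) x = 'D_v f x *: g x + f x *: 'D_v g x.
Proof.
move=> df dg.
have fgE : (fun y => f y *: g y) =
   (fun p : R^o * W => scale2 p.1 p.2) \o (fun y => (f y, g y)) by [].
have dp := differentiable_pair df dg.
have db : differentiable (fun p : R^o * W => scale2 p.1 p.2) (f x, g x).
  by apply: differentiable_bilin; exact: scale_continuous.
have dd : differentiable (fun y => f y *: g y) x.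
  by rewrite fgE; apply: differentiable_comp.
split=> // v; rewrite !deriveE// fgE diff_comp//=.
rewrite diff_pair// (diff_bilin (f := scale2)); last exact: scale_continuous.
by rewrite addrC.
Qed.

Lemma differentiable_scale (f : V -> R^o) (g : V -> W) x :
  differentiable f x -> differentiable g x ->
  differentiable (fun y => f y *: g y) x.
Proof. by move=> df dg; have [] := is_diff_scale df dg. Qed.

Lemma derive_scale (f : V -> R^o) (g : V -> W) x v :
  differentiable f x -> differentiable g x ->
  'D_v (fun y => f y *: g y) x = 'D_v f x *: g x + f x *: 'D_v g x.
Proof. by move=> df dg; have [] := is_diff_scale df dg. Qed.

Lemma differentiable_sumf n (f : 'I_n -> V -> W) x :
  (forall i, differentiable (f i) x) ->
  differentiable (fun y => \sum_i f i y) x.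
Proof.
move=> df; have -> : (fun y => \sum_i f i y) = \sum_i f i.
  by apply/funext => y; rewrite fct_sumE.
exact: differentiable_sum.
Qed.

Lemma derive_sumf n (f : 'I_n -> V -> W) x v :
  (forall i, differentiable (f i) x) ->
  'D_v (fun y => \sum_i f i y) x = \sum_i 'D_v (f i) x.
Proof.
move=> df; have -> : (fun y => \sum_i f i y) = \sum_i f i.
  by apply/funext => y; rewrite fct_sumE.
by rewrite derive_sum// => i; apply: diff_derivable.
Qed.

End Scale.

(** * Linear maps on row vectors and families of them *)

Section RowVector.
Context {R : realType} {n : nat} {V W : normedModType R}.
Implicit Types (L : 'rV[R]_n -> W).

Lemma linear_row_sum L : linear L ->
  forall w, L w = \sum_i w 0 i *: L (delta_mx 0 i).
Proof.
move=> lL w; pose LL : {linear _ -> _} := HB.pack L (GRing.isLinear.Build _ _ _ _ _ lL).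
rewrite -[L]/(LL : _ -> _) {1}(row_sum_delta w) linear_sum.
by apply: eq_bigr => i _; rewrite linearZ.
Qed.

Lemma differentiable_coord_row (f : V -> 'rV[R]_n) x i :
  differentiable f x -> differentiable (fun y => f y 0 i : R^o) x.
Proof.
move=> df; apply: (differentiable_comp (g := fun A : 'rV_n => A 0 i : R^o)) => //.
exact: differentiable_coord.
Qed.

Lemma derive_coord_row (f : V -> 'rV[R]_n) x v i : differentiable f x ->
  'D_v (fun y => f y 0 i : R^o) x = 'D_v f x 0 i.
Proof. by move=> df; rewrite derive_mx ?mxE//; exact: diff_derivable. Qed.

(** The Leibniz rule for a contraction such as y_i X^i: expanding X in the standard basis turns
    A(y)(X(y)) into a sum of scalars times the differentiable maps A(y)(e_i). Linearity is asked
    only on U, because the maps of Finsler geometry are linear in the vector only at points where F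
    is smooth. *)
Lemma is_diff_linear_family (U : set V) (A : V -> 'rV[R]_n -> W)
    (X : V -> 'rV[R]_n) x :
  open U -> U x -> (forall y, U y -> linear (A y)) ->
  (forall c, differentiable (A ^~ c) x) -> differentiable X x ->
  differentiable (fun y => A y (X y)) x /\
  forall v, 'D_v (fun y => A y (X y)) x = 'D_v (A ^~ (X x)) x + A x ('D_v X x).
Proof.
move=> oU Ux lA dA dX.
pose B (Y : V -> 'rV[R]_n) y := \sum_i Y y 0 i *: A y (delta_mx 0 i).
have dB Y : differentiable Y x -> differentiable (B Y) x.
  move=> dY; apply: differentiable_sumf => i; apply: differentiable_scale => //.
  exact: differentiable_coord_row.
have EB Y y : U y -> B Y y = A y (Y y).
  by move=> Uy; rewrite (linear_row_sum (lA _ Uy)).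
split; first by apply: (differentiable_eq_on oU Ux (EB X)); exact: dB.
move=> v; rewrite -(derive_eq_on _ oU Ux (EB X)).
rewrite -(derive_eq_on _ oU Ux (EB (fun=> X x))) /B !derive_sumf; last 2 first.
- by move=> i; apply: differentiable_scale.
- by move=> i; apply: differentiable_scale => //; exact: differentiable_coord_row.
rewrite (linear_row_sum (lA _ Ux)) -big_split/=; apply: eq_bigr => i _.
rewrite !derive_scale//; last exact: differentiable_coord_row.
by rewrite derive_coord_row// derive_cst scale0r add0r addrC.
Qed.

Lemma derive_linear_family (U : set V) (A : V -> 'rV[R]_n -> W)
    (X : V -> 'rV[R]_n) x v :
  open U -> U x -> (forall y, U y -> linear (A y)) ->
  (forall c, differentiable (A ^~ c) x) -> differentiable X x ->
  'D_v (fun y => A y (X y)) x = 'D_v (A ^~ (X x)) x + A x ('D_v X x).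
Proof. by move=> oU Ux lA dA dX; have [] := is_diff_linear_family oU Ux lA dA dX. Qed.

Lemma linear_row_differentiable L x : linear L -> differentiable L x.
Proof.
move=> lL; have -> : L = fun w => \sum_i w 0 i *: L (delta_mx 0 i).
  by apply/funext => w; exact: linear_row_sum.
apply: differentiable_sumf => i; apply: differentiable_scale => //.
exact: differentiable_coord.
Qed.

Lemma derive_linear_row L x v : linear L -> 'D_v L x = L v.
Proof.
move=> lL; pose LL : {linear _ -> _} := HB.pack L (GRing.isLinear.Build _ _ _ _ _ lL).
have cL : continuous (LL : _ -> _).
  by move=> y; apply: differentiable_continuous; exact: linear_row_differentiable.
rewrite -[L]/(LL : _ -> _) deriveE; last exact: linear_row_differentiable.
by rewrite diff_lin.
Qed.

End RowVector.

Section LinearComp.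
Context {R : realType} {n : nat} {V W : normedModType R}.

Lemma derive_linear_comp (L : 'rV[R]_n -> W) (f : V -> 'rV[R]_n) x v :
  linear L -> differentiable f x -> 'D_v (fun y => L (f y)) x = L ('D_v f x).
Proof.
move=> lL df; rewrite derive_comp ?derive_linear_row//.
exact: linear_row_differentiable.
Qed.

Lemma differentiable_linear_comp (L : 'rV[R]_n -> W) (f : V -> 'rV[R]_n) x :
  linear L -> differentiable f x -> differentiable (fun y => L (f y)) x.
Proof.
move=> lL df; apply: (differentiable_comp df).
exact: linear_row_differentiable.
Qed.

End LinearComp.

Section LinearFun.
Context {R : nzRingType} {V W : lmodType R}.
Variable L : V -> W.
Hypothesis lL : linear L.

(** Linearity is a hypothesis here rather than a structure on L, since for maps like [flat z] it is
    a fact depending on the membership of z in U. *)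
Lemma linear_fun0 : L 0 = 0.
Proof. by have := lL (-1) 0 0; rewrite scaler0 addr0 scaleN1r addNr. Qed.

Lemma linear_funZ k v : L (k *: v) = k *: L v.
Proof. by have := lL k v 0; rewrite linear_fun0 !addr0. Qed.

Lemma linear_funD v w : L (v + w) = L v + L w.
Proof. by have := lL 1 v w; rewrite !scale1r. Qed.

Lemma linear_funN v : L (- v) = - L v.
Proof. by rewrite -scaleN1r linear_funZ scaleN1r. Qed.

Lemma linear_funB v w : L (v - w) = L v - L w.
Proof. by rewrite linear_funD linear_funN. Qed.

Lemma linear_fun_sum n (c : 'I_n -> R) (v : 'I_n -> V) :
  L (\sum_j c j *: v j) = \sum_j c j *: L (v j).
Proof.
elim: n c v => [|n IH] c v; first by rewrite !big_ord0 linear_fun0.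
by rewrite !big_ord_recl linear_funD linear_funZ IH.
Qed.

End LinearFun.

(** * Functions of class C^k *)

Section CkTheory.
Context {R : realType} {d : nat} {W : normedModType R}.
Implicit Types (U V : set 'rV[R]_d) (f g : 'rV[R]_d -> W).

Lemma Ck_eq_on k U f g : open U -> (forall x, U x -> f x = g x) ->
  Ck k U f -> Ck k U g.
Proof.
move=> oU; elim: k f g => [|k IH] f g fg /=.
  by move=> cf x Ux; apply: (continuous_eq_on oU Ux fg); exact: cf.
move=> [df Df]; split=> [x Ux|v].
  exact: differentiable_eq_on fg (df x Ux).
apply: IH (Df v) => x Ux; exact: derive_eq_on fg.
Qed.

Lemma Ck_sub k U V f : V `<=` U -> Ck k U f -> Ck k V f.
Proof.
move=> VU; elim: k f => [|k IH] f /=; first by move=> cf x /VU; exact: cf.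
by move=> [df Df]; split=> [x /VU|v]; [exact: df|exact: IH].
Qed.

Lemma CkS k U f : Ck k.+1 U f -> Ck k U f.
Proof.
elim: k f => [|k IH] f.
  by move=> [df _] x Ux; apply: differentiable_continuous; exact: df.
by move=> [df Df]; split=> // v; apply: IH; exact: Df.
Qed.

Lemma Ck_cst k U (c : W) : Ck k U (fun=> c).
Proof.
elim: k c => [|k IH] c /=; first by move=> x _; exact: cst_continuous.
split=> [x _|v]; first exact: differentiable_cst.
rewrite (_ : (fun x => 'D_v (fun=> c) x) = fun=> 0)//.
by apply/funext => x; exact: derive_cst.
Qed.

Lemma CkD k U f g : open U -> Ck k U f -> Ck k U g ->
  Ck k U (fun x => f x + g x).
Proof.
move=> oU; elim: k f g => [|k IH] f g /=.
  by move=> cf cg x Ux; apply: continuousD; [exact: cf|exact: cg].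
move=> [df Df] [dg Dg]; split=> [x Ux|v].
  by apply: differentiableD; [exact: df|exact: dg].
apply: Ck_eq_on (IH _ _ (Df v) (Dg v)) => // x Ux.
by rewrite deriveDE//; [exact: df|exact: dg].
Qed.

Lemma Ck_sum k U n (f : 'I_n -> 'rV[R]_d -> W) : open U ->
  (forall i, Ck k U (f i)) -> Ck k U (fun x => \sum_i f i x).
Proof.
move=> oU; elim: n f => [|n IH] f Cf.
  rewrite (_ : (fun x => _) = fun=> 0); first exact: Ck_cst.
  by apply/funext => x; rewrite big_ord0.
rewrite (_ : (fun x => _) = fun x => f ord0 x + \sum_i f (lift ord0 i) x).
  by apply: CkD => //; apply: IH.
by apply/funext => x; rewrite big_ord_recl.
Qed.

End CkTheory.

Section SmoothTheory.
Context {R : realType} {d : nat} {W : normedModType R}.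
Implicit Types (U V : set 'rV[R]_d) (f g : 'rV[R]_d -> W).

Lemma Ck_scale k U (f : 'rV[R]_d -> R^o) g : open U -> Ck k U f -> Ck k U g ->
  Ck k U (fun x => f x *: g x).
Proof.
move=> oU; elim: k f g => [|k IH] f g.
  by move=> cf cg x Ux; apply: continuousZ; [exact: cf|exact: cg].
move=> Cf Cg; have [[df Df] [dg Dg]] := (Cf, Cg); split=> [x Ux|v].
  by apply: differentiable_scale; [exact: df|exact: dg].
apply: (@Ck_eq_on _ _ _ _ _ (fun x => 'D_v f x *: g x + f x *: 'D_v g x)) => //.
  by move=> x Ux; rewrite derive_scale//; [exact: df|exact: dg].
by apply: CkD => //; apply: IH; do ?[exact: Df | exact: Dg | exact: CkS].
Qed.

Lemma smooth_eq_on U f g : open U -> (forall x, U x -> f x = g x) ->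
  smooth_on U f -> smooth_on U g.
Proof. by move=> oU fg sf k; exact: Ck_eq_on (sf k). Qed.

Lemma smooth_sub U V f : V `<=` U -> smooth_on U f -> smooth_on V f.
Proof. by move=> VU sf k; exact: Ck_sub (sf k). Qed.

Lemma smooth_cst U (c : W) : smooth_on U (fun=> c).
Proof. by move=> k; exact: Ck_cst. Qed.

Lemma smoothD U f g : open U -> smooth_on U f -> smooth_on U g ->
  smooth_on U (fun x => f x + g x).
Proof. by move=> oU sf sg k; exact: CkD. Qed.

Lemma smooth_sum U n (f : 'I_n -> 'rV[R]_d -> W) : open U ->
  (forall i, smooth_on U (f i)) -> smooth_on U (fun x => \sum_i f i x).
Proof. by move=> oU sf k; apply: Ck_sum => // i; exact: sf. Qed.

Lemma smooth_scale U (f : 'rV[R]_d -> R^o) g : open U ->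
  smooth_on U f -> smooth_on U g -> smooth_on U (fun x => f x *: g x).
Proof. by move=> oU sf sg k; exact: Ck_scale. Qed.

Lemma smoothZ U (c : R) g : open U ->
  smooth_on U g -> smooth_on U (fun x => c *: g x).
Proof. by move=> oU sg; apply: smooth_scale => // k; exact: Ck_cst. Qed.

Lemma smoothN U f : open U -> smooth_on U f -> smooth_on U (fun x => - f x).
Proof.
move=> oU sf; rewrite (_ : (fun x => _) = fun x => -1 *: f x).
  exact: smoothZ.
by apply/funext => x; rewrite scaleN1r.
Qed.

Lemma smoothB U f g : open U -> smooth_on U f -> smooth_on U g ->
  smooth_on U (fun x => f x - g x).
Proof. by move=> oU sf sg; apply: smoothD => //; exact: smoothN. Qed.

Lemma smooth_differentiable U f x : smooth_on U f -> U x -> differentiable f x.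
Proof. by move=> /(_ 1%N)[df _]; exact: df. Qed.

Lemma smooth_continuous U f x : smooth_on U f -> U x -> {for x, continuous f}.
Proof. by move=> /(_ 0%N); apply. Qed.

Lemma smooth_derive U f v : smooth_on U f -> smooth_on U (fun x => 'D_v f x).
Proof. by move=> sf k; have [_] := sf k.+1; apply. Qed.

Lemma Ck_linear k U f : linear f -> Ck k U f.
Proof.
move=> lf; case: k => [|k] /=.
  by move=> x _; apply: differentiable_continuous; exact: linear_row_differentiable.
split=> [x _|v]; first exact: linear_row_differentiable.
rewrite (_ : (fun x => _) = fun=> f v); first exact: Ck_cst.
by apply/funext => x; rewrite derive_linear_row.
Qed.

Lemma smooth_linear U f : linear f -> smooth_on U f.
Proof. by move=> lf k; exact: Ck_linear. Qed.

End SmoothTheory.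

Section SmoothRow.
Context {R : realType} {d n : nat}.
Implicit Types (U : set 'rV[R]_d) (f : 'rV[R]_d -> 'rV[R]_n).

Lemma Ck_coord k U f i : open U -> Ck k U f -> Ck k U (fun x => f x 0 i : R^o).
Proof.
move=> oU; elim: k f => [|k IH] f /=.
  move=> cf x Ux; apply: (continuous_comp (g := fun A : 'rV_n => A 0 i : R^o)).
    exact: cf.
  exact: coord_continuous.
move=> [df Df]; split=> [x Ux|v].
  by apply: differentiable_coord_row; exact: df.
apply: Ck_eq_on (IH _ (Df v)) => // x Ux.
by rewrite derive_coord_row//; exact: df.
Qed.

Lemma smooth_coord U f i : open U -> smooth_on U f ->
  smooth_on U (fun x => f x 0 i : R^o).
Proof. by move=> oU sf k; exact: Ck_coord. Qed.

Lemma smooth_row U f : open U ->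
  (forall i, smooth_on U (fun x => f x 0 i : R^o)) -> smooth_on U f.
Proof.
move=> oU sf; apply: (@smooth_eq_on _ _ _ _ (fun x => \sum_i f x 0 i *: delta_mx 0 i)) => //.
  by move=> x _; rewrite -row_sum_delta.
by apply: smooth_sum => // i; apply: smooth_scale => //; exact: smooth_cst.
Qed.

End SmoothRow.

Section SmoothComp.
Context {R : realType} {d n : nat} {W : normedModType R}.
Implicit Types (U : set 'rV[R]_d) (V : set 'rV[R]_n).

Lemma Ck_comp k U V (f : 'rV[R]_d -> 'rV[R]_n) (g : 'rV[R]_n -> W) :
  open U -> (forall x, U x -> V (f x)) -> Ck k U f -> Ck k V g ->
  Ck k U (fun x => g (f x)).
Proof.
move=> oU UV; elim: k f g UV => [|k IH] f g UV.
  by move=> cf cg x Ux; apply: continuous_comp; [exact: cf|exact/cg/UV].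
move=> Cf Cg; have [[df Df] [dg Dg]] := (Cf, Cg); split=> [x Ux|v].
  by apply: differentiable_comp; [exact: df|exact/dg/UV].
(* The chain rule expanded in coordinates: the directions in which g is differentiated become
   constant, so the induction hypothesis applies to each partial derivative of g. *)
pose h i x := ('D_v f x) 0 i *: 'D_(delta_mx 0 i) g (f x).
apply: (@Ck_eq_on _ _ _ _ _ (fun x => \sum_i h i x)) => //.
  move=> x Ux; rewrite derive_comp; [|exact: df|exact/dg/UV].
  rewrite {1}(row_sum_delta ('D_v f x)) derive_dir_sum; last exact/dg/UV.
  by apply: eq_bigr => i _; rewrite derive_dirZ//; exact/dg/UV.
apply: Ck_sum => // i; apply: Ck_scale => //; last exact: IH (CkS Cf) (Dg _).
by apply: Ck_coord => //; exact: Df.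
Qed.

Lemma smooth_comp U V (f : 'rV[R]_d -> 'rV[R]_n) (g : 'rV[R]_n -> W) :
  open U -> (forall x, U x -> V (f x)) -> smooth_on U f -> smooth_on V g ->
  smooth_on U (fun x => g (f x)).
Proof. by move=> oU UV sf sg k; exact: Ck_comp (sf k) (sg k). Qed.

Lemma smooth_linear_comp U (L : 'rV[R]_n -> W) (f : 'rV[R]_d -> 'rV[R]_n) :
  open U -> linear L -> smooth_on U f -> smooth_on U (fun x => L (f x)).
Proof.
by move=> oU lL sf; apply: (@smooth_comp _ setT) => //; exact: smooth_linear.
Qed.

Lemma smooth_linear_family U (A : 'rV[R]_d -> 'rV[R]_n -> W)
    (X : 'rV[R]_d -> 'rV[R]_n) :
  open U -> (forall x, U x -> linear (A x)) ->
  (forall c, smooth_on U (A ^~ c)) -> smooth_on U X ->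
  smooth_on U (fun x => A x (X x)).
Proof.
move=> oU lA sA sX.
apply: (@smooth_eq_on _ _ _ _ (fun x => \sum_i X x 0 i *: A x (delta_mx 0 i))) => //.
  by move=> x Ux; rewrite (linear_row_sum (lA _ Ux)).
by apply: smooth_sum => // i; apply: smooth_scale => //; exact: smooth_coord.
Qed.

End SmoothComp.

Section SmoothReal.
Context {R : realType} {d : nat}.
Implicit Types (U : set 'rV[R]_d) (f g : 'rV[R]_d -> R^o).

Lemma smoothM U f g : open U -> smooth_on U f -> smooth_on U g ->
  smooth_on U ((fun x => f x * g x) : 'rV[R]_d -> R^o).
Proof. exact: smooth_scale. Qed.

Lemma CkV k U f : open U -> (forall x, U x -> f x != 0) -> Ck k U f ->
  Ck k U ((fun x => (f x)^-1) : 'rV[R]_d -> R^o).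
Proof.
move=> oU f0; elim: k => [|k IH].
  by move=> cf x Ux; apply: continuousV; [exact: f0|exact: cf].
move=> Cf; have [df Df] := Cf; split=> [x Ux|v].
  by apply: differentiableV; [exact: df|exact: f0].
(* The derivative -f'/f^2, written as iterated scalings so that the induction hypothesis for 1/f can
   be used twice. *)
pose g : 'rV[R]_d -> R^o := fun x => -1 *: ((f x)^-1 *: ((f x)^-1 *: ('D_v f x : R^o))).
apply: (@Ck_eq_on _ _ _ _ _ g) => //.
  move=> x Ux; rewrite deriveV; [|exact: f0|exact: diff_derivable (df _ Ux)].
  by rewrite /g !scalerA mulN1r -invfM -expr2.
have CV := IH (CkS Cf); rewrite {}/g.
apply: Ck_scale => //; first exact: Ck_cst.
by apply: Ck_scale => //; apply: Ck_scale => //; exact: Df.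
Qed.

Lemma smoothV U f : open U -> (forall x, U x -> f x != 0) -> smooth_on U f ->
  smooth_on U ((fun x => (f x)^-1) : 'rV[R]_d -> R^o).
Proof. by move=> oU f0 sf k; exact: CkV. Qed.

(** Induction on the size by Laplace expansion along the first row. *)
Lemma smooth_det U n (A : 'rV[R]_d -> 'M[R]_n) : open U ->
  (forall i j, smooth_on U ((fun x => A x i j) : 'rV[R]_d -> R^o)) ->
  smooth_on U ((fun x => \det (A x)) : 'rV[R]_d -> R^o).
Proof.
move=> oU; elim: n A => [|n IH] A sA.
  rewrite (_ : (fun x => _) = fun=> 1); first exact: smooth_cst.
  by apply/funext => x; rewrite det_mx00.
rewrite (_ : (fun x => _) = fun x => \sum_j A x ord0 j * cofactor (A x) ord0 j).
  apply: smooth_sum => // j; apply: smoothM => //; apply: smoothM => //.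
    exact: smooth_cst.
  apply: IH => i k; rewrite (_ : (fun x => _) = fun x => A x (lift ord0 i) (lift j k)) //.
  by apply/funext => x; rewrite !mxE.
by apply/funext => x; rewrite (expand_det_row _ ord0).
Qed.

(** Cramer's formula: on U the entries are cofactors divided by a nonvanishing determinant. *)
Lemma smooth_invmx U n (A : 'rV[R]_d -> 'M[R]_n) : open U ->
  (forall x, U x -> A x \in unitmx) ->
  (forall i j, smooth_on U ((fun x => A x i j) : 'rV[R]_d -> R^o)) ->
  forall i j, smooth_on U ((fun x => invmx (A x) i j) : 'rV[R]_d -> R^o).
Proof.
move=> oU; case: n A => [|n] A uA sA i j; first by case: i.
apply: (@smooth_eq_on _ _ _ _ ((fun x => (\det (A x))^-1 * cofactor (A x) j i) : _ -> R^o)) => //.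
  by move=> x Ux; rewrite /invmx uA// !mxE.
apply: smoothM => //.
  apply: smoothV => //; last exact: smooth_det.
  by move=> x Ux; rewrite -unitfE -unitmxE uA.
apply: smoothM => //; first exact: smooth_cst.
apply: smooth_det => // k l.
rewrite (_ : (fun x => _) = fun x => A x (lift j k) (lift i l)) //.
by apply/funext => x; rewrite !mxE.
Qed.

End SmoothReal.

(** * Symmetry of second derivatives *)

Section Schwarz.
Context {R : realType}.

(** Two uses of the mean value theorem: for s |-> f(x + hw + sv) - f(x + sv), and then for t |-> D_v
    f(x + sv + tw). The second difference on the left is symmetric in v and w, which is what makes
    it useful. *)
Lemma second_difference {V : normedModType R} (U : set V) (f : V -> R^o) x v w (h : R) :
  0 < h ->
  (forall y, U y -> differentiable f y) ->
  (forall y, U y -> differentiable (fun z => 'D_v f z) y) ->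
  (forall s t : R, 0 <= s <= h -> 0 <= t <= h -> U (x + s *: v + t *: w)) ->
  exists s t : R, [/\ 0 <= s <= h, 0 <= t <= h &
    f (x + h *: v + h *: w) - f (x + h *: v) - f (x + h *: w) + f x =
    h ^+ 2 * 'D_w (fun z => 'D_v f z) (x + s *: v + t *: w)].
Proof.
move=> h0 df dvf box.
have dline (g : V -> R^o) y u (s : R) : differentiable g (y + s *: u) ->
    is_derive s 1 (fun s => g (y + s *: u)) ('D_u g (y + s *: u)).
  move=> dg.
  have E : (fun t : R => t^-1 *: (((fun s => g (y + s *: u)) \o shift s) (t *: 1) -
                                 g (y + s *: u))) =
           (fun t => t^-1 *: ((g \o shift (y + s *: u)) (t *: u) - g (y + s *: u))).
    apply/funext => t /=; congr (_ *: (g _ - _)).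
    by rewrite [t *: 1]mulr1 scalerDl addrCA.
  by apply: DeriveDef; rewrite /derivable /derive E//; exact: diff_derivable.
have h00 : (0 : R) <= 0 <= h by apply/andP; split=> //; exact: ltW.
have hhh : 0 <= h <= h by apply/andP; split=> //; exact: ltW.
pose phi (s : R) : R := f (x + h *: w + s *: v) - f (x + s *: v).
pose dphi (s : R) : R := 'D_v f (x + h *: w + s *: v) - 'D_v f (x + s *: v).
have dphiE (s : R) : 0 <= s <= h -> is_derive s 1 phi (dphi s).
  move=> sh; apply: is_deriveB; apply: dline; apply: df.
    by rewrite addrAC; exact: box.
  by rewrite -[X in U X]addr0 -(scale0r w); exact: box.
have [||s sh E1] := @MVT _ phi dphi 0 h h0.
- by move=> s; rewrite in_itv/= => /andP[s0 s1]; apply: dphiE; rewrite !ltW.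
- apply: derivable_within_continuous => s; rewrite in_itv/= => sh.
  by have [] := dphiE _ sh.
have {}sh : 0 <= s <= h by move: sh; rewrite in_itv/= => /andP[? ?]; rewrite !ltW.
pose psi (t : R) : R := 'D_v f (x + s *: v + t *: w).
pose dpsi (t : R) : R := 'D_w (fun z => 'D_v f z) (x + s *: v + t *: w).
have dpsiE (t : R) : 0 <= t <= h -> is_derive t 1 psi (dpsi t).
  by move=> th; apply: dline; apply: dvf; exact: box.
have [||t th E2] := @MVT _ psi dpsi 0 h h0.
- by move=> t; rewrite in_itv/= => /andP[t0 t1]; apply: dpsiE; rewrite !ltW.
- apply: derivable_within_continuous => t; rewrite in_itv/= => th.
  by have [] := dpsiE _ th.
exists s, t; split=> //.
  by move: th; rewrite in_itv/= => /andP[? ?]; rewrite !ltW.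
rewrite expr2 -mulrA -/(dpsi t).
have -> : h * dpsi t = dphi s.
  rewrite mulrC -[h in LHS]subr0 -E2 /psi /dphi scale0r addr0.
  by rewrite [x + s *: v + _]addrAC.
rewrite mulrC -[h in RHS]subr0 -E1 /phi !scale0r !addr0.
by rewrite [x + h *: v + _]addrAC opprB addrA [RHS]addrAC.
Qed.

(** The same second difference, divided by h^2, is a value of D_w D_v f at one nearby point and of
    D_v D_w f at another; continuity of both at x makes them as close as desired. *)
Lemma derive_swap_real {d : nat} (U : set 'rV[R]_d) (f : 'rV[R]_d -> R^o) x v w :
  open U -> U x -> smooth_on U f ->
  'D_v (fun z => 'D_w f z) x = 'D_w (fun z => 'D_v f z) x.
Proof.
move=> oU Ux sf; apply/eqP; rewrite -subr_eq0 -normr_le0.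
apply/ler_addgt0Pr => e e0; rewrite add0r.
have e20 : 0 < e / 2 by rewrite divr_gt0.
have close a b : \forall y \near x,
    `|'D_a (fun z => 'D_b f z) x - 'D_a (fun z => 'D_b f z) y| <= e / 2.
  have := smooth_continuous (smooth_derive a (smooth_derive b sf)) Ux.
  by move=> /cvgrPdist_le; apply.
have nU : \forall y \near x, U y := open_nbhs_nbhs (conj oU Ux).
have : \forall y \near x, [/\ U y,
    `|'D_v (fun z => 'D_w f z) x - 'D_v (fun z => 'D_w f z) y| <= e / 2 &
    `|'D_w (fun z => 'D_v f z) x - 'D_w (fun z => 'D_v f z) y| <= e / 2].
  by apply: filterS3 nU (close v w) (close w v).
move=> /nbhs_ballP[r /= r0 ball_r].
(* With this h, all points x + sv + tw with s and t in [0, h] stay in the ball of radius r; the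
   added 1 keeps the denominator positive when v = w = 0. *)
pose h := r / (2 * (`|v| + `|w| + 1)).
have nz : 0 < `|v| + `|w| + 1 by rewrite ltr_wpDl// addr_ge0.
have h0 : 0 < h by rewrite divr_gt0// mulr_gt0.
have box a b s t : `|a| + `|b| = `|v| + `|w| -> 0 <= s <= h -> 0 <= t <= h ->
    ball x r (x + s *: a + t *: b).
  move=> ab /andP[s0 sh] /andP[t0 th]; rewrite -ball_normE /= -addrA opprD addNKr normrN.
  apply: (le_lt_trans (ler_normD _ _)); rewrite !normrZ !ger0_norm//.
  apply: (@le_lt_trans _ _ (h * (`|a| + `|b|))).
    by rewrite mulrDr lerD// ler_wpM2r.
  rewrite ab /h mulrAC ltr_pdivrMr ?mulr_gt0// ltr_pM2l//.
  by rewrite mulr_natl mulr2n; have := normr_ge0 v; have := normr_ge0 w; lra.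
have boxU a b : `|a| + `|b| = `|v| + `|w| -> forall s t,
    0 <= s <= h -> 0 <= t <= h -> U (x + s *: a + t *: b).
  by move=> ab s t sh th; have [] := ball_r _ (box _ _ _ _ ab sh th).
move: h0 boxU box; clearbody h; move=> h0 boxU box.
have df y : U y -> differentiable f y by exact: smooth_differentiable.
have d2f a y : U y -> differentiable (fun z => 'D_a f z) y.
  by apply: smooth_differentiable; exact: smooth_derive.
have [s [t [sh th E1]]] := second_difference h0 df (d2f v) (boxU v w erefl).
have [s' [t' [sh' th' E2]]] := second_difference h0 df (d2f w) (boxU w v (addrC _ _)).
have [_ _ c1] := ball_r _ (box v w _ _ erefl sh th).
have [_ c2 _] := ball_r _ (box w v _ _ (addrC _ _) sh' th').
(* Both mixed derivatives, each at its own intermediate point, times h^2 give the same second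
   difference. *)
have E : 'D_w (fun z => 'D_v f z) (x + s *: v + t *: w) =
         'D_v (fun z => 'D_w f z) (x + s' *: w + t' *: v).
  have E12 : f (x + h *: v + h *: w) - f (x + h *: v) - f (x + h *: w) + f x =
      f (x + h *: w + h *: v) - f (x + h *: w) - f (x + h *: v) + f x.
    by rewrite (addrAC x) [_ - f _ - _ in LHS]addrAC.
  have hh : h ^+ 2 != 0 by rewrite expf_neq0// gt_eqF.
  exact: (mulfI hh (etrans (esym E1) (etrans E12 E2))).
rewrite {}E in c1.
move: ('D_v (fun z => 'D_w f z) x) ('D_w (fun z => 'D_v f z) x)
  ('D_v (fun z => 'D_w f z) (x + s' *: w + t' *: v)) c1 c2 => a b c c1 c2.
have -> : a - b = (a - c) - (b - c) by rewrite opprB addrA subrK.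
apply: (le_trans (ler_normB _ _)); apply: (le_trans (lerD c2 c1)).
by rewrite -splitr.
Qed.

Lemma derive_swap {d n : nat} (U : set 'rV[R]_d) (f : 'rV[R]_d -> 'rV[R]_n) x v w :
  open U -> U x -> smooth_on U f ->
  'D_v (fun z => 'D_w f z) x = 'D_w (fun z => 'D_v f z) x.
Proof.
move=> oU Ux sf; apply/rowP => i.
have swapE a b : 'D_a (fun z => 'D_b f z) x 0 i =
    'D_a (fun z => 'D_b (fun y => f y 0 i : R^o) z) x.
  rewrite -derive_coord_row; last first.
    exact: smooth_differentiable (smooth_derive b sf) Ux.
  apply: (derive_eq_on _ oU Ux) => y Uy; rewrite derive_coord_row//.
  exact: smooth_differentiable sf Uy.
apply: (etrans (swapE v w)); apply: (etrans _ (esym (swapE w v))).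
apply: (derive_swap_real _ _ oU Ux).
exact: smooth_coord.
Qed.

End Schwarz.

(** * Tangent vectors and brackets in an atlas *)

Section SmoothLocal.
Context {R : realType} {d : nat} {W : normedModType R}.

(** [smooth_on V] constrains the derivatives of the total function at the points of V, so the sets V
    may be arbitrary sets containing the points in question. *)
Lemma smooth_local (U : set 'rV[R]_d) (f : 'rV[R]_d -> W) :
  (forall x, U x -> exists2 V, V x & smooth_on V f) -> smooth_on U f.
Proof.
move=> loc k; elim: k f loc => [|k IH] f loc /=.
  by move=> x /loc[V Vx sf]; exact: smooth_continuous sf Vx.
split=> [x /loc[V Vx sf]|v]; first exact: smooth_differentiable sf Vx.
by apply: IH => x /loc[V Vx sf]; exists V => //; exact: smooth_derive.
Qed.

Lemma open_preimage_on {V : normedModType R} (U : set V) (B : set W) (f : V -> W) :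
  open U -> open B -> (forall x, U x -> {for x, continuous f}) ->
  open (U `&` f @^-1` B).
Proof.
move=> oU oB cf; rewrite openE => x [Ux Bfx].
rewrite /interior; apply: filterI; first exact: open_nbhs_nbhs.
by apply: (cf x Ux); exact: open_nbhs_nbhs.
Qed.

End SmoothLocal.

Section AtlasTheory.
Context {R : realType} {d : nat} {N : atlas R d}.
Hypothesis sN : smooth_atlas N.
Implicit Types (a b c : chart N) (p q : point_of N) (U : set (point_of N)).
Implicit Types (x v w : 'rV[R]_d).

Lemma coordK a p : dom a p -> coord_inv a (coord a p) = p.
Proof. by have [_ + _ _] := sN; apply. Qed.

Lemma dom_carrier a p : dom a p -> carrier N p.
Proof. by have [<- _ _ _] := sN; exists a. Qed.

Lemma carrier_dom p : carrier N p -> exists a, dom a p.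
Proof. by have [<- _ _ _] := sN => -[a _ ap]; exists a. Qed.

Lemma open_overlap a b : open (coord a @` (dom a `&` dom b)).
Proof. by have [_ _ + _] := sN; apply. Qed.

Lemma open_chart a : open (coord a @` dom a).
Proof. by rewrite -[dom a]setIid; exact: open_overlap. Qed.

Lemma smooth_transition a b :
  smooth_on (coord a @` (dom a `&` dom b)) (transition a b).
Proof. by have [_ _ _] := sN; apply. Qed.

Lemma transition_coord a b p : dom a p -> transition a b (coord a p) = coord b p.
Proof. by move=> ap; rewrite /transition coordK. Qed.

Lemma chart_overlap a b p : dom a p -> dom b p ->
  (coord a @` (dom a `&` dom b)) (coord a p).
Proof. by move=> ap bp; exists p. Qed.

Lemma imageP a (A : set (point_of N)) x : (coord a @` (dom a `&` A)) x ->
  [/\ dom a (coord_inv a x), A (coord_inv a x) & coord a (coord_inv a x) = x].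
Proof. by move=> [p [ap Ap] <-]; rewrite coordK. Qed.

Lemma differentiable_transition a b p : dom a p -> dom b p ->
  differentiable (transition a b) (coord a p).
Proof.
move=> ap bp; apply: (smooth_differentiable (@smooth_transition a b)).
exact: chart_overlap.
Qed.

Lemma derive_transition_comp a b c p v : dom a p -> dom b p -> dom c p ->
  'D_('D_v (transition a b) (coord a p)) (transition b c) (coord b p) =
  'D_v (transition a c) (coord a p).
Proof.
move=> ap bp cp; rewrite -(transition_coord b ap) -derive_comp.
(* The composition law of transition maps holds on the whole overlap of a and b, even at points
   outside c. *)
- apply: (derive_eq_on _ (@open_overlap a b) (chart_overlap ap bp)).
  move=> x /imageP[ax bx _].
  by rewrite /transition coordK.
- exact: differentiable_transition.
- by rewrite transition_coord//; exact: differentiable_transition.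
Qed.

Lemma derive_transition_id a p v : dom a p ->
  'D_v (transition a a) (coord a p) = v.
Proof.
move=> ap; rewrite -[RHS](derive_id (coord a p) v).
apply: (derive_eq_on _ (@open_overlap a a) (chart_overlap ap ap)).
by move=> x /imageP[].
Qed.

Lemma chartwiseE (f : chart N -> 'rV[R]_d) p a : dom a p -> chartwise f p a = f a.
Proof. by move=> ap; rewrite /chartwise asboolT. Qed.

Lemma chartwiseN (f : chart N -> 'rV[R]_d) p a : ~ dom a p -> chartwise f p a = 0.
Proof. by move=> ap; rewrite /chartwise asboolF. Qed.

Lemma tangent_eq p (v w : tvec N) a : dom a p -> tangent p v -> tangent p w ->
  v a = w a -> v = w.
Proof.
move=> ap [v0 vt] [w0 wt] vw; apply/funext => b.
have [bp|bp] := pselect (dom b p); last by rewrite v0// w0.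
by have := vt a b ap bp; have := wt a b ap bp; rewrite vw => -> ->.
Qed.

Lemma tangent_chartwise (f : chart N -> 'rV[R]_d) p :
  (forall a b, dom a p -> dom b p ->
    f b = 'D_(f a) (transition a b) (coord a p)) ->
  tangent p (chartwise f p).
Proof.
move=> fE; split=> [a ap|a b ap bp]; first exact: chartwiseN.
by rewrite !chartwiseE//; exact: fE.
Qed.

(** With v the fibre coordinate, this is the vector part of [coord_inv] for the tangent bundle,
    parametrized by the base point instead of its coordinates. *)
Definition tangent_of a v p : tvec N :=
  chartwise (fun b => 'D_v (transition a b) (coord a p)) p.

Lemma tangent_ofP a v p : dom a p -> tangent p (tangent_of a v p).
Proof.
by move=> ap; apply: tangent_chartwise => b c bp cp; rewrite derive_transition_comp.
Qed.

Lemma tangent_ofE a v p : dom a p -> tangent_of a v p a = v.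
Proof. by move=> ap; rewrite /tangent_of chartwiseE// derive_transition_id. Qed.

Lemma tangentP p (v w : tvec N) (k : R) :
  tangent p v -> tangent p w -> tangent p (k *: v + w).
Proof.
move=> [v0 vt] [w0 wt]; split=> [a ap|a b ap bp].
  by rewrite !fctE v0// w0// scaler0 addr0.
rewrite !fctE; have -> := derive_dirP (v a) (w a) k (differentiable_transition ap bp).
by rewrite -(vt a b ap bp) -(wt a b ap bp).
Qed.

Lemma tangent0 p : tangent p (0 : tvec N).
Proof. by split=> // a b _ _; rewrite derive0. Qed.

Lemma tangentD p (v w : tvec N) : tangent p v -> tangent p w -> tangent p (v + w).
Proof. by move=> vt wt; rewrite -[v]scale1r; exact: tangentP. Qed.

Lemma tangentZ p (k : R) (v : tvec N) : tangent p v -> tangent p (k *: v).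
Proof.
by move=> vt; have := tangentP k vt (tangent0 p); rewrite addr0.
Qed.

Lemma tangent_sum p n (k : 'I_n -> R) (v : 'I_n -> tvec N) :
  (forall i, tangent p (v i)) -> tangent p (\sum_i k i *: v i).
Proof.
move=> vt; elim/big_ind: _ => [|u w ut wt|i _]; first exact: tangent0.
- exact: tangentD.
- exact: tangentZ.
Qed.

Lemma tangent_nz p (v : tvec N) a : dom a p -> tangent p v -> v <> 0 -> v a <> 0.
Proof. by move=> ap vt v0 va; apply: v0; exact: (tangent_eq ap vt (tangent0 p)). Qed.

(** Openness has to be tested in every chart b; there the image is the part of the overlap that the
    transition map sends into B. *)
Lemma open_in_chart a (B : set 'rV[R]_d) : open B ->
  open_in [set p | dom a p /\ B (coord a p)].
Proof.
move=> oB; split=> [p [/dom_carrier]|b] //.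
rewrite (_ : _ @` _ = coord b @` (dom b `&` dom a) `&` (transition b a @^-1` B)).
  apply: open_preimage_on => //; first exact: open_overlap.
  by move=> x; exact: smooth_continuous (@smooth_transition b a).
apply/seteqP; split=> [x [p [bp [ap Bp]] <-]|x [[p [bp ap] <-]]] /=.
  by split; [exact: chart_overlap|rewrite transition_coord].
by rewrite transition_coord// => Bp; exists p.
Qed.

Lemma open_in_carrier : open_in (carrier N).
Proof.
split=> // a; rewrite (_ : dom a `&` carrier N = dom a); first exact: open_chart.
by apply/seteqP; split=> [p []//|p ap]; split=> //; exact: dom_carrier ap.
Qed.

Lemma open_inI U (V : set (point_of N)) : open_in U -> open_in V -> open_in (U `&` V).
Proof.
move=> [UN oU] [_ oV]; split=> [p []/UN//|a].
rewrite (_ : _ @` _ = coord a @` (dom a `&` U) `&` coord a @` (dom a `&` V)).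
  exact: openI.
apply/seteqP; split=> [x [p [ap [Up Vp]] <-]|x [[p [ap Up] <-]] [q [aq Vq]]].
  by split; exists p.
(* The image of an intersection is the intersection of the images because [coord a] is injective on
   [dom a]. *)
move=> /(congr1 (coord_inv a)); rewrite !coordK// => pq.
by exists p => //; split=> //; rewrite -pq; split=> //; rewrite pq.
Qed.

Lemma open_in_dom a : open_in (dom a).
Proof.
rewrite (_ : dom a = [set p | dom a p /\ setT (coord a p)]).
  by apply: open_in_chart; exact: openT.
by apply/seteqP; split=> [p|p []].
Qed.

Lemma local_rep_transition U (X : field N) a b x : (forall p, U p -> tangent p (X p)) ->
  (coord b @` (dom b `&` (dom a `&` U))) x ->
  local_rep X b x =
  'D_(local_rep X a (transition b a x)) (transition a b) (transition b a x).
Proof.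
move=> tX [p [bp [ap Up]] <-]; rewrite transition_coord// /local_rep !coordK//.
by have [_ XE] := tX _ Up; rewrite (XE a b).
Qed.

(** One chart around each point suffices: in another chart b the components are the differential of
    the transition map applied to the components in a, a smooth family of linear maps applied to a
    smooth map. *)
Lemma smooth_field_chart U (X : field N) : open_in U ->
  (forall p, U p -> tangent p (X p)) ->
  (forall p, U p -> exists2 a, dom a p &
     smooth_on (coord a @` (dom a `&` U)) (local_rep X a)) ->
  smooth_field_on U X.
Proof.
move=> oU tX sX; split=> // b; apply: smooth_local => x [p [bp Up] <-].
have [a ap sXa] := sX p Up.
exists (coord b @` (dom b `&` (dom a `&` U))); first by exists p.
have oV : open (coord b @` (dom b `&` (dom a `&` U))).
  by have [_] := open_inI (open_in_dom a) oU; apply.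
have sT : smooth_on (coord b @` (dom b `&` (dom a `&` U))) (transition b a).
  apply: smooth_sub (@smooth_transition b a) => y [q [bq [aq Uq]] <-].
  exact: chart_overlap.
apply: (smooth_eq_on oV (fun y Vy => esym (local_rep_transition tX Vy))).
apply: (@smooth_linear_family _ _ _ _ _ (fun y v => 'D_v (transition a b) (transition b a y))
  (fun y => local_rep X a (transition b a y))) => //.
- move=> y [q [bq [aq Uq]] <-] k v w; rewrite derive_dirP// transition_coord//.
  exact: differentiable_transition.
- move=> v; apply: (smooth_comp (V := coord a @` (dom a `&` dom b))
    (f := transition b a) (g := 'D_v (transition a b))) => //.
    by move=> y [q [bq [aq Uq]] <-]; rewrite transition_coord//; exact: chart_overlap.
  by apply: smooth_derive; exact: smooth_transition.
- apply: (smooth_comp (V := coord a @` (dom a `&` U))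
    (f := transition b a) (g := local_rep X a)) => //.
  by move=> y [q [bq [aq Uq]] <-]; rewrite transition_coord//; exists q.
Qed.

Lemma smooth_fieldD U (X Y : field N) : open_in U ->
  smooth_field_on U X -> smooth_field_on U Y ->
  smooth_field_on U (fun p => X p + Y p).
Proof.
move=> [_ oU] [tX sX] [tY sY]; split=> [p Up|a].
  by apply: tangentD; [exact: tX|exact: tY].
exact: (smoothD (oU a)).
Qed.

Lemma smooth_fieldN U (X : field N) : open_in U ->
  smooth_field_on U X -> smooth_field_on U (fun p => - X p).
Proof.
move=> [_ oU] [tX sX]; split=> [p Up|a].
  by rewrite -scaleN1r; apply: tangentZ; exact: tX.
exact: (smoothN (oU a)).
Qed.

Lemma differentiable_local_rep U (X : field N) a p : smooth_field_on U X ->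
  dom a p -> U p -> differentiable (local_rep X a) (coord a p).
Proof.
by move=> [_ sX] ap Up; apply: smooth_differentiable (sX a) _; exists p.
Qed.

(* Differentiate [local_rep_transition] along X and antisymmetrize: the second
   derivatives of the transition map cancel. *)
Lemma smooth_bracket U (X Y : field N) : open_in U ->
  smooth_field_on U X -> smooth_field_on U Y -> smooth_field_on U (bracket X Y).
Proof.
move=> oU sX sY.
have D1 (Z T : field N) a b p : smooth_field_on U Z -> smooth_field_on U T ->
    dom a p -> dom b p -> U p ->
    'D_(Z p b) (local_rep T b) (coord b p) =
    'D_(Z p a) (fun x => 'D_(T p a) (transition a b) x) (coord a p) +
    'D_('D_(Z p a) (local_rep T a) (coord a p)) (transition a b) (coord a p).
  move=> sZ sT ap bp Up.
  have oV : open (coord a @` (dom a `&` (dom b `&` U))).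
    by have [_] := open_inI (open_in_dom b) oU; apply.
  have Vp : (coord a @` (dom a `&` (dom b `&` U))) (coord a p) by exists p.
  have [[tZ _] [tT _]] := (sZ, sT).
  have [_ ZE] := tZ _ Up.
  rewrite (ZE a b)// -(transition_coord b ap) -derive_comp; last 2 first.
  - exact: differentiable_transition.
  - by rewrite transition_coord//; exact: differentiable_local_rep sT bp Up.
  pose A x v := 'D_v (transition a b) x.
  have lA y : (coord a @` (dom a `&` (dom b `&` U))) y -> linear (A y).
    move=> [q [aq [bq Uq]] <-] k v w; apply: derive_dirP.
    exact: differentiable_transition.
  have dA v : differentiable (A ^~ v) (coord a p).
    apply: smooth_differentiable (smooth_derive v (@smooth_transition a b)) _.
    exact: chart_overlap.
  have dT := differentiable_local_rep sT ap Up.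
  have L := derive_linear_family (Z p a) oV Vp lA dA dT.
  rewrite {2}/local_rep coordK// in L.
  rewrite -[RHS]L; apply: (derive_eq_on _ oV Vp).
  move=> x [q [aq [bq Uq]] <-]; rewrite transition_coord// /A /local_rep !coordK//.
  have [_ TE] := tT _ Uq; exact: TE.
apply: smooth_field_chart => //.
  move=> p Up; apply: tangent_chartwise => a b ap bp.
  rewrite (D1 X Y a b)// (D1 Y X a b)// derive_dirB; last exact: differentiable_transition.
  rewrite (derive_swap _ _ (@open_overlap a b) (chart_overlap ap bp) (@smooth_transition a b)).
  by rewrite opprD addrACA subrr add0r.
move=> p Up; have [UN oUc] := oU; have [a ap] := carrier_dom (UN _ Up).
exists a => //.
have [[_ sXa] [_ sYa]] := (sX, sY); move: {sXa sYa} (sXa a) (sYa a) => sXa sYa.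
have half (F G : 'rV[R]_d -> 'rV[R]_d) : smooth_on (coord a @` (dom a `&` U)) F ->
    smooth_on (coord a @` (dom a `&` U)) G ->
    smooth_on (coord a @` (dom a `&` U)) (fun x => 'D_(F x) G x).
  move=> sF sG.
  apply: (@smooth_linear_family _ _ _ _ _ (fun x v => 'D_v G x)) => //.
  - move=> x Vx k v w; rewrite derive_dirP//.
    exact: smooth_differentiable sG Vx.
  - by move=> v; exact: smooth_derive.
apply: (smooth_eq_on (oUc a)); last exact: (smoothB (oUc a) (half _ _ sXa sYa) (half _ _ sYa sXa)).
move=> x /imageP[ax _ xE] /=.
by apply/esym; apply: etrans (chartwiseE _ ax) _; rewrite xE.
Qed.

End AtlasTheory.

(** * Separation and countability from charts *)

Section AtlasTopology.
Context {R : realType} {d : nat} {N : atlas R d}.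
Hypothesis sN : smooth_atlas N.
Implicit Types (a b : chart N) (p q : point_of N).

Lemma chart_separated a p q : dom a p -> dom a q -> p <> q ->
  exists A B, [/\ open_in A, open_in B, A p, B q & A `&` B = set0].
Proof.
move=> ap aq pq.
have : coord a p != coord a q.
  apply/eqP => E; apply: pq.
  by rewrite -(coordK sN ap) E coordK.
have := @norm_hausdorff R 'rV[R]_d; rewrite open_hausdorff => H /H.
move=> [[A B] /= [pA qB] [oA oB AB]].
exists [set p | dom a p /\ A (coord a p)], [set p | dom a p /\ B (coord a p)].
split; try exact: open_in_chart.
- by split=> //; exact: set_mem.
- by split=> //; exact: set_mem.
apply/seteqP; split=> // x [[ax Ax] [_ Bx]].
suff : (A `&` B) (coord a x) by rewrite (eqP AB).
by split.
Qed.

Lemma rat_ball (x : 'rV[R]_d) (e : R) : 0 < e ->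
  exists q : 'rV[rat]_d, ball (map_mx ratr q : 'rV[R]_d) e x.
Proof.
move=> e0.
have H i : {r : rat | `|ratr r - x 0 i| < e}.
  apply: cid; have lt : x 0 i - e < x 0 i + e by lra.
  have [r] := rat_in_itvoo lt; rewrite in_itv/= => /andP[r1 r2].
  by exists r; rewrite ltr_norml; apply/andP; split; lra.
exists (\row_i sval (H i)); split=> // i j.
rewrite !mxE (ord1 i).
exact: (svalP (H j)).
Qed.

(** The base consists of the pullbacks, by countably many charts, of balls with rational centre and
    radius 1/(r+1). Triples (chart index, centre, r) are coded by natural numbers; numbers that code
    no triple, and indices that name no chart, give the empty set. *)
Lemma second_countable_atlas (c : nat -> option (chart N)) :
  (forall p, carrier N p -> exists i a, c i = Some a /\ dom a p) ->
  second_countable_manifold N.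
Proof.
move=> cover.
pose B k : set (point_of N) :=
  if unpickle k is Some (i, q, r) then
    if c i is Some a then
      [set p | dom a p /\
        ball (map_mx ratr (q : 'rV[rat]_d) : 'rV[R]_d) (r.+1%:R^-1 : R) (coord a p)]
    else set0
  else set0.
have o0 : open_in (set0 : set (point_of N)).
  by split=> // a; rewrite setI0 image_set0; exact: open0.
exists B; split=> [k|A p [AN oA] Ap].
  rewrite /B; case: unpickle => [[[i q] r]|//]; case: (c i) => [a|//].
  by apply: open_in_chart => //; exact: ball_open.
have [i [a [ci ap]]] := cover p (AN _ Ap).
have xA : (coord a @` (dom a `&` A)) (coord a p) by exists p.
have /nbhs_ballP[e /= e0 eA] := open_nbhs_nbhs (conj (oA a) xA).
(* Half of e: the two points to be compared both lie in a ball of this radius about the rational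
   centre. *)
have [r re] : exists r : nat, (r.+1%:R^-1 : R) < e / 2.
  have [r hr] := ltr_add_invr (y := 0) (x := e / 2) (divr_gt0 e0 (ltr0Sn _ 1)).
  by exists r; rewrite add0r in hr.
have r0 : 0 < r.+1%:R^-1 :> R by rewrite invr_gt0.
have [q qx] := rat_ball (coord a p) r0.
exists (pickle (i, q, r)); rewrite /B pickleK ci//= => p' [ap' qx'].
have [|p'' [ap'' Ap'']] := eA (coord a p').
  apply: (@ball_splitr _ _ (map_mx ratr q : 'rV[R]_d)); apply: le_ball (ltW re) _ _ => //.
move=> /(congr1 (coord_inv a)); rewrite !coordK// => <- //.
Qed.

End AtlasTopology.

(** * The slit tangent bundle *)

Section TangentMap.
Context {R : realType} {m : nat}.
Implicit Types (x y v : 'rV[R]_m) (z w : 'rV[R]_(m + m)).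

(* The vectors v^i d/dx^i and v^i d/dy^i of the coordinates (x, y). *)
Definition xvec v : 'rV[R]_(m + m) := row_mx v 0.
Definition yvec v : 'rV[R]_(m + m) := row_mx 0 v.

Lemma row_mx_xyvec v y : row_mx v y = xvec v + yvec y.
Proof. by rewrite add_row_mx addr0 add0r. Qed.

Lemma linear_lsubmx : linear (lsubmx : 'rV[R]_(m + m) -> 'rV[R]_m).
Proof. by move=> k z w; rewrite linearP. Qed.

Lemma linear_rsubmx : linear (rsubmx : 'rV[R]_(m + m) -> 'rV[R]_m).
Proof. by move=> k z w; rewrite linearP. Qed.

Lemma linear_xvec : linear xvec.
Proof. by move=> k v w; rewrite /xvec scale_row_mx add_row_mx scaler0 addr0. Qed.

Lemma linear_yvec : linear yvec.
Proof. by move=> k v w; rewrite /yvec scale_row_mx add_row_mx scaler0 addr0. Qed.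

Definition over (U : set 'rV[R]_m) : set 'rV[R]_(m + m) := [set z | U (lsubmx z)].

Lemma open_over U : open U -> open (over U).
Proof.
move=> oU; rewrite (_ : over U = setT `&` lsubmx @^-1` U); last by rewrite setTI.
apply: (@open_preimage_on R 'rV[R]_m 'rV[R]_(m + m) setT U lsubmx openT oU).
move=> z _; apply: differentiable_continuous.
exact: linear_row_differentiable linear_lsubmx.
Qed.

Lemma open_rsubmx_neq0 : open [set z : 'rV[R]_(m + m) | rsubmx z <> 0].
Proof.
rewrite (_ : mkset _ = setT `&` rsubmx @^-1` (~` [set 0])); last by rewrite setTI.
have o0 : open (~` [set (0 : 'rV[R]_m)]).
  rewrite openC; apply: accessible_closed_set1.
  by apply: hausdorff_accessible; exact: norm_hausdorff.
apply: (@open_preimage_on R 'rV[R]_m 'rV[R]_(m + m) setT _ rsubmx openT o0).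
move=> z _; apply: differentiable_continuous.
exact: linear_row_differentiable linear_rsubmx.
Qed.

(** The tangent map (x, y) |-> (phi(x), d phi(x) y); for a transition map of M it is the induced
    transition map of TM. *)
Definition tmap (phi : 'rV[R]_m -> 'rV[R]_m) z : 'rV[R]_(m + m) :=
  row_mx (phi (lsubmx z)) ('D_(rsubmx z) phi (lsubmx z)).

Variables (phi : 'rV[R]_m -> 'rV[R]_m) (U : set 'rV[R]_m).
Hypotheses (oU : open U) (sphi : smooth_on U phi).

Let dphi x : U x -> differentiable phi x.
Proof. exact: smooth_differentiable. Qed.

Lemma linear_derive_over z : over U z -> linear (fun v => 'D_v phi (lsubmx z)).
Proof. by move=> Uz k v w; apply: derive_dirP; exact: dphi. Qed.

Lemma smooth_derive_over v : smooth_on (over U) (fun z => 'D_v phi (lsubmx z)).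
Proof.
apply: (smooth_comp (V := U) (f := lsubmx) (g := 'D_v phi)) => //.
- exact: open_over.
- exact: smooth_linear linear_lsubmx.
- exact: smooth_derive.
Qed.

Lemma smooth_tmap : smooth_on (over U) (tmap phi).
Proof.
have oV := open_over oU.
pose A z v := 'D_v phi (lsubmx z).
apply: (smooth_eq_on (f := fun z => xvec (phi (lsubmx z)) + yvec (A z (rsubmx z)))) => //.
  by move=> z Uz; rewrite -row_mx_xyvec.
apply: smoothD => //.
  apply: smooth_linear_comp => //; first exact: linear_xvec.
  apply: (smooth_comp (V := U) (f := lsubmx)) => //.
  exact: smooth_linear linear_lsubmx.
apply: smooth_linear_comp => //; first exact: linear_yvec.
apply: (smooth_linear_family (A := A)) => //.
- exact: linear_derive_over.
- exact: smooth_derive_over.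
- exact: smooth_linear linear_rsubmx.
Qed.

(** The fibre component picks up a second derivative of [phi], since the coefficients of d phi(x) y
    also vary with x. This term is the source of the inhomogeneous transformation law of N. *)
Lemma derive_tmap z w : over U z ->
  'D_w (tmap phi) z = row_mx ('D_(lsubmx w) phi (lsubmx z))
    ('D_(lsubmx w) (fun x => 'D_(rsubmx z) phi x) (lsubmx z) +
     'D_(rsubmx w) phi (lsubmx z)).
Proof.
move=> Uz; have oV := open_over oU.
pose A z v := 'D_v phi (lsubmx z).
have dl : differentiable (lsubmx : 'rV[R]_(m + m) -> 'rV[R]_m) z.
  exact: linear_row_differentiable linear_lsubmx.
have dr : differentiable (rsubmx : 'rV[R]_(m + m) -> 'rV[R]_m) z.
  exact: linear_row_differentiable linear_rsubmx.
have d1 : differentiable (fun z => phi (lsubmx z)) z.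
  by apply: (differentiable_comp dl); exact: dphi.
have dA v : differentiable (A ^~ v) z.
  exact: smooth_differentiable (@smooth_derive_over v) Uz.
have [d2 D2] := is_diff_linear_family oV Uz linear_derive_over dA dr.
rewrite (derive_eq_on (g := fun z => xvec (phi (lsubmx z)) + yvec (A z (rsubmx z))) _ oV Uz);
  last by move=> z' _; rewrite -row_mx_xyvec.
rewrite deriveDE; last 2 first.
- by apply: differentiable_linear_comp d1; exact: linear_xvec.
- by apply: differentiable_linear_comp d2; exact: linear_yvec.
rewrite (derive_linear_comp w linear_xvec d1) (derive_linear_comp w linear_yvec d2).
have dDy := smooth_differentiable (smooth_derive (rsubmx z) sphi) Uz.
have DA : 'D_w (A ^~ (rsubmx z)) z = 'D_(lsubmx w) ('D_(rsubmx z) phi) (lsubmx z).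
  have := derive_comp w dl dDy.
  by rewrite (derive_linear_row _ _ linear_lsubmx).
rewrite D2 DA (derive_linear_row _ _ linear_rsubmx) -row_mx_xyvec.
have := derive_comp w dl (dphi Uz).
by rewrite (derive_linear_row _ _ linear_lsubmx) => ->.
Qed.

End TangentMap.

Section SlitTangentBundle.
Context {R : realType} {m : nat} {M : atlas R m}.
Hypothesis sM : smooth_atlas M.
Local Notation TM := (tangent_bundle M).
Local Notation T0M := (slit_tangent_bundle M).
Implicit Types (a b : chart M) (p : point_of M) (u : point_of T0M).
Implicit Types (z w : 'rV[R]_(m + m)) (A : set (point_of M)).

Lemma T0M_coord_inv a z : dom a (coord_inv a (lsubmx z)) ->
  coord a (coord_inv a (lsubmx z)) = lsubmx z ->
  @coord_inv _ _ T0M a z =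
  (coord_inv a (lsubmx z), tangent_of a (rsubmx z) (coord_inv a (lsubmx z))).
Proof. by move=> ax xE; rewrite /tangent_of xE. Qed.

(** A tangent vector is zero as soon as its component in one chart is, so removing the null section
    removes exactly y = 0 in each chart. *)
Lemma T0M_image a A z :
  (@coord _ _ T0M a @` (@dom _ _ T0M a `&` [set u | A u.1])) z <->
  (coord a @` (dom a `&` A)) (lsubmx z) /\ rsubmx z <> 0.
Proof.
split=> [[u [[[au tu] u0] Au] <-]|[/(imageP sM)[ax Ax xE] z0]].
  rewrite /= row_mxKl row_mxKr; split; first by exists u.1.
  exact: (tangent_nz au tu u0).
exists (@coord_inv _ _ T0M a z); last first.
  by rewrite T0M_coord_inv//= xE tangent_ofE// hsubmxK.
rewrite T0M_coord_inv//; split=> //; split; first by split=> //=; exact: tangent_ofP.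
by move=> /= /(congr1 (@^~ a)); rewrite tangent_ofE.
Qed.

Lemma T0M_overlap a b z :
  (@coord _ _ T0M a @` (@dom _ _ T0M a `&` @dom _ _ T0M b)) z <->
  (coord a @` (dom a `&` dom b)) (lsubmx z) /\ rsubmx z <> 0.
Proof.
rewrite -T0M_image; split=> [[u [au [[bu _] _]] <-]|[u [au bu] <-]]; exists u => //.
by case: (au) => -[_ tu] u0; split.
Qed.

Lemma T0M_chart a z : (@coord _ _ T0M a @` @dom _ _ T0M a) z <->
  (coord a @` dom a) (lsubmx z) /\ rsubmx z <> 0.
Proof.
by have := T0M_overlap a a z; rewrite !setIid.
Qed.

Lemma T0M_transition a b z : (coord a @` (dom a `&` dom b)) (lsubmx z) ->
  @transition _ _ T0M a b z = tmap (@transition _ _ M a b) z.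
Proof.
by move=> /(imageP sM)[ax bx xE]; rewrite /transition/= chartwiseE.
Qed.

Lemma open_T0M_image a A : open (coord a @` (dom a `&` A)) ->
  open (@coord _ _ T0M a @` (@dom _ _ T0M a `&` [set u | A u.1])).
Proof.
move=> oA; rewrite (_ : _ @` _ =
   over (coord a @` (dom a `&` A)) `&` [set z | rsubmx z <> 0]).
  by apply: openI; [exact: open_over|exact: open_rsubmx_neq0].
by apply/seteqP; split=> z; rewrite T0M_image.
Qed.

Lemma smooth_atlas_T0M : smooth_atlas T0M.
Proof.
split.
- apply/seteqP; split=> u.
    by move=> [a _ [[au tu] u0]]; split=> //; split=> //; exact: dom_carrier au.
  by move=> [[Nu tu] u0]; have [a au] := carrier_dom sM Nu; exists a.
- move=> a [p v] [[ap tv] _].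
  apply: etrans (T0M_coord_inv _ _) _; rewrite /= ?row_mxKl ?row_mxKr ?coordK//.
  congr (_, _); apply: (tangent_eq ap) => //; first exact: tangent_ofP.
  by rewrite tangent_ofE.
- move=> a b.
  rewrite (_ : _ @` _ = @coord _ _ T0M a @`
     (@dom _ _ T0M a `&` [set u : point_of T0M | @dom _ _ M b u.1])).
    by apply: open_T0M_image; exact: open_overlap.
  by apply/seteqP; split=> z; rewrite T0M_overlap T0M_image.
- move=> a b.
  pose V : set 'rV[R]_m := @coord _ _ M a @` (@dom _ _ M a `&` @dom _ _ M b).
  have oV : open (over V) by apply: open_over; exact: open_overlap.
  apply: (smooth_sub (U := over V)).
    by move=> z /T0M_overlap[].
  apply: (smooth_eq_on oV (fun z Uz => esym (T0M_transition Uz))).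
  by apply: smooth_tmap; [exact: open_overlap|exact: smooth_transition].
Qed.

End SlitTangentBundle.

Lemma smooth_manifold_T0M (R : realType) (m : nat) (M : atlas R m) :
  smooth_manifold M -> smooth_manifold (slit_tangent_bundle M).
Proof.
move=> [sM hM [B [oB bB]]]; have sT := smooth_atlas_T0M sM.
split=> // [u w cu cw uw|].
  (* Vectors over the same base point share a chart, which separates them; over distinct base
     points, disjoint open sets of M are pulled back. *)
  have [E|E] := pselect (u.1 = w.1).
    have [[Nu tu] u0] := cu; have [[Nw tw] w0] := cw.
    have [a au] := carrier_dom sM Nu.
    apply: (@chart_separated _ _ _ sT a) => //.
    by split=> //; split=> //=; rewrite -E.
  have [[Nu tu] u0] := cu; have [[Nw tw] w0] := cw.
  have [A [C [[AM oA] [CM oC] Au Cw AC]]] := hM _ _ Nu Nw E.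
  have oo (D : set (point_of M)) : open_in D ->
     open_in (carrier (slit_tangent_bundle M) `&` [set u | D u.1]).
    move=> [_ oD]; split=> [x []//|a].
    rewrite (_ : _ @` _ = @coord _ _ (slit_tangent_bundle M) a @`
       (@dom _ _ (slit_tangent_bundle M) a `&` [set u | D u.1])).
      exact: open_T0M_image.
    congr (_ @` _); apply/seteqP; split=> x; first by move=> [ax [_ Dx]].
    by move=> [ax Dx]; split=> //; split=> //; exact: dom_carrier ax.
  exists (carrier (slit_tangent_bundle M) `&` [set u | A u.1]).
  exists (carrier (slit_tangent_bundle M) `&` [set u | C u.1]).
  split=> //; try exact: oo.
  apply/seteqP; split=> // x [[_ Ax] [_ Cx]].
  by have : (A `&` C) x.1 by []; rewrite AC.
(* For each basic open set of M contained in some chart domain, one such chart is chosen. These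
   countably many charts cover, because every chart domain is a union of basic open sets. *)
apply: (@second_countable_atlas _ _ _ sT (fun i =>
   if pselect (exists a : chart M, B i `<=` dom a) is left e
   then Some (proj1_sig (cid e)) else None)).
move=> u [[Nu tu] u0]; have [a au] := carrier_dom sM Nu.
have [i Bi sBi] := bB _ _ (open_in_dom sM a) au.
exists i; case: pselect => [e|]; last by case; exists a.
exists (proj1_sig (cid e)); split=> //.
by split=> //; split=> //; exact: (proj2_sig (cid e)).
Qed.

(** * The Cartan nonlinear connection in a chart *)

Lemma scalerB_addB (R : nzRingType) (V : lmodType R) (k : R) (a b c d : V) :
  k *: a + b - (k *: c + d) = k *: (a - c) + (b - d).
Proof. by rewrite scalerBr opprD addrACA. Qed.

Section LinearFamily.
Context {R : realType} {n : nat} {V W : normedModType R}.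

Lemma linear_derive_family (U : set V) (A : V -> 'rV[R]_n -> W) x u :
  open U -> U x -> (forall y, U y -> linear (A y)) ->
  (forall c, differentiable (A ^~ c) x) -> linear (fun c => 'D_u (A ^~ c) x).
Proof.
move=> oU Ux lA dA k v w.
rewrite (derive_eq_on (g := fun y => k *: A y v + A y w) _ oU Ux); last first.
  by move=> y Uy; rewrite lA.
by rewrite deriveDE ?deriveZE//; exact: differentiableZ.
Qed.

End LinearFamily.

Section LocalFinsler.
Context {R : realType} {m : nat}.
Implicit Types (v w c x y : 'rV[R]_m) (z : 'rV[R]_(m + m)) (i j k l : 'I_m).
Variable f : 'rV[R]_(m + m) -> R.

(* These are F^2/2, y_i v^i, g_ij v^i w^j, gamma^i_00, N^i_j v^j and
   v^i delta/delta x^i; flat and gform are derivatives of the energy, which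
   agrees with y_i = g_ij y^j by Euler's theorem. *)
Definition energy z : R^o := 2^-1 * f z ^+ 2.
Definition flat z v : R^o := 'D_(yvec v) energy z.
Definition gform z v w : R^o := 'D_(yvec v) (flat^~ w) z.
Definition gspray z : 'rV[R]_m := \row_i christoffel00 f i z.
Definition nconn z v : 'rV[R]_m := 2^-1 *: 'D_(yvec v) gspray z.
Definition hlift z v : 'rV[R]_(m + m) := xvec v - yvec (nconn z v).

Local Notation "''e_' i" := (delta_mx 0 i : 'rV[R]_m) (at level 8, i at level 2).

Lemma energyE z : energy z = 2^-1 * f z ^+ 2.
Proof. by []. Qed.

Lemma derive_gspray z v : 'D_(yvec v) gspray z = 2 *: nconn z v.
Proof. by rewrite /nconn scalerA divff ?scale1r// pnatr_eq0. Qed.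

Lemma xvec_delta i : xvec 'e_i = (delta_mx 0 (lshift m i) : 'rV[R]_(m + m)).
Proof.
apply/rowP => j; case: (split_ordP j) => k ->.
  by rewrite row_mxEl !mxE eq_lshift.
by rewrite row_mxEr !mxE eq_rlshift.
Qed.

Lemma yvec_delta i : yvec 'e_i = (delta_mx 0 (rshift m i) : 'rV[R]_(m + m)).
Proof.
apply/rowP => j; case: (split_ordP j) => k ->.
  by rewrite row_mxEl !mxE eq_lrshift.
by rewrite row_mxEr !mxE eq_rshift.
Qed.

Lemma lsubmx_xvec v : lsubmx (xvec v) = v. Proof. exact: row_mxKl. Qed.
Lemma rsubmx_xvec v : rsubmx (xvec v) = 0. Proof. exact: row_mxKr. Qed.
Lemma lsubmx_yvec v : lsubmx (yvec v) = 0. Proof. exact: row_mxKl. Qed.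
Lemma rsubmx_yvec v : rsubmx (yvec v) = v. Proof. exact: row_mxKr. Qed.

(** Homogeneity is replaced by Euler's identity for the energy, a pointwise condition: the record
    then passes to any smaller open set, whether or not it is stable under rescaling y. *)
Record local_finsler (U : set 'rV[R]_(m + m)) : Prop := {
  local_finsler_open : open U;
  local_finsler_smooth : smooth_on U (f : 'rV[R]_(m + m) -> R^o);
  local_finsler_euler : forall z, U z -> flat z (rsubmx z) = 2 * energy z;
  local_finsler_unit : forall z, U z -> gmat f z \in unitmx;
  local_finsler_pos : forall z v, U z -> v != 0 ->
    0 < \sum_i \sum_j glow f i j z * v 0 i * v 0 j }.

Variable U : set 'rV[R]_(m + m).
Hypothesis Ff : local_finsler U.
Let oU : open U := local_finsler_open Ff.
Let sf : smooth_on U (f : 'rV[R]_(m + m) -> R^o) := local_finsler_smooth Ff.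
Let euler z : U z -> flat z (rsubmx z) = 2 * energy z := local_finsler_euler Ff (z := z).
Let gunit z : U z -> gmat f z \in unitmx := local_finsler_unit Ff (z := z).

Lemma smooth_energy : smooth_on U energy.
Proof. by apply: smoothZ => //; apply: smoothM. Qed.

Lemma smooth_flat v : smooth_on U (flat^~ v).
Proof. exact: smooth_derive smooth_energy. Qed.

Lemma smooth_gform v w : smooth_on U (fun z => gform z v w).
Proof. exact: smooth_derive (smooth_flat w). Qed.

Lemma linear_flat z : U z -> linear (flat z).
Proof.
move=> Uz k v w; rewrite /flat (linear_yvec k v w); apply: derive_dirP.
exact: smooth_differentiable smooth_energy Uz.
Qed.

Lemma gformC z v w : U z -> gform z v w = gform z w v.
Proof. by move=> Uz; exact: derive_swap_real oU Uz smooth_energy. Qed.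

Lemma linear_gforml z w : U z -> linear (gform z ^~ w).
Proof.
move=> Uz k v v'; rewrite /gform (linear_yvec k v v'); apply: derive_dirP.
exact: smooth_differentiable (smooth_flat w) Uz.
Qed.

Lemma linear_gformr z v : U z -> linear (gform z v).
Proof. by move=> Uz k w w'; rewrite !(gformC v)// linear_gforml. Qed.

Lemma derive_rsubmx z u : 'D_u (rsubmx : 'rV[R]_(m + m) -> 'rV[R]_m) z = rsubmx u.
Proof. exact: derive_linear_row linear_rsubmx. Qed.

Lemma differentiable_rsub z : differentiable (rsubmx : 'rV[R]_(m + m) -> 'rV[R]_m) z.
Proof. exact: linear_row_differentiable linear_rsubmx. Qed.

(** The vertical derivative of Euler's identity gives g(v, y) + flat(v) = 2 flat(v). This identifies
    [flat] with lowering the index of y. *)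
Lemma gform_y z v : U z -> gform z v (rsubmx z) = flat z v.
Proof.
move=> Uz.
have dflat c : differentiable (flat^~ c) z := smooth_differentiable (smooth_flat c) Uz.
have L := derive_linear_family (yvec v) oU Uz linear_flat dflat (differentiable_rsub z).
have := etrans (esym (derive_eq_on (yvec v) oU Uz euler)) L.
rewrite {L} derive_rsubmx rsubmx_yvec.
rewrite deriveZE; last exact: smooth_differentiable smooth_energy Uz.
rewrite -/(flat z v) -/(gform z v (rsubmx z)) => /eqP.
have -> : 2 *: flat z v = flat z v + flat z v by rewrite scaler_nat mulr2n.
by move=> /eqP/addIr.
Qed.

Lemma derive_flat_x z v : U z ->
  'D_(xvec v) (flat^~ (rsubmx z)) z = 2 * 'D_(xvec v) energy z.
Proof.
move=> Uz.
have dflat c : differentiable (flat^~ c) z := smooth_differentiable (smooth_flat c) Uz.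
have L := derive_linear_family (xvec v) oU Uz linear_flat dflat (differentiable_rsub z).
have := etrans (esym (derive_eq_on (xvec v) oU Uz euler)) L.
rewrite {L} derive_rsubmx rsubmx_xvec.
rewrite deriveZE; last exact: smooth_differentiable smooth_energy Uz.
have -> : flat z 0 = 0.
  by have := linear_flat Uz (-1) 0 0; rewrite scaler0 addr0 scaleN1r addNr.
by rewrite addr0 => /esym.
Qed.

Lemma derive_gform_x z v w : U z ->
  'D_(xvec v) (fun z' => gform z' w (rsubmx z)) z = 'D_(xvec v) (flat^~ w) z.
Proof.
move=> Uz.
have dg c : differentiable (fun z => gform z w c) z :=
  smooth_differentiable (smooth_gform w c) Uz.
have lg z' : U z' -> linear (gform z' w) by exact: linear_gformr.
have L := derive_linear_family (xvec v) oU Uz lg dg (differentiable_rsub z).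
have := etrans (esym (derive_eq_on (xvec v) oU Uz (fun z' => @gform_y z' w))) L.
rewrite {L} derive_rsubmx rsubmx_xvec.
have -> : gform z w 0 = 0.
  by have := linear_gformr w Uz (-1) 0 0; rewrite scaler0 addr0 scaleN1r addNr.
by rewrite addr0 => /esym.
Qed.

(** The Cartan tensor, half the vertical derivative of g_ij, annihilates y: differentiate [gform_y]
    vertically and cancel g(v, w). *)
Lemma cartan_y z v w : U z ->
  'D_(yvec v) (fun z' => gform z' w (rsubmx z)) z = 0.
Proof.
move=> Uz.
have dg c : differentiable (fun z => gform z w c) z :=
  smooth_differentiable (smooth_gform w c) Uz.
have lg z' : U z' -> linear (gform z' w) by exact: linear_gformr.
have L := derive_linear_family (yvec v) oU Uz lg dg (differentiable_rsub z).
have E : gform z v w = _ :=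
  etrans (esym (derive_eq_on (yvec v) oU Uz (fun z' => @gform_y z' w))) L.
move: E; rewrite {L} derive_rsubmx rsubmx_yvec (gformC v w Uz) => /esym/eqP.
by rewrite -subr_eq0 addrK => /eqP.
Qed.

Lemma derive_sq z u : U z ->
  'D_u ((fun t => f t ^+ 2) : _ -> R^o) z = 2 * 'D_u energy z.
Proof.
move=> Uz; have -> : (fun t => f t ^+ 2) = (fun t => 2 *: energy t : R^o).
  by apply/funext => t; rewrite /energy /GRing.scale/= mulrA divff ?mul1r// pnatr_eq0.
rewrite deriveZE//; exact: smooth_differentiable smooth_energy Uz.
Qed.

Lemma glowE i j z : U z -> glow f i j z = gform z 'e_i 'e_j.
Proof.
move=> Uz; rewrite /glow mxE /dy_ -!yvec_delta.
rewrite (derive_eq_on (g := fun z' => 2 *: flat z' 'e_j) _ oU Uz); last first.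
  by move=> z' Uz'; rewrite derive_sq.
rewrite deriveZE; last exact: smooth_differentiable (smooth_flat _) Uz.
by rewrite /GRing.scale/= mulrA mulVf ?mul1r// pnatr_eq0.
Qed.

Lemma sum_gformr z v w : U z -> \sum_j gform z v 'e_j * w 0 j = gform z v w.
Proof.
move=> Uz; rewrite (linear_row_sum (linear_gformr v Uz) w).
by apply: eq_bigr => j _; rewrite mulrC.
Qed.

Lemma ylowE i z : U z -> ylow f i z = flat z 'e_i.
Proof.
move=> Uz; rewrite -gform_y// -sum_gformr//; apply: eq_bigr => j _.
by rewrite glowE// /ycoord mxE.
Qed.

Lemma smooth_glow i j : smooth_on U (glow f i j : 'rV[R]_(m + m) -> R^o).
Proof.
apply: (smooth_eq_on oU _ (smooth_gform 'e_i 'e_j)) => z Uz.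
by rewrite glowE.
Qed.

Lemma smooth_gup i j : smooth_on U (gup f i j : 'rV[R]_(m + m) -> R^o).
Proof. by apply: smooth_invmx => // k l; exact: smooth_glow. Qed.

Lemma smooth_ycoord i : smooth_on U (ycoord i : 'rV[R]_(m + m) -> R^o).
Proof. by apply: smooth_linear => k z w; rewrite /ycoord !mxE. Qed.

Lemma smooth_dx i (h : 'rV[R]_(m + m) -> R^o) : smooth_on U h ->
  smooth_on U (dx_ i h : 'rV[R]_(m + m) -> R^o).
Proof. exact: smooth_derive. Qed.

Lemma smooth_christoffel i j k :
  smooth_on U (christoffel f i j k : 'rV[R]_(m + m) -> R^o).
Proof.
apply: smoothZ => //; apply: smooth_sum => // l; apply: smoothM => //.
  exact: smooth_gup.
apply: smoothB => //; last by apply: smooth_dx; exact: smooth_glow.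
by apply: smoothD => //; apply: smooth_dx; exact: smooth_glow.
Qed.

Lemma smooth_gspray : smooth_on U gspray.
Proof.
apply: smooth_row => // i.
apply: (smooth_eq_on (f := christoffel00 f i : 'rV[R]_(m + m) -> R^o)) => //.
  by move=> z _; rewrite mxE.
apply: smooth_sum => // j; apply: smooth_sum => // k.
apply: smoothM => //; last exact: smooth_ycoord.
by apply: smoothM => //; [exact: smooth_christoffel|exact: smooth_ycoord].
Qed.

Lemma smooth_nconn v : smooth_on U (nconn^~ v).
Proof. by apply: smoothZ => //; apply: smooth_derive; exact: smooth_gspray. Qed.

Lemma linear_nconn z : U z -> linear (nconn z).
Proof.
move=> Uz k v w; rewrite /nconn (linear_yvec k v w) derive_dirP.
  by rewrite scalerDr !scalerA mulrC.
exact: smooth_differentiable smooth_gspray Uz.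
Qed.

Lemma nconnE i j z : U z -> nlconn f i j z = nconn z 'e_j 0 i.
Proof.
move=> Uz; rewrite /nconn mxE -derive_coord_row.
  rewrite /nlconn /dy_ -yvec_delta; congr (_ * _).
  by apply: (derive_eq_on _ oU Uz) => z' _; rewrite mxE.
exact: smooth_differentiable smooth_gspray Uz.
Qed.

Lemma linear_hlift z : U z -> linear (hlift z).
Proof.
move=> Uz k v w.
rewrite /hlift (linear_nconn Uz) (linear_xvec k v w).
have -> := linear_yvec k (nconn z v) (nconn z w).
exact: scalerB_addB.
Qed.

(** Lowering the index cancels the inverse matrix in the Christoffel symbols. Contracting with y
    twice then replaces derivatives of g by derivatives of y_i and of E, through the x-derivatives
    of [gform_y] and of Euler's identity. *)
Lemma geodesic_eq z v : U z ->
  gform z v (gspray z) =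
  'D_(xvec (rsubmx z)) (flat^~ v) z - 'D_(xvec v) energy z.
Proof.
move=> Uz; set y := rsubmx z.
have dflat c : differentiable (flat^~ c) z := smooth_differentiable (smooth_flat c) Uz.
(* The derivatives of g, the Christoffel symbols of the first kind, and the contraction of the
   latter with y twice. *)
pose D i j k : R := 'D_(xvec 'e_i) (fun z => gform z 'e_j 'e_k) z.
pose T l j k : R := 2^-1 * (D j l k + D k j l - D l j k).
pose C l : R := \sum_j \sum_k T l j k * y 0 j * y 0 k.
have dxE i j k : dx_ i (glow f j k) z = D i j k.
  rewrite /dx_ -xvec_delta; apply: (derive_eq_on _ oU Uz) => z' Uz'.
  by rewrite glowE.
have yE i : ycoord i z = y 0 i by rewrite /y mxE.
have gammaE i : gspray z 0 i = \sum_l gup f i l z * C l.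
  rewrite mxE /christoffel00 /C.
  under [RHS]eq_bigr do rewrite mulr_sumr.
  rewrite [RHS]exchange_big/=; apply: eq_bigr => j _.
  under [RHS]eq_bigr do rewrite mulr_sumr.
  rewrite [RHS]exchange_big/=; apply: eq_bigr => k _.
  rewrite /christoffel mulr_sumr !mulr_suml; apply: eq_bigr => l _.
  have L (g a b d1 d2 d3 : R) : 2^-1 * (g * (d1 + d2 - d3)) * a * b =
      g * (2^-1 * (d1 + d2 - d3) * a * b) by ring.
  by rewrite !dxE !yE; exact: L.
have gC a : gform z 'e_a (gspray z) = C a.
  rewrite -sum_gformr//.
  transitivity (\sum_l (\sum_i glow f a i z * gup f i l z) * C l).
    under [RHS]eq_bigr do rewrite mulr_suml.
    rewrite [RHS]exchange_big/=; apply: eq_bigr => i _; rewrite gammaE mulr_sumr.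
    by apply: eq_bigr => l _; rewrite glowE// mulrA.
  have gK l : \sum_i glow f a i z * gup f i l z = (a == l)%:R.
    have := mulmxV (gunit Uz) => /matrixP/(_ a l); rewrite !mxE => <-.
    by [].
  under eq_bigr do rewrite gK.
  rewrite (bigD1 a)//= eqxx mul1r big1 ?addr0// => l /negPf la.
  by rewrite eq_sym la mul0r.
(* Both sides of the goal are linear in v, so basis vectors suffice. *)
suff CE a : C a = 'D_(xvec y) (flat^~ 'e_a) z - 'D_(xvec 'e_a) energy z.
  pose rhs v : R^o := 'D_(xvec y) (flat^~ v) z - 'D_(xvec v) energy z.
  have lrhs : linear rhs.
    move=> k w w'; rewrite /rhs.
    have -> := linear_derive_family (xvec y) oU Uz linear_flat dflat k w w'.
    have dE := smooth_differentiable smooth_energy Uz.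
    have -> : 'D_(xvec (k *: w + w')) energy z = _ := congr1 (derive energy z) (linear_xvec k w w').
    have -> := derive_dirP (xvec w) (xvec w') k dE.
    exact: scalerB_addB.
  rewrite -/(rhs v) (linear_row_sum (linear_gforml _ Uz) v) (linear_row_sum lrhs).
  by apply: eq_bigr => i _; rewrite gC CE.
pose Phi u v w : R^o := 'D_(xvec u) (fun z => gform z v w) z.
have dg v' w : differentiable (fun z => gform z v' w) z.
  exact: smooth_differentiable (smooth_gform v' w) Uz.
have Phi1 v' w : linear (fun u => Phi u v' w).
  by move=> k u u'; rewrite /Phi (linear_xvec k u u') derive_dirP.
have Phi2 u w : linear (fun v => Phi u v w).
  apply: (linear_derive_family (A := fun z v => gform z v w) _ oU Uz) => [z' Uz'|c].
    exact: linear_gforml.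
  exact: dg.
have Phi3 u v' : linear (fun w => Phi u v' w).
  apply: (linear_derive_family (A := fun z w => gform z v' w) _ oU Uz) => [z' Uz'|c].
    exact: linear_gformr.
  exact: dg.
have sum2 (B : 'rV[R]_m -> 'rV[R]_m -> R^o) :
    (forall w, linear (B^~ w)) -> (forall v, linear (B v)) ->
    \sum_j \sum_k B 'e_j 'e_k * y 0 j * y 0 k = B y y.
  move=> B1 B2; rewrite (linear_row_sum (B1 y) y); apply: eq_bigr => j _.
  rewrite (linear_row_sum (B2 'e_j) y) scaler_sumr; apply: eq_bigr => k _.
  by rewrite /GRing.scale/=; ring.
have -> : C a = 2^-1 * (\sum_j \sum_k Phi 'e_j 'e_a 'e_k * y 0 j * y 0 k +
                        \sum_j \sum_k Phi 'e_k 'e_j 'e_a * y 0 j * y 0 k -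
                        \sum_j \sum_k Phi 'e_a 'e_j 'e_k * y 0 j * y 0 k).
  rewrite -big_split -sumrB mulr_sumr /=; apply: eq_bigr => j _.
  rewrite -big_split -sumrB mulr_sumr /=; apply: eq_bigr => k _.
  have L (s t d1 d2 d3 : R) : 2^-1 * (d1 + d2 - d3) * s * t =
      2^-1 * (d1 * s * t + d2 * s * t - d3 * s * t) by ring.
  exact: L.
have S1 := sum2 _ (Phi1 'e_a) (fun u => Phi3 u 'e_a).
have S2 := sum2 _ (Phi2^~ 'e_a) (fun v => Phi1 v 'e_a).
have S3 := sum2 _ (Phi2 'e_a) (Phi3 'e_a).
apply: etrans (congr1 (fun t => 2^-1 * t)
  (congr2 (fun s t => s - t) (congr2 +%R S1 S2) S3)) _.
(* The first two terms agree by symmetry of g and are derivatives of y_a; the third is twice a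
   derivative of the energy. *)
have P1 : Phi y 'e_a y = 'D_(xvec y) (flat^~ 'e_a) z := derive_gform_x y 'e_a Uz.
have P2 : Phi y y 'e_a = Phi y 'e_a y :=
  derive_eq_on (xvec y) oU Uz (fun z' => @gformC z' y 'e_a).
have P3 : Phi 'e_a y y = 2 * 'D_(xvec 'e_a) energy z :=
  etrans (derive_gform_x 'e_a y Uz) (derive_flat_x 'e_a Uz).
have L (s t : R) : 2^-1 * (s + s - 2 * t) = s - t by field.
by rewrite P2 P1 P3 L.
Qed.

End LocalFinsler.

(** * Horizontal derivatives, curvature, and the splitting into horizontal and vertical parts *)

Section LocalGeometry.
Context {R : realType} {m : nat}.
Implicit Types (v w c x y h k : 'rV[R]_m) (z : 'rV[R]_(m + m)).
Variables (f : 'rV[R]_(m + m) -> R) (U : set 'rV[R]_(m + m)).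
Hypothesis Ff : local_finsler f U.
Let oU : open U := local_finsler_open Ff.
Local Notation energy := (energy f).
Local Notation flat := (flat f).
Local Notation gform := (gform f).
Local Notation gspray := (gspray f).
Local Notation nconn := (nconn f).
Local Notation hlift := (hlift f).
Local Notation "''e_' i" := (delta_mx 0 i : 'rV[R]_m) (at level 8, i at level 2).

Let dE z : U z -> differentiable energy z.
Proof. exact: smooth_differentiable (smooth_energy Ff). Qed.
Let dflat z v : U z -> differentiable (flat^~ v) z.
Proof. exact: smooth_differentiable (smooth_flat Ff v). Qed.
Let dgform z v w : U z -> differentiable (fun z => gform z v w) z.
Proof. exact: smooth_differentiable (smooth_gform Ff v w). Qed.
Let dgspray z : U z -> differentiable gspray z.
Proof. exact: smooth_differentiable (smooth_gspray Ff). Qed.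
Let dnconn z v : U z -> differentiable (nconn^~ v) z.
Proof. exact: smooth_differentiable (smooth_nconn Ff v). Qed.

(** The vertical derivative along c of the geodesic equation. The spray contributes 2N, and the
    dependence on y of the direction of differentiation contributes the first term on the right. *)
Lemma gform_nconn z v c : U z ->
  2 * gform z v (nconn z c) =
  'D_(xvec c) (flat^~ v) z - 'D_(xvec v) (flat^~ c) z +
  ('D_(yvec c) (fun z' => 'D_(xvec (rsubmx z)) (flat^~ v) z') z -
   'D_(yvec c) (fun z' => gform z' v (gspray z)) z).
Proof.
move=> Uz.
pose A z w : R^o := 'D_(xvec w) (flat^~ v) z.
have lA z' : U z' -> linear (A z').
  by move=> Uz' k w w'; rewrite /A (linear_xvec k w w') derive_dirP//; exact: dflat.
have dA w : differentiable (A^~ w) z.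
  exact: smooth_differentiable (smooth_derive _ (smooth_flat Ff v)) Uz.
have dy := differentiable_rsub z.
have [dAy DAy] := is_diff_linear_family oU Uz lA dA dy.
have dxE : differentiable (fun z' => 'D_(xvec v) energy z') z.
  exact: smooth_differentiable (smooth_derive _ (smooth_energy Ff)) Uz.
have lg z' : U z' -> linear (gform z' v) by exact: (linear_gformr Ff).
have L1 := derive_linear_family (yvec c) oU Uz lg (fun w => dgform v w Uz) (dgspray Uz).
have L2 := derive_eq_on (yvec c) oU Uz (fun z' => @geodesic_eq _ _ _ _ Ff z' v).
have swap := derive_swap_real (yvec c) (xvec v) oU Uz (smooth_energy Ff).
have D2 : 'D_(yvec c) gspray z = 2 *: nconn z c.
  by rewrite /nconn scalerA divff ?scale1r// pnatr_eq0.
have g2 : gform z v ('D_(yvec c) gspray z) = 2 * gform z v (nconn z c).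
  by rewrite D2; exact: linear_funZ (lg z Uz) _ _.
have q : A z ('D_(yvec c) rsubmx z) = A z c :=
  congr1 (A z) (etrans (derive_rsubmx z (yvec c)) (rsubmx_yvec c)).
have L3 := etrans (deriveBE (yvec c) dAy dxE) (congr2 (fun s t => s - t)
  (etrans (DAy (yvec c)) (congr1 (+%R ('D_(yvec c) (A^~ (rsubmx z)) z)) q)) swap).
have L (a b r s t : R) : a + b - r = s + t -> t = b - r + (a - s).
  by move=> E; rewrite -(addKr s t) -E; ring.
apply: L; exact: etrans (esym L3) (etrans (esym L2) (etrans L1
  (congr1 (+%R ('D_(yvec c) (fun z' => gform z' v (gspray z)) z)) g2))).
Qed.

Lemma derive_hlift (W : normedModType R) (h : 'rV[R]_(m + m) -> W) z v :
  differentiable h z ->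
  'D_(hlift z v) h z = 'D_(xvec v) h z - 'D_(yvec (nconn z v)) h z.
Proof. by move=> dh; rewrite /hlift derive_dirB. Qed.

(** In [gform_nconn] the difference of x-derivatives is antisymmetric in the two vectors, while the
    parenthesis is symmetric: [S1] and [S2] follow from the symmetry of g and of second
    derivatives. *)
Lemma derive_hlift_flatC z h k : U z ->
  'D_(hlift z h) (flat^~ k) z = 'D_(hlift z k) (flat^~ h) z.
Proof.
move=> Uz.
have E1 := gform_nconn k h Uz; have E2 := gform_nconn h k Uz.
have sw u v := derive_swap_real (yvec u) (xvec (rsubmx z)) oU Uz (smooth_flat Ff v).
have S1 : 'D_(yvec h) (fun z' => 'D_(xvec (rsubmx z)) (flat^~ k) z') z =
          'D_(yvec k) (fun z' => 'D_(xvec (rsubmx z)) (flat^~ h) z') z.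
  apply: (etrans (sw h k)); apply: (etrans _ (esym (sw k h))).
  exact: (derive_eq_on _ oU Uz (fun z' => @gformC _ _ _ _ Ff z' h k)).
have S2 : 'D_(yvec h) (fun z' => gform z' k (gspray z)) z =
          'D_(yvec k) (fun z' => gform z' h (gspray z)) z :=
  derive_swap_real (yvec h) (yvec k) oU Uz (smooth_flat Ff (gspray z)).
have H1 := derive_hlift h (dflat k Uz); have H2 := derive_hlift k (dflat h Uz).
have G1 := gformC Ff (nconn z h) k Uz; have G2 := gformC Ff (nconn z k) h Uz.
have E3 := etrans E1 (congr1 (+%R _) (congr2 (fun s t => s - t) S1 S2)).
have L (g1 g2 a b s : R) : 2 * g1 = a - b + s -> 2 * g2 = b - a + s -> a - g1 = b - g2.
  move=> e1 e2; have : 2 * (a - g1) = 2 * (b - g2) by rewrite !mulrBr e1 e2; ring.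
  by apply: mulfI; rewrite pnatr_eq0.
have L0 := L _ _ _ _ _ E3 E2.
pose a : R^o := 'D_(xvec h) (flat^~ k) z; pose b : R^o := 'D_(xvec k) (flat^~ h) z.
exact: etrans (etrans H1 (congr1 (fun t => a - t) G1))
  (etrans L0 (esym (etrans H2 (congr1 (fun t => b - t) G2)))).
Qed.

(** The case of [gform_nconn] in which y is the lowered vector: the spray term vanishes by
    [cartan_y], two others cancel, and 2 flat(N v) is left equal to twice the x-derivative of E. *)
Lemma derive_hlift_energy z v : U z -> 'D_(hlift z v) energy z = 0.
Proof.
move=> Uz; set y := rsubmx z.
have E := gform_nconn y v Uz; have F1 := derive_flat_x Ff v Uz.
have C0 : 'D_(yvec v) (fun z' => gform z' y (gspray z)) z = 0 :=
  etrans (derive_eq_on _ oU Uz (fun z' => @gformC _ _ _ _ Ff z' y (gspray z)))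
    (cartan_y Ff v (gspray z) Uz).
have C1 : 'D_(yvec v) (fun z' => 'D_(xvec y) (flat^~ y) z') z = 'D_(xvec y) (flat^~ v) z :=
  etrans (derive_swap_real (yvec v) (xvec y) oU Uz (smooth_flat Ff y))
    (derive_gform_x Ff y v Uz).
have G : gform z y (nconn z v) = flat z (nconn z v) :=
  etrans (gformC Ff y (nconn z v) Uz) (gform_y Ff (nconn z v) Uz).
have L (g a b c d e : R) : 2 * g = a - b + (c - d) -> a = 2 * e -> d = 0 -> c = b -> e - g = 0.
  move=> e1 e2 e3 e4; apply/eqP; rewrite subr_eq0; apply/eqP.
  have : 2 * e = 2 * g by rewrite e1 e2 e3 e4; ring.
  by apply: mulfI; rewrite pnatr_eq0.
pose a : R^o := 'D_(xvec v) energy z.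
apply: etrans (etrans (derive_hlift v (dE Uz)) (congr1 (fun t => a - t) (esym G))) _.
exact: (L _ _ _ _ _ _ E F1 C0 C1).
Qed.

(** Each side is half a second vertical derivative of the spray coefficients. *)
Lemma derive_nconnC z v w : U z ->
  'D_(yvec v) (nconn^~ w) z = 'D_(yvec w) (nconn^~ v) z.
Proof.
move=> Uz.
have D u u' : 'D_(yvec u) (nconn^~ u') z =
    2^-1 *: 'D_(yvec u) (fun z' => 'D_(yvec u') gspray z') z.
  apply: deriveZE.
  exact: smooth_differentiable (smooth_derive _ (smooth_gspray Ff)) Uz.
have swap := derive_swap (yvec v) (yvec w) oU Uz (smooth_gspray Ff).
exact: etrans (D v w) (etrans (congr1 ( *:%R 2^-1) swap) (esym (D w v))).
Qed.

(* The components (delta y^i)(u). *)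
Definition vpart z (u : 'rV[R]_(m + m)) : 'rV[R]_m := rsubmx u + nconn z (lsubmx u).

Lemma vpartE z (u : 'rV[R]_(m + m)) : vpart z u = rsubmx u + nconn z (lsubmx u).
Proof. by []. Qed.

Lemma hlift_vpart z (u : 'rV[R]_(m + m)) :
  u = hlift z (lsubmx u) + yvec (vpart z u).
Proof.
rewrite /hlift /vpart /xvec /yvec opp_row_mx !add_row_mx oppr0 !addr0 add0r.
by rewrite [- _ + _]addrC addrK hsubmxK.
Qed.

Lemma linear_vpart z : U z -> linear (vpart z).
Proof.
move=> Uz k v w; rewrite /vpart (linear_rsubmx k v w) (linear_lsubmx k v w).
by rewrite (linear_nconn Ff Uz) scalerDr addrACA.
Qed.

(** That is, dE = y_i delta y^i, because horizontal vectors do not change E. *)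
Lemma derive_energy z u : U z -> 'D_u energy z = flat z (vpart z u).
Proof.
move=> Uz; rewrite {1}(hlift_vpart z u) derive_dirD; last exact: dE.
by rewrite derive_hlift_energy// add0r.
Qed.

Lemma delta_xE z (i : 'I_m) (h : 'rV[R]_(m + m) -> R^o) : U z ->
  differentiable h z -> delta_x f i h z = 'D_(hlift z 'e_i) h z.
Proof.
move=> Uz dh; rewrite derive_hlift// /delta_x /dx_ -xvec_delta; congr (_ - _).
have lD : linear (fun w => 'D_(yvec w) h z).
  by move=> k v w; rewrite (linear_yvec k v w) derive_dirP.
rewrite [RHS](linear_row_sum lD); apply: eq_bigr => j _.
rewrite (@nconnE _ _ f U Ff j i z Uz).
exact: (congr1 (fun t : R => nconn z 'e_i 0 j * t) (congr1 (derive h z) (esym (yvec_delta j)))).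
Qed.

(* The left-hand side is the contracted curvature R^i_jl h^j k^l. *)
Lemma derive_hlift_nconn z (lam : R) h k : U z ->
  (forall i j l, curvature f i j l z =
     lam * ((i == l)%:R * ylow f j z - (i == j)%:R * ylow f l z)) ->
  'D_(hlift z k) (nconn^~ h) z - 'D_(hlift z h) (nconn^~ k) z =
  lam *: (flat z h *: k - flat z k *: h).
Proof.
move=> Uz curv.
pose B h k := 'D_(hlift z k) (nconn^~ h) z - 'D_(hlift z h) (nconn^~ k) z.
pose C h k := lam *: (flat z h *: k - flat z k *: h).
have lD1 k' : linear (fun h => 'D_(hlift z k') (nconn^~ h) z) :=
  linear_derive_family (hlift z k') oU Uz (fun z' => @linear_nconn _ _ f U Ff z')
    (fun v => dnconn v Uz).
have lD2 h' : linear (fun k => 'D_(hlift z k) (nconn^~ h') z).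
  move=> a v w.
  exact: etrans (congr1 (derive (nconn^~ h') z) (linear_hlift Ff Uz a v w))
    (derive_dirP (hlift z v) (hlift z w) a (dnconn h' Uz)).
have lB1 k' : linear (B^~ k').
  move=> a v w; exact: etrans (congr2 (fun s t => s - t) (lD1 k' a v w) (lD2 k' a v w))
    (scalerB_addB _ _ _ _ _).
have lB2 h' : linear (B h').
  move=> a v w; exact: etrans (congr2 (fun s t => s - t) (lD2 h' a v w) (lD1 h' a v w))
    (scalerB_addB _ _ _ _ _).
have lF := linear_flat Ff Uz.
have lC1 k' : linear (C^~ k').
  move=> a v w; have L (s t p : R) : lam *: ((a * s + t) *: k' - p *: (a *: v + w)) =
      a *: (lam *: (s *: k' - p *: v)) + lam *: (t *: k' - p *: w).
    by apply/rowP => i; rewrite !mxE; ring.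
  exact: etrans (congr1 (fun t => lam *: (t *: k' - flat z k' *: (a *: v + w))) (lF a v w))
    (L (flat z v) (flat z w) (flat z k')).
have lC2 h' : linear (C h').
  move=> a v w; have L (s t p : R) : lam *: (p *: (a *: v + w) - (a * s + t) *: h') =
      a *: (lam *: (p *: v - s *: h')) + lam *: (p *: w - t *: h').
    by apply/rowP => i; rewrite !mxE; ring.
  exact: etrans (congr1 (fun t => lam *: (flat z h' *: (a *: v + w) - t *: h')) (lF a v w))
    (L (flat z v) (flat z w) (flat z h')).
(* Both sides are bilinear in h and k, so they can be compared on basis vectors, where the
   hypothesis on the curvature coefficients applies. *)
suff BC i j : B 'e_i 'e_j = C 'e_i 'e_j.
  rewrite -/(B h k) -/(C h k) (linear_row_sum (lB1 k) h) (linear_row_sum (lC1 k) h).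
  apply: eq_bigr => i _; rewrite (linear_row_sum (lB2 _) k) (linear_row_sum (lC2 _) k).
  by congr (_ *: _); apply: eq_bigr => j _; rewrite BC.
apply/rowP => l.
have dl (p : 'I_m) : differentiable (nlconn f l p : 'rV[R]_(m + m) -> R^o) z.
  apply: (differentiable_eq_on oU Uz _ (differentiable_coord_row l (dnconn 'e_p Uz))).
  by move=> z' Uz'; rewrite (nconnE Ff).
have DE (p q : 'I_m) : delta_x f p (nlconn f l q) z = 'D_(hlift z 'e_p) (nconn^~ 'e_q) z 0 l.
  apply: (etrans (delta_xE p Uz (dl q))).
  apply: (etrans _ (derive_coord_row (hlift z 'e_p) l (dnconn 'e_q Uz))).
  exact: (derive_eq_on _ oU Uz (fun z' => @nconnE _ _ f U Ff l q z')).
have sub (X Y : 'rV[R]_m) : (X - Y) 0 l = X 0 l - Y 0 l by rewrite !mxE.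
have CE : C 'e_i 'e_j 0 l = lam * ((l == j)%:R * flat z 'e_i - (l == i)%:R * flat z 'e_j).
  have L (s t : R) : (lam *: (s *: 'e_j - t *: 'e_i)) 0 l =
     lam * ((l == j)%:R * s - (l == i)%:R * t) by rewrite !mxE !eqxx /=; ring.
  exact: L.
rewrite CE -(ylowE Ff i Uz) -(ylowE Ff j Uz) -curv.
exact: etrans (sub _ _) (esym (congr2 (fun s t => s - t) (DE j i) (DE i j))).
Qed.

Local Notation Psi := (loc_Psi f).
Implicit Types a b : 'rV[R]_(m + m).

Lemma lsubmx_hlift z v : lsubmx (hlift z v) = v.
Proof. by rewrite /hlift /xvec /yvec opp_row_mx add_row_mx row_mxKl oppr0 addr0. Qed.

Lemma rsubmx_hlift z v : rsubmx (hlift z v) = - nconn z v.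
Proof. by rewrite /hlift /xvec /yvec opp_row_mx add_row_mx row_mxKr add0r. Qed.

Lemma vpart_hlift z v : vpart z (hlift z v) = 0.
Proof. by rewrite /vpart rsubmx_hlift lsubmx_hlift addNr. Qed.

Lemma vpart_yvec z v : U z -> vpart z (yvec v) = v.
Proof.
move=> Uz; rewrite /vpart rsubmx_yvec lsubmx_yvec.
by rewrite (linear_fun0 (linear_nconn Ff Uz)) addr0.
Qed.

Lemma hv_inj z a b : lsubmx a = lsubmx b -> vpart z a = vpart z b -> a = b.
Proof. by move=> E1 E2; rewrite (hlift_vpart z a) (hlift_vpart z b) E1 E2. Qed.

Lemma vcoframeE i z a : U z -> vcoframe f i z a = vpart z a 0 i.
Proof.
move=> Uz; rewrite /vcoframe /vpart.
have add (A B : 'rV[R]_m) : (A + B) 0 i = A 0 i + B 0 i by rewrite mxE.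
have lin (A B : 'rV[R]_m) (s : R) : (s *: A + B) 0 i = s * A 0 i + B 0 i by rewrite !mxE.
have l1 : linear (fun w => nconn z w 0 i : R^o).
  move=> s v w; have -> := linear_nconn Ff Uz s v w.
  exact: lin.
apply: (etrans _ (esym (add (rsubmx a) (nconn z (lsubmx a))))).
have -> : rsubmx a 0 i = a 0 (rshift m i) by rewrite mxE.
congr (_ + _); apply: (etrans _ (esym (linear_row_sum l1 (lsubmx a)))); apply: eq_bigr => j _.
have -> : lsubmx a 0 j = a 0 (lshift m j) by rewrite mxE.
by rewrite (nconnE Ff)// mulrC.
Qed.

Lemma hframeE i z : U z -> hframe f i z = hlift z 'e_i.
Proof.
move=> Uz; rewrite -[RHS]hsubmxK lsubmx_hlift rsubmx_hlift /hframe.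
by congr (row_mx _ (- _)); apply/rowP => j; rewrite mxE (nconnE Ff).
Qed.

Lemma loc_PsiE z a : U z -> Psi z a = hlift z (vpart z a) - yvec (lsubmx a).
Proof.
move=> Uz; rewrite /loc_Psi.
rewrite (linear_row_sum (linear_hlift Ff Uz) (vpart z a)).
rewrite (linear_row_sum linear_yvec (lsubmx a)) -sumrB; apply: eq_bigr => i _.
by rewrite vcoframeE// hframeE// /hcoframe /vframe scalerN addrC !mxE.
Qed.

Lemma smooth_hlift v : smooth_on U (hlift^~ v).
Proof.
apply: smoothB => //; first exact: smooth_cst.
by apply: smooth_linear_comp => //; [exact: linear_yvec|exact: smooth_nconn Ff v].
Qed.

Lemma smooth_vpart (X : 'rV[R]_(m + m) -> 'rV[R]_(m + m)) :
  smooth_on U X -> smooth_on U (fun z => vpart z (X z)).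
Proof.
move=> sX; apply: smoothD => //; first exact: smooth_linear_comp linear_rsubmx sX.
apply: (smooth_linear_family (A := nconn) (X := fun z => lsubmx (X z))) => //.
- by move=> z Uz; exact: linear_nconn Ff _ Uz.
- exact: smooth_nconn Ff.
- exact: smooth_linear_comp linear_lsubmx sX.
Qed.

Lemma is_diff_vpart z (c : 'rV[R]_(m + m)) : U z -> differentiable (vpart^~ c) z /\
  forall u, 'D_u (vpart^~ c) z = 'D_u (nconn^~ (lsubmx c)) z.
Proof.
move=> Uz; have dN := dnconn (lsubmx c) Uz.
have dc : differentiable (fun=> rsubmx c) z by exact: differentiable_cst.
split=> [|u]; first exact: differentiableD dc dN.
apply: etrans (deriveDE u dc dN) _.
by have -> : 'D_u (fun=> rsubmx c) z = 0 := derive_cst (rsubmx c) z u; rewrite add0r.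
Qed.

(* The first summand is the curvature term and vanishes on D_F. *)
Lemma derive_nconn_hv z a b : U z ->
  'D_a (nconn^~ (lsubmx b)) z - 'D_b (nconn^~ (lsubmx a)) z =
  ('D_(hlift z (lsubmx a)) (nconn^~ (lsubmx b)) z -
   'D_(hlift z (lsubmx b)) (nconn^~ (lsubmx a)) z) +
  ('D_(yvec (vpart z a)) (nconn^~ (lsubmx b)) z -
   'D_(yvec (vpart z b)) (nconn^~ (lsubmx a)) z).
Proof.
move=> Uz; have D u v : 'D_u (nconn^~ v) z = 'D_(hlift z (lsubmx u)) (nconn^~ v) z +
    'D_(yvec (vpart z u)) (nconn^~ v) z.
  apply: etrans (congr1 (derive (nconn^~ v) z) (hlift_vpart z u)) _.
  exact: derive_dirD (dnconn v Uz).
have L (p q r s : 'rV[R]_m) : p + q - (r + s) = (p - r) + (q - s).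
  by rewrite opprD addrACA.
exact: etrans (congr2 (fun s t => s - t) (D a (lsubmx b)) (D b (lsubmx a))) (L _ _ _ _).
Qed.

(** After splitting the directions a and b, the horizontal contributions cancel by
    [derive_hlift_flatC] and the vertical ones are values of g. *)
Lemma derive_flat_hv z a b : U z ->
  'D_b (flat^~ (lsubmx a)) z - 'D_a (flat^~ (lsubmx b)) z =
  gform z (vpart z b) (lsubmx a) - gform z (vpart z a) (lsubmx b).
Proof.
move=> Uz; have D u v : 'D_u (flat^~ v) z = 'D_(hlift z (lsubmx u)) (flat^~ v) z +
    gform z (vpart z u) v.
  apply: etrans (congr1 (derive (flat^~ v) z) (hlift_vpart z u)) _.
  exact: derive_dirD (dflat v Uz).
have H := derive_hlift_flatC (lsubmx a) (lsubmx b) Uz.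
have L (p q r s : R) : p = r -> r + q - (p + s) = q - s by move=> ->; ring.
exact: etrans (congr2 (fun s t => s - t) (D b (lsubmx a)) (D a (lsubmx b))) (L _ _ _ _ H).
Qed.

End LocalGeometry.

(** * Integrability in a chart *)

(* Otherwise unification unfolds these down to limits and matrix entries. *)
#[local] Opaque energy flat gform gspray nconn hlift vpart loc_Psi xvec yvec derive.

Section LocalCR.
Context {R : realType} {m : nat}.
Implicit Types (v w c x y h k : 'rV[R]_m) (z a b u : 'rV[R]_(m + m)).
Implicit Types (X Y : 'rV[R]_(m + m) -> 'rV[R]_(m + m)).
Variables (f : 'rV[R]_(m + m) -> R) (U : set 'rV[R]_(m + m)).
Hypothesis Ff : local_finsler f U.
Let oU : open U := local_finsler_open Ff.
Local Notation energy := (energy f).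
Local Notation flat := (flat f).
Local Notation gform := (gform f).
Local Notation nconn := (nconn f).
Local Notation hlift := (hlift f).
Local Notation vpart := (vpart f).
Local Notation Psi := (loc_Psi f).

Let dflat z v : U z -> differentiable (flat^~ v) z.
Proof. exact: smooth_differentiable (smooth_flat Ff v). Qed.
Let dnconn z v : U z -> differentiable (nconn^~ v) z.
Proof. exact: smooth_differentiable (smooth_nconn Ff v). Qed.

Lemma lsubmx_Psi z a : U z -> lsubmx (Psi z a) = vpart z a.
Proof.
move=> Uz; rewrite (loc_PsiE Ff _ Uz) (linear_funB linear_lsubmx) lsubmx_hlift lsubmx_yvec.
by rewrite subr0.
Qed.

Lemma vpart_Psi z a : U z -> vpart z (Psi z a) = - lsubmx a.
Proof.
move=> Uz; rewrite (loc_PsiE Ff _ Uz) (linear_funB (linear_vpart Ff Uz)).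
by rewrite vpart_hlift (vpart_yvec Ff _ Uz) sub0r.
Qed.

Lemma linear_Psi z : U z -> linear (Psi z).
Proof.
move=> Uz s a b; apply: (hv_inj (f := f) (z := z)).
  rewrite lsubmx_Psi// (linear_vpart Ff Uz) (linear_lsubmx s (Psi z a) (Psi z b)).
  by rewrite !lsubmx_Psi.
rewrite vpart_Psi// (linear_vpart Ff Uz s (Psi z a)) !vpart_Psi//.
by rewrite (linear_lsubmx s a b) opprD scalerN.
Qed.

Lemma Psi_Psi z a : U z -> Psi z (Psi z a) = - a.
Proof.
move=> Uz; apply: (hv_inj (f := f) (z := z)).
  by rewrite lsubmx_Psi// vpart_Psi// (linear_funN linear_lsubmx).
by rewrite vpart_Psi// lsubmx_Psi// (linear_funN (linear_vpart Ff Uz)).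
Qed.

Definition loc_D z : set 'rV[R]_(m + m) :=
  [set a | flat z (lsubmx a) = 0 /\ flat z (vpart z a) = 0].

Lemma loc_DP z (s : R) a b : U z -> loc_D z a -> loc_D z b -> loc_D z (s *: a + b).
Proof.
move=> Uz [a1 a2] [b1 b2]; have lF := linear_flat Ff Uz.
have L (t : R) : t * 0 + 0 = 0 by rewrite mulr0 addr0.
split.
  apply: etrans (congr1 (flat z) (linear_lsubmx s a b)) _.
  apply: etrans (lF s (lsubmx a) (lsubmx b)) _.
  exact: etrans (congr2 (fun p q : R => s * p + q) a1 b1) (L s).
apply: etrans (congr1 (flat z) (linear_vpart Ff Uz s a b)) _.
apply: etrans (lF s (vpart z a) (vpart z b)) _.
exact: etrans (congr2 (fun p q : R => s * p + q) a2 b2) (L s).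
Qed.

Lemma loc_D0 z : U z -> loc_D z 0.
Proof.
move=> Uz; have lF := linear_flat Ff Uz; split.
  exact: (etrans (congr1 (flat z) (linear_fun0 (@linear_lsubmx R m))) (linear_fun0 lF)).
exact: (etrans (congr1 (flat z) (linear_fun0 (linear_vpart Ff Uz))) (linear_fun0 lF)).
Qed.

Lemma loc_D_Psi z a : U z -> loc_D z a -> loc_D z (Psi z a).
Proof.
move=> Uz [a1 a2]; split; first by rewrite lsubmx_Psi.
apply: etrans (congr1 (flat z) (vpart_Psi a Uz)) _.
apply: etrans (linear_funN (linear_flat Ff Uz) (lsubmx a)) _.
by rewrite a1 oppr0.
Qed.

Lemma smooth_Psi X : smooth_on U X -> smooth_on U (fun z => Psi z (X z)).
Proof.
move=> sX; apply: (smooth_eq_on oU (fun z Uz => esym (loc_PsiE Ff (X z) Uz))).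
apply: smoothB => //.
  apply: (smooth_linear_family (A := hlift) (X := fun z => vpart z (X z))) => //.
  - by move=> z Uz; exact: linear_hlift Ff _ Uz.
  - exact: smooth_hlift Ff.
  - exact: smooth_vpart Ff _ sX.
apply: smooth_linear_comp => //; first exact: linear_yvec.
exact: smooth_linear_comp linear_lsubmx sX.
Qed.

Definition loc_bracket X Y z := 'D_(X z) Y z - 'D_(Y z) X z.

(* Minus the vertical part of the bracket of two fields with constant components
   in the frame (delta/delta x^i, d/dy^i). *)
Definition defect z a b : 'rV[R]_m :=
  'D_a (nconn^~ (lsubmx b)) z - 'D_b (nconn^~ (lsubmx a)) z.

(** The components enter as separate functions agreeing with those of X and Y on U. Thus for a field
    [JX] one may supply the components of X, exchanged by Psi. *)
Lemma lsubmx_bracket X Y (hX hY : 'rV[R]_(m + m) -> 'rV[R]_m) z :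
  smooth_on U X -> smooth_on U Y ->
  (forall z, U z -> lsubmx (X z) = hX z) -> (forall z, U z -> lsubmx (Y z) = hY z) ->
  U z -> lsubmx (loc_bracket X Y z) = 'D_(X z) hY z - 'D_(Y z) hX z.
Proof.
move=> sX sY XE YE Uz; apply: etrans (linear_funB linear_lsubmx _ _) _.
have dX := smooth_differentiable sX Uz; have dY := smooth_differentiable sY Uz.
have E1 := derive_linear_comp (Y z) linear_lsubmx dX.
have E2 := derive_linear_comp (X z) linear_lsubmx dY.
have F1 := derive_eq_on (Y z) oU Uz XE; have F2 := derive_eq_on (X z) oU Uz YE.
have L (p q r s : 'rV[R]_m) : p = r -> q = s -> p - q = r - s by move=> -> ->.
exact: L (etrans (esym E2) F2) (etrans (esym E1) F1).
Qed.

Lemma derive_vpart X z u : smooth_on U X -> U z ->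
  'D_u (fun z => vpart z (X z)) z =
  'D_u (nconn^~ (lsubmx (X z))) z + vpart z ('D_u X z).
Proof.
move=> sX Uz; have dX := smooth_differentiable sX Uz.
have dv a := (is_diff_vpart Ff a Uz).1.
have E1 := derive_linear_family u oU Uz (fun z' => @linear_vpart _ _ _ _ Ff z') dv dX.
have E2 := (is_diff_vpart Ff (X z) Uz).2 u.
have L (p q r s : 'rV[R]_m) : p = q + s -> q = r -> p = r + s by move=> -> ->.
exact: L E1 E2.
Qed.

Lemma vpart_bracket X Y (vX vY : 'rV[R]_(m + m) -> 'rV[R]_m) z :
  smooth_on U X -> smooth_on U Y ->
  (forall z, U z -> vpart z (X z) = vX z) -> (forall z, U z -> vpart z (Y z) = vY z) ->
  U z -> vpart z (loc_bracket X Y z) =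
    'D_(X z) vY z - 'D_(Y z) vX z - defect z (X z) (Y z).
Proof.
move=> sX sY XE YE Uz; apply: etrans (linear_funB (linear_vpart Ff Uz) _ _) _.
have E1 := derive_vpart (Y z) sX Uz; have E2 := derive_vpart (X z) sY Uz.
have F1 := derive_eq_on (Y z) oU Uz XE; have F2 := derive_eq_on (X z) oU Uz YE.
have L (p q r s d e : 'rV[R]_m) : p = r + s -> d = e + q -> s - q = p - d - (r - e).
  by move=> -> ->; apply/rowP => i; rewrite !mxE; ring.
exact: L (etrans (esym F2) E2) (etrans (esym F1) E1).
Qed.

Hypothesis curv : forall z, U z -> exists lam : R, forall i j l,
  curvature f i j l z =
  lam * ((i == l)%:R * ylow f j z - (i == j)%:R * ylow f l z).

(** The Berwald coefficients dN^i_j/dy^k contracted with w^j v^k. *)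
Let B z v w : 'rV[R]_m := 'D_(yvec v) (nconn^~ w) z.

Let BC z v w : U z -> B z v w = B z w v.
Proof. by move=> Uz; exact: (derive_nconnC Ff v w Uz). Qed.

Let BN z v w : U z -> B z (- v) w = - B z v w.
Proof.
move=> Uz; rewrite /B.
apply: etrans (congr1 (derive (nconn^~ w) z) (linear_funN linear_yvec v)) _.
exact: derive_dirN (dnconn w Uz).
Qed.

(** The curvature term is a combination of the vectors [lsubmx a] and [lsubmx b] with coefficients
    that are multiples of [flat] of the other one, hence zero on the distribution. *)
Lemma defect_D z a b : U z -> loc_D z a -> loc_D z b ->
  defect z a b = B z (vpart z a) (lsubmx b) - B z (vpart z b) (lsubmx a).
Proof.
move=> Uz [a1 _] [b1 _]; have [lam curvz] := curv Uz.
have H := derive_hlift_nconn Ff (lsubmx b) (lsubmx a) Uz curvz.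
have L (h k : 'rV[R]_m) (s t : R) : s = 0 -> t = 0 -> lam *: (s *: h - t *: k) = 0.
  by move=> -> ->; rewrite !scale0r subr0 scaler0.
have H0 := etrans H (L (lsubmx a) (lsubmx b) _ _ b1 a1).
apply: etrans (derive_nconn_hv Ff a b Uz) _.
exact: etrans (congr1 (fun t => t + _) H0) (add0r _).
Qed.

Let BPsiPsi z a b : U z ->
  B z (vpart z (Psi z a)) (lsubmx (Psi z b)) = - B z (vpart z b) (lsubmx a).
Proof.
move=> Uz; apply: etrans (congr2 (B z) (vpart_Psi a Uz) (lsubmx_Psi b Uz)) _.
have L (p q r : 'rV[R]_m) : p = - q -> q = r -> p = - r by move=> -> ->.
exact: (L _ _ _ (BN (lsubmx a) (vpart z b) Uz) (BC (lsubmx a) (vpart z b) Uz)).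
Qed.

Let BPsil z a b : U z ->
  B z (vpart z (Psi z a)) (lsubmx b) = - B z (lsubmx a) (lsubmx b).
Proof.
move=> Uz; apply: etrans (congr1 (fun t => B z t (lsubmx b)) (vpart_Psi a Uz)) _.
exact: BN.
Qed.

(** Psi turns (h, v) into (v, -h), so each Berwald term becomes, by symmetry, minus the other
    one. *)
Lemma defect_PsiPsi z a b : U z -> loc_D z a -> loc_D z b ->
  defect z (Psi z a) (Psi z b) = defect z a b.
Proof.
move=> Uz Da Db; have E1 := defect_D Uz Da Db.
have E2 := defect_D Uz (loc_D_Psi Uz Da) (loc_D_Psi Uz Db).
have L (d d' p q r s : 'rV[R]_m) : d = p - q -> d' = r - s -> r = - q -> s = - p -> d' = d.
  by move=> -> -> -> ->; rewrite opprK addrC.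
exact: L E1 E2 (BPsiPsi a b Uz) (BPsiPsi b a Uz).
Qed.

(** Only the terms B(v_a, v_b) and B(h_a, h_b) occur, each twice with opposite signs once B is
    symmetric. *)
Lemma defect_Psi z a b : U z -> loc_D z a -> loc_D z b ->
  defect z a (Psi z b) + defect z (Psi z a) b = 0.
Proof.
move=> Uz Da Db.
have E1 := defect_D Uz Da (loc_D_Psi Uz Db).
have E2 := defect_D Uz (loc_D_Psi Uz Da) Db.
have F1 : B z (vpart z a) (lsubmx (Psi z b)) = B z (vpart z a) (vpart z b) :=
  congr1 (B z (vpart z a)) (lsubmx_Psi b Uz).
have F2 : B z (vpart z b) (lsubmx (Psi z a)) = B z (vpart z a) (vpart z b) :=
  etrans (congr1 (B z (vpart z b)) (lsubmx_Psi a Uz)) (BC (vpart z b) (vpart z a) Uz).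
have F3 := BPsil b a Uz; have F4 := BPsil a b Uz.
have F5 := BC (lsubmx a) (lsubmx b) Uz.
have L (d d' p q r s t n n' : 'rV[R]_m) : d = p - q -> d' = r - s ->
    p = t -> s = t -> q = - n -> r = - n' -> n' = n -> d + d' = 0.
  by move=> -> -> -> -> -> -> ->; apply/rowP => i; rewrite !mxE; ring.
exact: L E1 E2 F1 F2 F3 F4 F5.
Qed.

Section TwoSections.
Variables X Y : 'rV[R]_(m + m) -> 'rV[R]_(m + m).
Hypotheses (sX : smooth_on U X) (sY : smooth_on U Y).
Hypotheses (DX : forall z, U z -> loc_D z (X z)) (DY : forall z, U z -> loc_D z (Y z)).

(** Differentiating the constraint [flat z (h z) = 0] trades the derivative of a component for a
    derivative of the form [flat]. *)
Let flat0 z (h : 'rV[R]_(m + m) -> 'rV[R]_m) u : U z -> differentiable h z ->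
  (forall z, U z -> flat z (h z) = 0) ->
  flat z ('D_u h z) = - 'D_u (flat^~ (h z)) z.
Proof.
move=> Uz dh h0.
have E := derive_linear_family u oU Uz (fun z' => @linear_flat _ _ _ _ Ff z')
  (fun v => dflat v Uz) dh.
have F := derive_eq_on (g := fun=> 0 : R^o) u oU Uz h0.
have F0 : 'D_u (fun=> 0 : R^o) z = 0 := derive_cst (0 : R^o) z u.
have L (p q : R) : p + q = 0 -> q = - p by move=> /eqP; rewrite addrC addr_eq0 => /eqP.
exact: L (etrans (esym E) (etrans F F0)).
Qed.

(** The formula omega([X,Y]) = -d omega(X,Y), valid for a one-form omega that vanishes on X and Y;
    here omega = y_i dx^i. *)
Lemma flat_lsubmx_bracket z : U z ->
  flat z (lsubmx (loc_bracket X Y z)) =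
  gform z (vpart z (Y z)) (lsubmx (X z)) - gform z (vpart z (X z)) (lsubmx (Y z)).
Proof.
move=> Uz.
pose hX z := lsubmx (X z); pose hY z := lsubmx (Y z).
have shX : smooth_on U hX by exact: smooth_linear_comp linear_lsubmx sX.
have shY : smooth_on U hY by exact: smooth_linear_comp linear_lsubmx sY.
have dhX := smooth_differentiable shX Uz; have dhY := smooth_differentiable shY Uz.
have EX := flat0 (Y z) Uz dhX (fun z Uz => (DX Uz).1).
have EY := flat0 (X z) Uz dhY (fun z Uz => (DY Uz).1).
have E := lsubmx_bracket sX sY (fun z _ => erefl (hX z)) (fun z _ => erefl (hY z)) Uz.
apply: etrans (congr1 (flat z) E) _.
apply: etrans (linear_funB (linear_flat Ff Uz) _ _) _.
apply: etrans (congr2 (fun s t => s - t) EY EX) _.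
apply: etrans _ (derive_flat_hv Ff (X z) (Y z) Uz).
have L (p q : R) : - p - - q = q - p by rewrite opprK addrC.
exact: L.
Qed.

(* D_F is tangent to the level sets of F^2. *)
Lemma flat_vpart_bracket z : U z -> flat z (vpart z (loc_bracket X Y z)) = 0.
Proof.
move=> Uz; apply: etrans (esym (derive_energy Ff (loc_bracket X Y z) Uz)) _.
have dE : differentiable energy z := smooth_differentiable (smooth_energy Ff) Uz.
have dEv u : differentiable (fun z => 'D_u energy z) z.
  exact: smooth_differentiable (smooth_derive u (smooth_energy Ff)) Uz.
have lE z' : U z' -> linear (fun u => 'D_u energy z').
  move=> Uz' s u v; apply: derive_dirP.
  exact: smooth_differentiable (smooth_energy Ff) Uz'.
have dX := smooth_differentiable sX Uz; have dY := smooth_differentiable sY Uz.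
have F0 u : 'D_u (fun=> 0 : R^o) z = 0 := derive_cst (0 : R^o) z u.
have X0 z' : U z' -> 'D_(X z') energy z' = 0.
  by move=> Uz'; apply: etrans (derive_energy Ff (X z') Uz') (DX Uz').2.
have Y0 z' : U z' -> 'D_(Y z') energy z' = 0.
  by move=> Uz'; apply: etrans (derive_energy Ff (Y z') Uz') (DY Uz').2.
have EX := derive_linear_family (Y z) oU Uz lE dEv dX.
have EY := derive_linear_family (X z) oU Uz lE dEv dY.
have GX := etrans (derive_eq_on (g := fun=> 0 : R^o) (Y z) oU Uz X0) (F0 (Y z)).
have GY := etrans (derive_eq_on (g := fun=> 0 : R^o) (X z) oU Uz Y0) (F0 (X z)).
have swap := derive_swap_real (X z) (Y z) oU Uz (smooth_energy Ff).
have L (p q r s : R) : p = q -> p + r = 0 -> q + s = 0 -> r - s = 0.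
  by move=> -> /(canRL (addKr _)) -> /(canRL (addKr _)) ->; rewrite subrr.
apply: etrans (derive_dirB _ _ dE) _.
exact: L swap (etrans (esym EY) GY) (etrans (esym EX) GX).
Qed.

End TwoSections.

Lemma loc_integrable X Y z : smooth_on U X -> smooth_on U Y ->
  (forall z, U z -> loc_D z (X z)) -> (forall z, U z -> loc_D z (Y z)) -> U z ->
  let JX z := Psi z (X z) in let JY z := Psi z (Y z) in
  loc_D z (loc_bracket JX JY z - loc_bracket X Y z) /\
  loc_bracket JX JY z - loc_bracket X Y z =
  Psi z (loc_bracket X JY z + loc_bracket JX Y z).
Proof.
move=> sX sY DX DY Uz JX JY.
have sJX : smooth_on U JX := smooth_Psi sX.
have sJY : smooth_on U JY := smooth_Psi sY.
have DJX z' : U z' -> loc_D z' (JX z') by move=> Uz'; exact: loc_D_Psi (DX _ Uz').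
have DJY z' : U z' -> loc_D z' (JY z') by move=> Uz'; exact: loc_D_Psi (DY _ Uz').
have lF := linear_flat Ff Uz; have lV := linear_vpart Ff Uz.
split; first split.
- apply: etrans (congr1 (flat z) (linear_funB linear_lsubmx _ _)) _.
  apply: etrans (linear_funB lF _ _) _.
  have E1 := flat_lsubmx_bracket sJX sJY DJX DJY Uz.
  have E2 := flat_lsubmx_bracket sX sY DX DY Uz.
  have lg w := linear_funN (linear_gforml Ff w Uz).
  have L0 (p q r s : R) : p = q -> q = - r -> r = s -> p = - s by move=> -> -> ->.
  have G a b : gform z (vpart z (Psi z b)) (lsubmx (Psi z a)) =
      - gform z (vpart z a) (lsubmx b) :=
    L0 _ _ _ _ (congr2 (gform z) (vpart_Psi b Uz) (lsubmx_Psi a Uz))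
      (lg (vpart z a) (lsubmx b)) (gformC Ff (lsubmx b) (vpart z a) Uz).
  have L (p q r s : R) : p = - s -> q = - r -> p - q - (r - s) = 0.
    by move=> -> ->; ring.
  apply: etrans (congr2 (fun s t => s - t) E1 E2) _.
  exact: L (G (X z) (Y z)) (G (Y z) (X z)).
- apply: etrans (congr1 (flat z) (linear_funB lV _ _)) _.
  apply: etrans (linear_funB lF _ _) _.
  have E1 := flat_vpart_bracket sJX sJY DJX DJY Uz.
  have E2 := flat_vpart_bracket sX sY DX DY Uz.
  exact: etrans (congr2 (fun s t => s - t) E1 E2) (subr0 _).
(* The fields [JX] and [JY] have horizontal components [vX], [vY] and vertical components [nhX],
   [nhY]; the four brackets are computed from these. *)
pose hX z := lsubmx (X z); pose hY z := lsubmx (Y z).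
pose vX z := vpart z (X z); pose vY z := vpart z (Y z).
pose nhX z := - hX z; pose nhY z := - hY z.
have dhX : differentiable hX z.
  by apply: smooth_differentiable Uz; exact: smooth_linear_comp linear_lsubmx sX.
have dhY : differentiable hY z.
  by apply: smooth_differentiable Uz; exact: smooth_linear_comp linear_lsubmx sY.
have XhE z' : U z' -> lsubmx (X z') = hX z' by [].
have YhE z' : U z' -> lsubmx (Y z') = hY z' by [].
have XvE z' : U z' -> vpart z' (X z') = vX z' by [].
have YvE z' : U z' -> vpart z' (Y z') = vY z' by [].
have JXhE z' : U z' -> lsubmx (JX z') = vX z' by move=> Uz'; exact: lsubmx_Psi.
have JYhE z' : U z' -> lsubmx (JY z') = vY z' by move=> Uz'; exact: lsubmx_Psi.
have JXvE z' : U z' -> vpart z' (JX z') = nhX z' by move=> Uz'; exact: vpart_Psi.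
have JYvE z' : U z' -> vpart z' (JY z') = nhY z' by move=> Uz'; exact: vpart_Psi.
have NX u : 'D_u nhX z = - 'D_u hX z := deriveNE u dhX.
have NY u : 'D_u nhY z = - 'D_u hY z := deriveNE u dhY.
have h1 := lsubmx_bracket sX sY XhE YhE Uz.
have h2 := lsubmx_bracket sJX sJY JXhE JYhE Uz.
have h3 := lsubmx_bracket sX sJY XhE JYhE Uz.
have h4 := lsubmx_bracket sJX sY JXhE YhE Uz.
have v1 := vpart_bracket sX sY XvE YvE Uz.
have v2 := vpart_bracket sJX sJY JXvE JYvE Uz.
have v3 := vpart_bracket sX sJY XvE JYvE Uz.
have v4 := vpart_bracket sJX sY JXvE YvE Uz.
have O1 := defect_PsiPsi Uz (DX _ Uz) (DY _ Uz).
have O2 := defect_Psi Uz (DX _ Uz) (DY _ Uz).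
(* In each component the derivatives of the component functions cancel. What is left is the sum in
   [defect_Psi] horizontally, and the difference in [defect_PsiPsi] vertically. *)
apply: (hv_inj (f := f) (z := z)).
  apply: etrans _ (esym (lsubmx_Psi _ Uz)).
  apply: etrans (linear_funB linear_lsubmx _ _) _.
  apply: etrans _ (esym (linear_funD lV _ _)).
  have L (a b c d e e' l1 l2 w1 w2 o3 o4 : 'rV[R]_m) : l2 = a - b -> l1 = c - d ->
     w1 = e - b - o3 -> e = - c -> w2 = a - e' - o4 -> e' = - d -> o3 + o4 = 0 ->
     l2 - l1 = w1 + w2.
    move=> -> -> -> -> -> -> /eqP; rewrite addr_eq0 => /eqP ->.
    by apply/rowP => i; rewrite !mxE; ring.
  exact: L h2 h1 v3 (NY _) v4 (NX _) O2.
apply: etrans _ (esym (vpart_Psi _ Uz)).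
apply: etrans (linear_funB lV _ _) _.
apply: etrans _ (esym (congr1 (fun t => - t) (linear_funD linear_lsubmx _ _))).
have L (a b c d e e' l1 l2 w1 w2 o1 o2 : 'rV[R]_m) :
   w2 = e - e' - o2 -> e = - c -> e' = - d -> w1 = a - b - o1 -> o2 = o1 ->
   l1 = a - d -> l2 = c - b -> w2 - w1 = - (l1 + l2).
  by move=> -> -> -> -> -> -> ->; apply/rowP => i; rewrite !mxE; ring.
exact: L v2 (NY _) (NX _) v1 O1 h3 h4.
Qed.

End LocalCR.

(** * Change of chart *)

Lemma local_finsler_sub (R : realType) (m : nat) (f : 'rV[R]_(m + m) -> R)
    (U V : set 'rV[R]_(m + m)) :
  open V -> V `<=` U -> local_finsler f U -> local_finsler f V.
Proof.
move=> oV VU [oU sf eu un po]; split=> //.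
- exact: smooth_sub sf.
- by move=> z /VU; exact: eu.
- by move=> z /VU; exact: un.
- by move=> z v /VU; exact: po.
Qed.

Lemma gform_sum (R : realType) (m : nat) (f : 'rV[R]_(m + m) -> R)
    (U : set 'rV[R]_(m + m)) z (v w : 'rV[R]_m) : local_finsler f U -> U z ->
  \sum_i \sum_j glow f i j z * v 0 i * w 0 j = gform f z v w.
Proof.
move=> Ff Uz; rewrite (linear_row_sum (linear_gforml Ff w Uz) v).
apply: eq_bigr => i _; rewrite -(sum_gformr Ff _ w Uz) scaler_sumr.
apply: eq_bigr => j _; rewrite (glowE Ff i j Uz).
have L (s t r : R) : r * s * t = s *: ((r * t) : R^o) by rewrite /GRing.scale/=; ring.
exact: L.
Qed.

Lemma gform_pos (R : realType) (m : nat) (f : 'rV[R]_(m + m) -> R)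
    (U : set 'rV[R]_(m + m)) z v :
  local_finsler f U -> U z -> v != 0 -> 0 < gform f z v v.
Proof.
by move=> Ff Uz v0; have := local_finsler_pos Ff Uz v0; rewrite (gform_sum _ _ Ff Uz).
Qed.

(** The derivatives of [phi] at the base point are viewed as functions of z = (x, y), so that they
    form families of linear maps over the coordinates of TM. *)
Definition tderiv {R : realType} {m : nat} (phi : 'rV[R]_m -> 'rV[R]_m)
  (z : 'rV[R]_(m + m)) v := 'D_v phi (lsubmx z).

Definition tderiv2 {R : realType} {m : nat} (phi : 'rV[R]_m -> 'rV[R]_m)
  (z : 'rV[R]_(m + m)) v w := 'D_v (fun x => 'D_w phi x) (lsubmx z).

Section ChangeOfChart.
Context {R : realType} {m : nat}.
Implicit Types (v w c x y h k : 'rV[R]_m) (z a b u : 'rV[R]_(m + m)).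
Variables (f f' : 'rV[R]_(m + m) -> R) (U U' : set 'rV[R]_(m + m)).
Variables (phi : 'rV[R]_m -> 'rV[R]_m) (V : set 'rV[R]_m).
Hypotheses (Ff : local_finsler f U) (Ff' : local_finsler f' U').
Hypotheses (oV : open V) (sphi : smooth_on V phi).
Local Notation tau := (tmap phi).
Hypotheses (UV : forall z, U z -> V (lsubmx z)) (UU' : forall z, U z -> U' (tau z)).
Hypothesis ff' : forall z, U z -> f z = f' (tau z).
Hypothesis phi_onto : forall z c, U z -> exists v, 'D_v phi (lsubmx z) = c.

Let oU : open U := local_finsler_open Ff.
Local Notation d1 := (tderiv phi).
Local Notation d2 := (tderiv2 phi).
Local Notation T z u := ('D_u tau z).

Let stau : smooth_on U tau.
Proof. by apply: smooth_sub (smooth_tmap oV sphi) => z /UV. Qed.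

Let dtau z : U z -> differentiable tau z.
Proof. exact: smooth_differentiable stau. Qed.

Let ld1 z : U z -> linear (d1 z).
Proof.
move=> Uz s v w; apply: derive_dirP; exact: smooth_differentiable sphi (UV Uz).
Qed.

Let ld2 z w : U z -> linear ((d2 z)^~ w).
Proof.
move=> Uz s v v'; apply: derive_dirP.
exact: smooth_differentiable (smooth_derive w sphi) (UV Uz).
Qed.

Let d2C z v w : U z -> d2 z v w = d2 z w v.
Proof. by move=> Uz; exact: (derive_swap v w oV (UV Uz) sphi). Qed.

Let TE z u : U z -> T z u = row_mx (d1 z (lsubmx u))
  (d2 z (lsubmx u) (rsubmx z) + d1 z (rsubmx u)).
Proof. by move=> Uz; exact: (derive_tmap oV sphi u (UV Uz)). Qed.

Let lsubmx_T z u : U z -> lsubmx (T z u) = d1 z (lsubmx u).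
Proof. by move=> Uz; rewrite TE// row_mxKl. Qed.

Let rsubmx_T z u : U z -> rsubmx (T z u) = d2 z (lsubmx u) (rsubmx z) + d1 z (rsubmx u).
Proof. by move=> Uz; rewrite TE// row_mxKr. Qed.

Let T_yvec z v : U z -> T z (yvec v) = yvec (d1 z v).
Proof.
move=> Uz; rewrite TE// lsubmx_yvec rsubmx_yvec.
rewrite (linear_fun0 (ld1 Uz)) (linear_fun0 (ld2 (rsubmx z) Uz)) add0r row_mx_xyvec.
by rewrite (linear_fun0 linear_xvec) add0r.
Qed.

Let T_xvec z v : U z -> T z (xvec v) = xvec (d1 z v) + yvec (d2 z v (rsubmx z)).
Proof.
move=> Uz; rewrite TE// lsubmx_xvec rsubmx_xvec.
by rewrite (linear_fun0 (ld1 Uz)) addr0 row_mx_xyvec.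
Qed.

Let rsubmx_tau z : rsubmx (tau z) = d1 z (rsubmx z).
Proof. by rewrite /tmap row_mxKr. Qed.

Let smooth_d1 v : smooth_on U (fun z => d1 z v).
Proof. by apply: smooth_sub (smooth_derive_over oV sphi v) => z /UV. Qed.

Let derive_d1 z u v : U z -> 'D_u (fun z => d1 z v) z = d2 z (lsubmx u) v.
Proof.
move=> Uz; have dl := linear_row_differentiable z (@linear_lsubmx R m).
have dp := smooth_differentiable (smooth_derive v sphi) (UV Uz).
apply: etrans (derive_comp u dl dp) _.
exact: (congr1 (derive ('D_v phi) (lsubmx z)) (derive_linear_row z u (@linear_lsubmx R m))).
Qed.

Lemma energy_tmap z : U z -> energy f z = energy f' (tau z).
Proof. by move=> Uz; rewrite !energyE ff'. Qed.

Let dE' z : U z -> differentiable (energy f') (tau z).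
Proof. by move=> Uz; exact: smooth_differentiable (smooth_energy Ff') (UU' Uz). Qed.

Let dflat' z v : U z -> differentiable ((flat f')^~ v) (tau z).
Proof. by move=> Uz; exact: smooth_differentiable (smooth_flat Ff' v) (UU' Uz). Qed.

Lemma derive_energy_tmap z u : U z -> 'D_u (energy f) z = 'D_(T z u) (energy f') (tau z).
Proof.
move=> Uz; apply: etrans (derive_eq_on u oU Uz energy_tmap) _.
exact: derive_comp (dtau Uz) (dE' Uz).
Qed.

Lemma flat_tmap z v : U z -> flat f z v = flat f' (tau z) (d1 z v).
Proof.
move=> Uz; apply: etrans (derive_energy_tmap (yvec v) Uz) _.
exact: (congr1 (derive (energy f') (tau z)) (T_yvec v Uz)).
Qed.

(** The last term comes from differentiating the coefficient d phi in [flat_tmap]. It depends only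
    on the x-part of u, so it disappears in vertical directions, which makes g a tensor. *)
Lemma derive_flat_tmap z u v : U z -> 'D_u ((flat f)^~ v) z =
  'D_(T z u) ((flat f')^~ (d1 z v)) (tau z) + flat f' (tau z) (d2 z (lsubmx u) v).
Proof.
move=> Uz.
have E1 := derive_eq_on u oU Uz (fun z' => @flat_tmap z' v).
have dA c : differentiable (fun z => flat f' (tau z) c) z.
  exact: differentiable_comp (dtau Uz) (dflat' c Uz).
have dX := smooth_differentiable (smooth_d1 v) Uz.
have lA z' : U z' -> linear (flat f' (tau z')).
  move=> Uz'; exact: (linear_flat Ff' (UU' Uz')).
have E2 := derive_linear_family u oU Uz lA dA dX.
have E3 := derive_comp u (dtau Uz) (dflat' (d1 z v) Uz).
have E4 := congr1 (flat f' (tau z)) (derive_d1 u v Uz).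
have L (p q r s t w : R) : p = q -> q = r + s -> r = t -> s = w -> p = t + w.
  by move=> -> -> -> ->.
exact: L E1 E2 E3 E4.
Qed.

Lemma gform_tmap z v w : U z ->
  gform f z v w = gform f' (tau z) (d1 z v) (d1 z w).
Proof.
move=> Uz; have E1 := derive_flat_tmap (yvec v) w Uz.
have E2 := congr1 (derive ((flat f')^~ (d1 z w)) (tau z)) (T_yvec v Uz).
have E3 : flat f' (tau z) (d2 z (lsubmx (yvec v)) w) = 0.
  apply: etrans (congr1 (fun t => flat f' (tau z) (d2 z t w)) (lsubmx_yvec v)) _.
  apply: etrans (congr1 (flat f' (tau z)) (linear_fun0 (ld2 w Uz))) _.
  exact: linear_fun0 (linear_flat Ff' (UU' Uz)).
have L (p q r s : R) : p = q + r -> q = s -> r = 0 -> p = s.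
  by move=> -> -> ->; rewrite addr0.
exact: L E1 E2 E3.
Qed.

(* Both sides of the geodesic equation change by [gform' (d2 y y)], since the
   terms with a second derivative contracted with [flat'] cancel. *)
Lemma gspray_tmap z : U z ->
  d1 z (gspray f z) = gspray f' (tau z) + d2 z (rsubmx z) (rsubmx z).
Proof.
move=> Uz; set y := rsubmx z.
pose Q := d2 z y y; pose G := gspray f' (tau z).
have lg' v := linear_gformr Ff' v (UU' Uz).
have key v : gform f' (tau z) (d1 z v) (d1 z (gspray f z)) =
    gform f' (tau z) (d1 z v) (G + Q).
  have E1 := geodesic_eq Ff v Uz; have E2 := geodesic_eq Ff' (d1 z v) (UU' Uz).
  have E3 := derive_flat_tmap (xvec y) v Uz.
  have E4 := derive_energy_tmap (xvec v) Uz.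
  have E5 : 'D_(T z (xvec y)) ((flat f')^~ (d1 z v)) (tau z) =
      'D_(xvec (rsubmx (tau z))) ((flat f')^~ (d1 z v)) (tau z) +
      gform f' (tau z) Q (d1 z v).
    have E : T z (xvec y) = xvec (rsubmx (tau z)) + yvec Q.
      by rewrite T_xvec// rsubmx_tau.
    apply: etrans (congr1 (derive ((flat f')^~ (d1 z v)) (tau z)) E) _.
    exact: derive_dirD (dflat' (d1 z v) Uz).
  have E6 : 'D_(T z (xvec v)) (energy f') (tau z) =
      'D_(xvec (d1 z v)) (energy f') (tau z) + flat f' (tau z) (d2 z v y).
    apply: etrans (congr1 (derive (energy f') (tau z)) (T_xvec v Uz)) _.
    exact: derive_dirD (dE' Uz).
  have E7 : flat f' (tau z) (d2 z (lsubmx (xvec y)) v) = flat f' (tau z) (d2 z v y).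
    apply: (congr1 (flat f' (tau z))).
    have -> : lsubmx (xvec y) = y := lsubmx_xvec y.
    exact: (d2C y v Uz).
  have E8 := gformC Ff' Q (d1 z v) (UU' Uz).
  have E9 := gform_tmap v (gspray f z) Uz.
  have E10 := linear_funD (lg' (d1 z v)) G Q.
  have L (g g1 g2 gq gq' gs F E F' E' t t' H H' : R) :
    g = F - E -> g2 = H - H' -> F = F' + t -> E = E' -> F' = H + gq ->
    E' = H' + t' -> t = t' -> gq = gq' -> g = g1 -> gs = g2 + gq' -> g1 = gs.
    by move=> e1 e2 e3 e4 e5 e6 e7 e8 <- ->; rewrite e1 e2 e3 e4 e5 e6 e7 e8; ring.
  exact: L E1 E2 E3 E4 E5 E6 E7 E8 E9 E10.
(* Since d phi is onto, the difference of the two sides is itself of the form [d1 z v]; by [key] it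
   is orthogonal to itself, so positivity of g forces it to vanish. *)
have [v vE] := phi_onto (d1 z (gspray f z) - (G + Q)) Uz.
apply/eqP; rewrite -subr_eq0; apply/negP => /negP nz.
have := gform_pos Ff' (UU' Uz) nz.
have E0 : gform f' (tau z) (d1 z v) (d1 z (gspray f z) - (G + Q)) = 0.
  apply: etrans (linear_funB (lg' (d1 z v)) _ _) _.
  by rewrite key subrr.
have E1 := congr1 (fun t => gform f' (tau z) t (d1 z (gspray f z) - (G + Q))) vE.
have L (p q : R) : p = q -> p = 0 -> ~ (0 < q) by move=> -> ->; rewrite ltxx.
exact: (L _ _ E1 E0).
Qed.

Let derive_base z c (h : 'rV[R]_m -> 'rV[R]_m) : differentiable h (lsubmx z) ->
  'D_(yvec c) (fun z => h (lsubmx z)) z = 0.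
Proof.
move=> dh; have dl := linear_row_differentiable z (@linear_lsubmx R m).
apply: etrans (derive_comp (yvec c) dl dh) _.
have E := etrans (derive_linear_row z (yvec c) (@linear_lsubmx R m)) (lsubmx_yvec c).
apply: etrans (congr1 (derive h (lsubmx z)) E) _.
exact: derive0.
Qed.

(** A quadratic form in y whose coefficients depend on x alone, hence are constant in vertical
    directions. *)
Let is_diff_d2 z c : U z -> differentiable (fun z => d2 z (rsubmx z) (rsubmx z)) z /\
  'D_(yvec c) (fun z => d2 z (rsubmx z) (rsubmx z)) z = 2 *: d2 z c (rsubmx z).
Proof.
move=> Uz; set y := rsubmx z.
have dy := differentiable_rsub z.
have yE : 'D_(yvec c) rsubmx z = c := etrans (derive_rsubmx z (yvec c)) (rsubmx_yvec c).
have lA2 v z' : U z' -> linear (d2 z' v).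
  move=> Uz'.
  apply: (linear_derive_family v oV (UV Uz') (A := fun x w => 'D_w phi x)) => [x Vx s w w'|w].
    by apply: derive_dirP; exact: smooth_differentiable sphi Vx.
  exact: smooth_differentiable (smooth_derive w sphi) (UV Uz').
have dphi2 v w : differentiable (fun x => 'D_v ('D_w phi) x) (lsubmx z).
  exact: smooth_differentiable (smooth_derive v (smooth_derive w sphi)) (UV Uz).
have dA2 v w : differentiable (fun z => d2 z v w) z.
  exact: differentiable_comp (linear_row_differentiable z (@linear_lsubmx R m)) (dphi2 v w).
have [dA1 _] := is_diff_linear_family oU Uz (lA2 y) (dA2 y) dy.
have dA v : differentiable (fun z => d2 z v (rsubmx z)) z.
  exact: (is_diff_linear_family oU Uz (lA2 v) (dA2 v) dy).1.
have lA z' : U z' -> linear (fun v => d2 z' v (rsubmx z')).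
  by move=> Uz'; exact: ld2.
have E1 := derive_linear_family (yvec c) oU Uz lA dA dy.
have E2 := derive_linear_family (yvec c) oU Uz (lA2 y) (dA2 y) dy.
have E3 : 'D_(yvec c) (fun z => d2 z y y) z = 0 := derive_base c (dphi2 y y).
have E4 := congr1 (d2 z y) yE; have E5 := d2C y c Uz.
have E6 := congr1 (fun v => d2 z v y) yE.
have L (p q r s t e e' : 'rV[R]_m) : p = q + r -> q = s + t -> s = 0 -> t = e -> e = e' ->
    r = e' -> p = 2 *: e'.
  by move=> -> -> -> -> -> ->; rewrite add0r scaler_nat mulr2n.
split; last exact: (L _ _ _ _ _ _ _ E1 E2 E3 E4 E5 E6).
exact: (is_diff_linear_family oU Uz lA dA dy).1.
Qed.

Lemma nconn_tmap z c : U z ->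
  d1 z (nconn f z c) = nconn f' (tau z) (d1 z c) + d2 z c (rsubmx z).
Proof.
move=> Uz; have E1 := derive_eq_on (yvec c) oU Uz gspray_tmap.
have dG := smooth_differentiable (smooth_gspray Ff) Uz.
have dG' := smooth_differentiable (smooth_gspray Ff') (UU' Uz).
have dd1 v : differentiable (fun z => d1 z v) z := smooth_differentiable (smooth_d1 v) Uz.
have E2 := derive_linear_family (yvec c) oU Uz ld1 dd1 dG.
have dg := smooth_differentiable (smooth_derive (gspray f z) sphi) (UV Uz).
have E3 : 'D_(yvec c) (d1^~ (gspray f z)) z = 0 := derive_base c dg.
have E4 := congr1 (d1 z) (derive_gspray f z c).
have E5 := linear_funZ (ld1 Uz) 2 (nconn f z c).
have [dQ E6] := is_diff_d2 c Uz.
have dG'tau : differentiable (fun z => gspray f' (tau z)) z.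
  exact: differentiable_comp (dtau Uz) dG'.
have E7 := deriveDE (yvec c) dG'tau dQ.
have E8 := derive_comp (yvec c) (dtau Uz) dG'.
have E9 := etrans (congr1 (derive (gspray f') (tau z)) (T_yvec c Uz))
  (derive_gspray f' (tau z) (d1 z c)).
have L (p q r r1 r2 s t t1 t2 : 'rV[R]_m) : p = q -> p = s + r -> s = 0 -> r = r1 ->
    r1 = 2 *: r2 -> t1 = 2 *: t2 -> q = t + t1 -> forall t3 t4, t = t3 -> t3 = 2 *: t4 ->
    r2 = t4 + t2.
  move=> -> e1 e2 e3 e4 e5 e6 t3 t4 e7 e8.
  have : 2 *: r2 = 2 *: (t4 + t2) by rewrite -e4 -e3 scalerDr -e5 -e8 -e7 -e6 e1 e2 add0r.
  by apply: scalerI; rewrite pnatr_eq0.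
exact: (L _ _ _ _ _ _ _ _ _ E1 E2 E3 E4 E5 E6 E7 _ _ E8 E9).
Qed.

(** The second derivative of [phi] in the differential of [tmap] cancels against the one in
    [nconn_tmap]; this is the tensoriality of delta y^i. *)
Lemma vpart_tmap z u : U z -> vpart f' (tau z) (T z u) = d1 z (vpart f z u).
Proof.
move=> Uz; rewrite !vpartE.
have E1 := rsubmx_T u Uz; have E2 := congr1 (nconn f' (tau z)) (lsubmx_T u Uz).
have E3 := nconn_tmap (lsubmx u) Uz.
have E4 := linear_funD (ld1 Uz) (rsubmx u) (nconn f z (lsubmx u)).
have L (p q r s t a b : 'rV[R]_m) : p = q + r -> s = t -> a = t + q -> b = r + a ->
    p + s = b by move=> -> -> -> ->; apply/rowP => i; rewrite !mxE; ring.
exact: (L _ _ _ _ _ _ _ E1 E2 E3 E4).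
Qed.

Lemma Psi_tmap z u : U z -> loc_Psi f' (tau z) (T z u) = T z (loc_Psi f z u).
Proof.
move=> Uz; have Uz' := UU' Uz; apply: (hv_inj (f := f') (z := tau z)).
  apply: etrans (lsubmx_Psi Ff' (T z u) Uz') _.
  apply: etrans (vpart_tmap u Uz) _.
  apply: etrans (congr1 (d1 z) (esym (lsubmx_Psi Ff u Uz))) _.
  exact: (esym (lsubmx_T (loc_Psi f z u) Uz)).
apply: etrans (vpart_Psi Ff' (T z u) Uz') _.
apply: etrans (congr1 (fun t => - t) (lsubmx_T u Uz)) _.
apply: etrans (esym (linear_funN (ld1 Uz) (lsubmx u))) _.
apply: etrans (congr1 (d1 z) (esym (vpart_Psi Ff u Uz))) _.
exact: (esym (vpart_tmap (loc_Psi f z u) Uz)).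
Qed.

Lemma loc_D_tmap z u : U z -> loc_D f z u -> loc_D f' (tau z) (T z u).
Proof.
move=> Uz [u1 u2]; split.
  apply: etrans (congr1 (flat f' (tau z)) (lsubmx_T u Uz)) _.
  exact: (etrans (esym (flat_tmap (lsubmx u) Uz)) u1).
apply: etrans (congr1 (flat f' (tau z)) (vpart_tmap u Uz)) _.
exact: (etrans (esym (flat_tmap (vpart f z u) Uz)) u2).
Qed.

End ChangeOfChart.

(** * The distribution D_F and the structure J_F *)

(** Euler's theorem in degree 2, obtained by differentiating (1 + t)^2 f(x) at t = 0. The
    restriction to t > -1 reflects that F is homogeneous for positive factors; it still covers a
    neighbourhood of 0. *)
Lemma derive_homogeneous (R : realType) (V : normedModType R) (f : V -> R^o) (x u : V) :
  (forall t : R, -1 < t -> f (x + t *: u) = (1 + t) ^+ 2 * f x) ->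
  'D_u f x = 2 * f x.
Proof.
move=> hom.
have E : (fun t : R => t^-1 *: (((fun s => f (x + s *: u)) \o shift 0) (t *: 1) -
                                 f (x + 0 *: u))) =
           (fun t => t^-1 *: ((f \o shift x) (t *: u) - f x)).
  apply/funext => t /=; rewrite scale0r !addr0; congr (_ *: (f _ - _)).
  by rewrite [t *: 1]mulr1 addrC.
have -> : 'D_u f x = 'D_1 (fun s : R => f (x + s *: u)) 0.
  exact: (esym (congr1 (fun g => lim (g @ 0^')) E)).
have o1 : open [set t : R | -1 < t] by exact: open_gt.
have m10 : [set t : R | -1 < t] 0 by rewrite /= oppr_lt0.
rewrite (derive_eq_on (g := fun t : R => (1 + t) ^+ 2 * f x : R^o) _ o1 m10 hom).
have D : is_derive (0 : R) 1 (fun t : R => (1 + t) ^+ 2 * f x : R^o) (2 * f x).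
  have D1 : is_derive (0 : R) 1 (fun t : R => 1 + t) 1.
    have := is_deriveD (is_derive_cst (1 : R) (0 : R) 1) (is_derive_id (0 : R) 1).
    by rewrite add0r.
  have -> : (fun t : R => (1 + t) ^+ 2 * f x : R^o) =
            (fun t : R => 1 + t) * (fun t : R => 1 + t) * cst (f x).
    by apply/funext => t; rewrite expr2.
  apply: is_derive_eq; rewrite /GRing.scale/= /cst addr0; ring.
by rewrite derive_val.
Qed.

Section SlitChart.
Context {R : realType} {m : nat} {M : atlas R m}.
Local Notation TM := (tangent_bundle M).
Local Notation T0M := (slit_tangent_bundle M).
Hypothesis sM : smooth_atlas M.
Variable F : point_of TM -> R.
Hypothesis FF : finsler_function F.
Implicit Types (a b : chart M) (u : point_of T0M) (z : 'rV[R]_(m + m)).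

Let sT : smooth_atlas T0M := smooth_atlas_T0M sM.

Definition chart_image a : set 'rV[R]_(m + m) := @coord _ _ T0M a @` @dom _ _ T0M a.

Lemma loc_F_scale a z (c : R) : chart_image a z -> 0 < c ->
  loc_F F a (row_mx (lsubmx z) (c *: rsubmx z)) = c * loc_F F a z.
Proof.
move=> /T0M_chart -/(_ sM)[+ z0] c0; rewrite -[dom a]setIT => /(imageP sM)[ax _ xE].
have [_ _ _ hom _] := FF.
have E v : @coord_inv _ _ TM a (row_mx (lsubmx z) v) =
    (coord_inv a (lsubmx z), tangent_of a v (coord_inv a (lsubmx z))).
  have := @T0M_coord_inv _ _ M a (row_mx (lsubmx z) v).
  by rewrite row_mxKl row_mxKr => ->.
have tv v := tangent_ofP sM v ax.
rewrite /loc_F E -{4}[z]hsubmxK E -hom//; last first.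
  split; [exact: (dom_carrier sM ax)|exact: tv].
congr (F (_, _)); apply: (tangent_eq ax) => //; first exact: tangentZ.
by rewrite fctE !tangent_ofE.
Qed.

Lemma local_finsler_chart a : local_finsler (loc_F F a) (chart_image a).
Proof.
have [_ sF _ _ reg] := FF; split.
- exact: open_chart.
- exact: sF.
- move=> z Uz; apply: derive_homogeneous => t t1.
  have t0 : 0 < 1 + t by lra.
  have zE : row_mx (lsubmx z) ((1 + t) *: rsubmx z) = z + t *: yvec (rsubmx z).
    rewrite row_mx_xyvec (linear_funZ linear_yvec) scalerDl scale1r addrA -row_mx_xyvec.
    by rewrite hsubmxK.
  have H := loc_F_scale Uz t0.
  have L (s e1 e2 : R) : e1 = s * e2 -> 2^-1 * e1 ^+ 2 = s ^+ 2 * (2^-1 * e2 ^+ 2).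
    by move=> ->; ring.
  apply: etrans (congr1 (energy (loc_F F a)) (esym zE)) _.
  apply: etrans (energyE _ _) _; apply: etrans (L _ _ _ H) _.
  exact: (congr1 (fun e => (1 + t) ^+ 2 * e) (esym (energyE _ _))).
- by move=> z /reg[].
- by move=> z v /reg[_ pos]; exact: pos.
Qed.

End SlitChart.

Section LocalFrame.
Context {R : realType} {m : nat}.
Variables (f : 'rV[R]_(m + m) -> R) (U : set 'rV[R]_(m + m)).
Hypothesis Ff : local_finsler f U.
Implicit Types (z a b : 'rV[R]_(m + m)).

Lemma loc_sasakiE z a b : U z -> loc_sasaki f z a b =
  gform f z (lsubmx a) (lsubmx b) + gform f z (vpart f z a) (vpart f z b).
Proof.
move=> Uz; rewrite -!(gform_sum _ _ Ff Uz) -big_split; apply: eq_bigr => i _.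
rewrite -big_split; apply: eq_bigr => j _ /=.
rewrite !(vcoframeE Ff _ _ Uz).
have lE (c : 'rV[R]_(m + m)) (k : 'I_m) : hcoframe k c = lsubmx c 0 k by rewrite mxE.
by rewrite !lE.
Qed.

Lemma loc_sprayE z : U z -> loc_spray f z = hlift f z (rsubmx z).
Proof.
move=> Uz; rewrite (linear_row_sum (linear_hlift Ff Uz) (rsubmx z)).
apply: eq_bigr => i _; rewrite (hframeE Ff _ Uz); congr (_ *: _).
by rewrite mxE.
Qed.

Lemma loc_liouvilleE z : loc_liouville z = yvec (rsubmx z).
Proof.
rewrite (linear_row_sum linear_yvec (rsubmx z)).
by apply: eq_bigr => i _; congr (_ *: _); rewrite mxE.
Qed.

(** The spray and the Liouville field are the horizontal and the vertical lift of y, and g(v, y) =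
    flat(v). Orthogonality to both thus means that [flat] vanishes on both components. *)
Lemma sasaki_span z a (s t : R) : U z ->
  loc_sasaki f z a (s *: loc_spray f z + t *: loc_liouville z) =
  s * flat f z (lsubmx a) + t * flat f z (vpart f z a).
Proof.
move=> Uz; set b := _ + _.
have lb : lsubmx b = s *: rsubmx z.
  rewrite /b loc_sprayE// loc_liouvilleE (linear_funD linear_lsubmx).
  rewrite !(linear_funZ linear_lsubmx) lsubmx_hlift lsubmx_yvec.
  by rewrite scaler0 addr0.
have vb : vpart f z b = t *: rsubmx z.
  rewrite /b loc_sprayE// loc_liouvilleE (linear_funD (linear_vpart Ff Uz)).
  rewrite !(linear_funZ (linear_vpart Ff Uz)) vpart_hlift (vpart_yvec Ff _ Uz).
  by rewrite scaler0 add0r.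
rewrite (loc_sasakiE a b Uz) lb vb.
have G r v : gform f z v (r *: rsubmx z) = r * flat f z v.
  apply: etrans (linear_funZ (linear_gformr Ff v Uz) r (rsubmx z)) _.
  exact: (congr1 (fun e => r * e) (gform_y Ff v Uz)).
have L (p q p' q' : R) : p = p' -> q = q' -> p + q = p' + q' by move=> -> ->.
exact: L (G _ _) (G _ _).
Qed.

End LocalFrame.

Section SlitGeometry.
Context {R : realType} {m : nat} {M : atlas R m}.
Local Notation TM := (tangent_bundle M).
Local Notation T0M := (slit_tangent_bundle M).
Hypothesis sM : smooth_atlas M.
Variable F : point_of TM -> R.
Hypothesis FF : finsler_function F.
Implicit Types (a b : chart T0M) (u : point_of T0M) (z : 'rV[R]_(m + m)).
Implicit Types (v w : tvec T0M).

Let sT : smooth_atlas T0M := smooth_atlas_T0M sM.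
Local Notation Fl a := (loc_F F (a : chart M)).
Let Ff a : local_finsler (Fl a) (@chart_image R m M a) := local_finsler_chart sM FF a.

Lemma chart_imageP a u : dom a u -> @chart_image R m M a (coord a u).
Proof. by move=> au; exists u. Qed.

Section TwoCharts.
Variables (a b : chart T0M).
Let ab : set 'rV[R]_(m + m) := coord a @` (dom a `&` dom b).
Let phi : 'rV[R]_m -> 'rV[R]_m := @transition _ _ M a b.
Let V : set 'rV[R]_m := @coord _ _ M a @` (@dom _ _ M a `&` @dom _ _ M b).

Let oV : open V. Proof. exact: (@open_overlap _ _ M sM a b). Qed.
Let sphi : smooth_on V phi. Proof. exact: (@smooth_transition _ _ M sM a b). Qed.

Let abV z : ab z -> V (lsubmx z).
Proof. by move=> abz; have [] := (T0M_overlap sM a b z).1 abz. Qed.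

Let tauE z : ab z -> transition a b z = tmap phi z.
Proof. by move=> /abV Vz; exact: (@T0M_transition _ _ M sM a b z Vz). Qed.

Let Fab : local_finsler (Fl a) ab.
Proof.
apply: local_finsler_sub (Ff a); first exact: (@open_overlap _ _ T0M sT a b).
by move=> z [u [au bu] <-]; exact: chart_imageP.
Qed.

Let ab_b z : ab z -> @chart_image R m M b (tmap phi z).
Proof.
move=> abz; rewrite -tauE//; case: abz => u [au bu] <-.
by rewrite (transition_coord sT b au); exact: chart_imageP.
Qed.

Let Fl_tmap z : ab z -> Fl a z = Fl b (tmap phi z).
Proof.
move=> abz; have E := esym (tauE abz); case: abz E => u [au bu] <- E.
have E1 := etrans E (transition_coord sT b au).
rewrite /loc_F; apply: (congr1 F); apply: etrans (coordK sT au) _.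
exact: (esym (etrans (congr1 (@coord_inv _ _ T0M b) E1) (coordK sT bu))).
Qed.

(** The differential of the reverse transition map provides a preimage. *)
Let phi_onto z (c : 'rV[R]_m) : ab z -> exists h : 'rV[R]_m, 'D_h phi (lsubmx z) = c.
Proof.
move=> /abV [p [ap bp] <-].
exists ('D_c (@transition _ _ M b a) (@coord _ _ M b p)).
have E := @derive_transition_comp _ _ M sM b a b p c bp ap bp.
exact: etrans E (@derive_transition_id _ _ M sM b p c bp).
Qed.

Let derive_tau z c : ab z -> 'D_c (transition a b) z = 'D_c (tmap phi) z.
Proof.
by move=> abz; apply: (derive_eq_on c (@open_overlap _ _ T0M sT a b) abz tauE).
Qed.

Lemma loc_D_chart u v : dom a u -> dom b u -> tangent u v ->
  loc_D (Fl a) (coord a u) (v a) -> loc_D (Fl b) (coord b u) (v b).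
Proof.
move=> au bu [_ tv] Dv; have abu : ab (coord a u) by exists u.
have H := loc_D_tmap Fab (Ff b) oV sphi abV ab_b Fl_tmap phi_onto abu Dv.
have E1 := etrans (esym (tauE abu)) (transition_coord sT b au).
have E2 := etrans (esym (derive_tau (v a) abu)) (esym (tv a b au bu)).
have L (f : 'rV[R]_(m + m) -> R) z z' c c' : z = z' -> c = c' ->
    loc_D f z c -> loc_D f z' c' by move=> -> ->.
exact: L E1 E2 H.
Qed.

Lemma loc_Psi_chart u v : dom a u -> dom b u -> tangent u v ->
  loc_Psi (Fl b) (coord b u) (v b) =
  'D_(loc_Psi (Fl a) (coord a u) (v a)) (transition a b) (coord a u).
Proof.
move=> au bu [_ tv]; have abu : ab (coord a u) by exists u.
have H := Psi_tmap Fab (Ff b) oV sphi abV ab_b Fl_tmap phi_onto (v a) abu.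
have E1 := etrans (esym (tauE abu)) (transition_coord sT b au).
have E2 := etrans (esym (derive_tau (v a) abu)) (esym (tv a b au bu)).
have E3 := derive_tau (loc_Psi (Fl a) (coord a u) (v a)) abu.
have L (f : 'rV[R]_(m + m) -> R) z z' c c' e e' : z = z' -> c = c' ->
    e' = e -> loc_Psi f z c = e -> loc_Psi f z' c' = e' by move=> -> -> ->.
exact: L E1 E2 E3 H.
Qed.

End TwoCharts.

(** The definition tests orthogonality in all charts around u; by [loc_D_chart] a single one
    decides. The combinations (1, 0) and (0, 1) isolate the two conditions. *)
Lemma D_FP a u v : dom a u ->
  D_F F u v <-> tangent u v /\ loc_D (Fl a) (coord a u) (v a).
Proof.
move=> au; split=> [[tv Dv]|[tv Dv]]; split=> //.
  have S s t : s * flat (Fl a) (coord a u) (lsubmx (v a)) +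
      t * flat (Fl a) (coord a u) (vpart (Fl a) (coord a u) (v a)) = 0.
    rewrite -(sasaki_span (Ff a) _ _ _ (chart_imageP au)).
    have := Dv (s *: spray F u + t *: liouville u).
    rewrite /sasaki => /(_ _ a au); rewrite !fctE /spray /liouville !chartwiseE//.
    by apply; exists s, t.
  split.
    by have := S 1 0; rewrite mul1r mul0r addr0.
  by have := S 0 1; rewrite mul1r mul0r add0r.
move=> w [s [t ->]] b bu; rewrite /sasaki !fctE /spray /liouville !chartwiseE//.
rewrite (sasaki_span (Ff b) _ _ _ (chart_imageP bu)).
have [-> ->] := loc_D_chart au bu tv Dv.
by rewrite !mulr0 addr0.
Qed.

Lemma tangent_Psi_F u v : tangent u v -> tangent u (Psi_F F u v).
Proof.
by move=> tv; apply: tangent_chartwise => a b au bu; exact: loc_Psi_chart.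
Qed.

Lemma Psi_FE a u v : dom a u ->
  Psi_F F u v a = loc_Psi (Fl a) (coord a u) (v a).
Proof. exact: chartwiseE. Qed.

Lemma J_FE u v : D_F F u v -> J_F F u v = Psi_F F u v.
Proof. by move=> Dv; rewrite /J_F patchE mem_set. Qed.

Lemma D_F_Psi u v : carrier T0M u -> D_F F u v -> D_F F u (Psi_F F u v).
Proof.
move=> /(carrier_dom sT)[a au] /(D_FP _ au)[tv Dv]; apply/(D_FP _ au); split.
  exact: tangent_Psi_F.
have L (f : 'rV[R]_(m + m) -> R) z c c' : c' = c -> loc_D f z c -> loc_D f z c' by move=> ->.
exact: L (Psi_FE v au) (loc_D_Psi (Ff a) (chart_imageP au) Dv).
Qed.

Lemma D_F_lin u (c : R) v w : carrier T0M u -> D_F F u v -> D_F F u w ->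
  D_F F u (c *: v + w).
Proof.
move=> /(carrier_dom sT)[a au] /(D_FP _ au)[tv Dv] /(D_FP _ au)[tw Dw].
apply/(D_FP _ au); split; first exact: (tangentP sT).
have L (f : 'rV[R]_(m + m) -> R) z e e' : e' = e -> loc_D f z e -> loc_D f z e' by move=> ->.
have E : (c *: v + w) a = c *: v a + w a by [].
exact: L E (loc_DP (Ff a) c (chart_imageP au) Dv Dw).
Qed.

Lemma D_F_sum u n (c : 'I_n -> R) (e : 'I_n -> tvec T0M) : carrier T0M u ->
  (forall i, D_F F u (e i)) -> D_F F u (\sum_i c i *: e i).
Proof.
move=> cu De; elim/big_rec: _ => [|i w _ Dw]; last exact: D_F_lin.
have [a au] := carrier_dom sT cu; apply/(D_FP _ au); split; first exact: tangent0.
exact: (loc_D0 (Ff a) (chart_imageP au)).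
Qed.

End SlitGeometry.

(* The vectors L e_p e_j - L e_j e_p span ker L and involve no division, so they
   vary smoothly with L. *)
Lemma kernel_frame (R : realType) (n : nat) (L : 'rV[R]_n.+1 -> R^o) (p : 'I_n.+1) h :
  linear L -> L (delta_mx 0 p) != 0 -> L h = 0 ->
  h = \sum_j (h 0 (lift p j) / L (delta_mx 0 p)) *:
    (L (delta_mx 0 p) *: delta_mx 0 (lift p j) - L (delta_mx 0 (lift p j)) *: delta_mx 0 p).
Proof.
move=> lL nz Lh.
pose S : R := \sum_j h 0 (lift p j) * L (delta_mx 0 (lift p j)).
have hp : h 0 p = - (S / L (delta_mx 0 p)).
  have := linear_row_sum lL h; rewrite Lh (bigD1_ord p)//= => /esym/eqP.
  rewrite addr_eq0 => /eqP E.
  by apply: (mulIf nz); rewrite mulNr divfK.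
rewrite {1}(row_sum_delta h) (bigD1_ord p)//= hp addrC.
transitivity (\sum_j (h 0 (lift p j) *: delta_mx 0 (lift p j) -
    (h 0 (lift p j) * L (delta_mx 0 (lift p j)) / L (delta_mx 0 p)) *: delta_mx 0 p) : 'rV[R]_n.+1).
  rewrite sumrB -scaler_suml -mulr_suml; congr (_ + _).
  by rewrite scaleNr.
apply: eq_bigr => j _; rewrite scalerBr !scalerA; congr (_ *: _ - _ *: _).
  by rewrite divfK.
by rewrite mulrAC.
Qed.

(** Only the i-th vector of the family has a component along the basis vector of index [lift p i],
    namely L e_p; linear independence follows when that is nonzero. *)
Lemma kernel_frame_coord (R : realType) (n : nat) (L : 'rV[R]_n.+1 -> R^o) (p : 'I_n.+1)
  (c : 'I_n -> R) (i : 'I_n) :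
  (\sum_j c j *: (L (delta_mx 0 p) *: delta_mx 0 (lift p j) -
     L (delta_mx 0 (lift p j)) *: delta_mx 0 p) : 'rV[R]_n.+1) 0 (lift p i) =
  c i * L (delta_mx 0 p).
Proof.
rewrite summxE (bigD1 i)//= big1 ?addr0 => [|j /negPf ji].
  by rewrite !mxE !eqxx/= lift_eqF mulr1 mulr0 subr0.
by rewrite !mxE !eqxx/= (inj_eq (@lift_inj _ _)) eq_sym ji lift_eqF !mulr0 subr0 mulr0.
Qed.

(** * The morphism J_F and its integrability on the slit tangent bundle *)

Section CRStructure.
Context {R : realType} {m : nat} {M : atlas R m}.
Local Notation TM := (tangent_bundle M).
Local Notation T0M := (slit_tangent_bundle M).
Hypothesis sM : smooth_atlas M.
Variable F : point_of TM -> R.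
Hypothesis FF : finsler_function F.
Implicit Types (a b : chart T0M) (u : point_of T0M) (z : 'rV[R]_(m + m)).
Implicit Types (v w : tvec T0M) (X Y : field T0M).

Let sT : smooth_atlas T0M := smooth_atlas_T0M sM.
Local Notation Fl a := (loc_F F (a : chart M)).
Let Ff a : local_finsler (Fl a) (@chart_image R m M a) := local_finsler_chart sM FF a.
Let UaP a u : dom a u -> @chart_image R m M a (coord a u).
Proof. by move=> au; exists u. Qed.

Lemma bundle_morphism_J_F : bundle_morphism (D_F F) (J_F F).
Proof.
split.
- by move=> u v cu Dv; rewrite (J_FE Dv); exact: (D_F_Psi sM FF).
- move=> u c v w cu Dv Dw.
  rewrite (J_FE Dv) (J_FE Dw) (J_FE (D_F_lin sM FF c cu Dv Dw)).
  (* In charts not containing u, every [chartwise] family is zero. *)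
  apply/funext => a; have [au|au] := pselect (dom a u); last first.
    by rewrite !fctE /Psi_F !chartwiseN// scaler0 addr0.
  rewrite !fctE !(Psi_FE F _ au).
  exact: (linear_Psi (Ff a) (UaP au)).
- move=> U X oU [[tX sX] DX].
  have [UN oUa] := oU.
  split; last by move=> u Uu; rewrite (J_FE (DX _ Uu)); exact: (D_F_Psi sM FF (UN _ Uu) (DX _ Uu)).
  split=> [u Uu|a].
    rewrite (J_FE (DX _ Uu)); exact: (tangent_Psi_F sM FF (tX _ Uu)).
  have Fa : local_finsler (Fl a) (coord a @` (dom a `&` U)).
    by apply: local_finsler_sub (Ff a) => // z [u [au _] <-]; exact: UaP.
  apply: (smooth_eq_on (oUa a)); last exact: (smooth_Psi Fa (sX a)).
  move=> z /(imageP sT)[az Uz zE].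
  rewrite /local_rep (J_FE (DX _ Uz)) (Psi_FE F _ az).
  by rewrite zE.
Qed.

Lemma J_F_J_F u v : carrier T0M u -> D_F F u v -> J_F F u (J_F F u v) = - v.
Proof.
move=> cu Dv; rewrite (J_FE Dv) (J_FE (D_F_Psi sM FF cu Dv)).
have [[v0 _] _] := Dv.
apply/funext => a; have [au|au] := pselect (dom a u); last first.
  by rewrite fctE /Psi_F chartwiseN// v0// oppr0.
rewrite fctE !(Psi_FE F _ au); exact: (Psi_Psi (Ff a) _ (UaP au)).
Qed.

Lemma loc_bracket_eq_on (U : set 'rV[R]_(m + m))
    (X X' Y Y' : 'rV[R]_(m + m) -> 'rV[R]_(m + m)) z :
  open U -> U z -> (forall z, U z -> X z = X' z) -> (forall z, U z -> Y z = Y' z) ->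
  loc_bracket X Y z = loc_bracket X' Y' z.
Proof.
move=> oU Uz XX' YY'; rewrite /loc_bracket.
have E1 := derive_eq_on (X z) oU Uz YY'; have E2 := derive_eq_on (Y z) oU Uz XX'.
have L (s s' t t' : 'rV[R]_(m + m)) : s = s' -> t = t' -> s - t = s' - t'.
  by move=> -> ->.
apply: L.
  by apply: etrans E1 _; rewrite XX'.
by apply: etrans E2 _; rewrite YY'.
Qed.

Lemma bracketE X Y a u : dom a u ->
  bracket X Y u a = loc_bracket (local_rep X a) (local_rep Y a) (coord a u).
Proof.
by move=> au; apply: etrans (chartwiseE _ au) _; rewrite /loc_bracket /local_rep (coordK sT au).
Qed.

Hypothesis SF : scalar_flag_curvature F.

Lemma integrable_J_F X Y :
  section (D_F F) (carrier T0M) X -> section (D_F F) (carrier T0M) Y ->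
  let JX : field T0M := fun p => J_F F p (X p) in
  let JY : field T0M := fun p => J_F F p (Y p) in
  section (D_F F) (carrier T0M) (bracket JX JY - bracket X Y) /\
  (forall p, carrier T0M p ->
     bracket JX JY p - bracket X Y p - J_F F p (bracket X JY p + bracket JX Y p) = 0).
Proof.
move=> [sX DX] [sY DY] JX JY.
have oN := open_in_carrier sT.
have [_ _ smJ] := bundle_morphism_J_F.
have [sJX _] : section (D_F F) (carrier T0M) JX by apply: smJ.
have [sJY _] : section (D_F F) (carrier T0M) JY by apply: smJ.
have b1 := smooth_bracket sT oN sJX sJY; have b2 := smooth_bracket sT oN sX sY.
have b3 := smooth_bracket sT oN sX sJY; have b4 := smooth_bracket sT oN sJX sY.
(* In the chart a, global sections of D_F become smooth maps with values in [loc_D], to which the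
   local integrability result applies. *)
have loc a u : dom a u ->
    loc_D (Fl a) (coord a u) (bracket JX JY u a - bracket X Y u a) /\
    bracket JX JY u a - bracket X Y u a =
    loc_Psi (Fl a) (coord a u) (bracket X JY u a + bracket JX Y u a).
  move=> au; have Uu := UaP au; have oUa := local_finsler_open (Ff a).
  have E : coord a @` (dom a `&` carrier T0M) = @chart_image R m M a.
    by congr (_ @` _); apply/seteqP; split=> [p []//|p ap]; split=> //; exact: (dom_carrier sT ap).
  have [_ sXa] := sX; have [_ sYa] := sY.
  have {}sXa := sXa a; have {}sYa := sYa a; rewrite E in sXa sYa.
  have inv z : @chart_image R m M a z -> dom a (coord_inv a z) /\ coord a (coord_inv a z) = z.
    by move=> [p ap <-]; rewrite (coordK sT ap).
  have DXa z : @chart_image R m M a z -> loc_D (Fl a) z (local_rep X a z).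
    move=> /inv[az zE]; have := DX _ (dom_carrier sT az).
    by move=> /(D_FP sM FF _ az)[_]; rewrite zE.
  have DYa z : @chart_image R m M a z -> loc_D (Fl a) z (local_rep Y a z).
    move=> /inv[az zE]; have := DY _ (dom_carrier sT az).
    by move=> /(D_FP sM FF _ az)[_]; rewrite zE.
  have JXE z : @chart_image R m M a z -> local_rep JX a z = loc_Psi (Fl a) z (local_rep X a z).
    move=> /inv[az zE]; apply: etrans (congr1 (@^~ a) (J_FE (DX _ (dom_carrier sT az)))) _.
    by apply: etrans (Psi_FE F _ az) _; rewrite zE.
  have JYE z : @chart_image R m M a z -> local_rep JY a z = loc_Psi (Fl a) z (local_rep Y a z).
    move=> /inv[az zE]; apply: etrans (congr1 (@^~ a) (J_FE (DY _ (dom_carrier sT az)))) _.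
    by apply: etrans (Psi_FE F _ az) _; rewrite zE.
  have curv z : @chart_image R m M a z -> exists l : R, forall i j k,
      curvature (Fl a) i j k z =
      l * ((i == k)%:R * ylow (Fl a) j z - (i == j)%:R * ylow (Fl a) k z).
    move=> Uz; have [lam _ H] := SF; exists (lam (@coord_inv _ _ T0M a z)) => i j k.
    exact: (H a z Uz).
  have [I1 I2] := loc_integrable (Ff a) curv sXa sYa DXa DYa Uu.
  have erX z : @chart_image R m M a z -> local_rep X a z = local_rep X a z by [].
  have erY z : @chart_image R m M a z -> local_rep Y a z = local_rep Y a z by [].
  have B1 := etrans (bracketE JX JY au) (loc_bracket_eq_on oUa Uu JXE JYE).
  have B2 := bracketE X Y au.
  have B3 := etrans (bracketE X JY au) (loc_bracket_eq_on oUa Uu erX JYE).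
  have B4 := etrans (bracketE JX Y au) (loc_bracket_eq_on oUa Uu JXE erY).
  by rewrite B1 B2 B3 B4; split.
have DW u : carrier T0M u -> D_F F u (bracket JX JY u - bracket X Y u).
  move=> cu; have [a au] := carrier_dom sT cu; apply/(D_FP sM FF _ au); split.
    have [[t1 _] [t2 _]] := (b1, b2).
    rewrite -scaleN1r addrC; apply: (tangentP sT); first exact: t2.
    exact: t1.
  exact: (loc a u au).1.
split.
  by split; [exact: (smooth_fieldD sT oN b1 (smooth_fieldN sT oN b2))|exact: DW].
move=> u cu.
(* Needed to replace [J_F] by [Psi_F]. By [I2] the vector in D_F is Psi c, with c the present sum;
   applying Psi once more stays in D_F and gives -c. *)
have DZ : D_F F u (bracket X JY u + bracket JX Y u).
  have [a au] := carrier_dom sT cu; apply/(D_FP sM FF _ au); split.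
    have [[t3 _] [t4 _]] := (b3, b4).
    by apply: (tangentD sT); [exact: t3|exact: t4].
  have [I1 I2] := loc a u au.
  have P1 := Psi_Psi (Ff a) (bracket X JY u a + bracket JX Y u a) (UaP au).
  have D1 := loc_D_Psi (Ff a) (UaP au) I1.
  have L (f : 'rV[R]_(m + m) -> R) z c e : e = loc_Psi f z c ->
      loc_Psi f z (loc_Psi f z c) = - c -> loc_D f z (loc_Psi f z e) -> loc_D f z (- c).
    by move=> -> ->.
  have D2 := L _ _ _ _ I2 P1 D1.
  have := loc_DP (Ff a) (-1) (UaP au) D2 (loc_D0 (Ff a) (UaP au)).
  by rewrite addr0 scaleN1r opprK.
rewrite (J_FE DZ); apply/funext => a; have [au|au] := pselect (dom a u).
  rewrite !fctE (Psi_FE F _ au).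
  by have [_ ->] := loc a u au; rewrite subrr.
have out Z : smooth_field_on (carrier T0M) Z -> Z u a = 0.
  by move=> [tZ _]; have [Z0 _] := tZ u cu; exact: Z0.
rewrite !fctE /Psi_F chartwiseN//.
by rewrite (out _ b1) (out _ b2) !subr0.
Qed.

End CRStructure.

(** * A smooth local frame of D_F *)

Section Distribution.
Context {R : realType} {n : nat} {M : atlas R n.+1}.
Local Notation TM := (tangent_bundle M).
Local Notation T0M := (slit_tangent_bundle M).
Hypothesis sM : smooth_atlas M.
Variable F : point_of TM -> R.
Hypothesis FF : finsler_function F.
Local Notation m := n.+1.
Implicit Types (a b : chart T0M) (u : point_of T0M) (z : 'rV[R]_(m + m)).
Local Notation "''e_' i" := (delta_mx 0 i : 'rV[R]_m) (at level 8, i at level 2).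

Let sT : smooth_atlas T0M := smooth_atlas_T0M sM.
Local Notation Fl a := (loc_F F (a : chart M)).
Let Ff a : local_finsler (Fl a) (@chart_image R m M a) := local_finsler_chart sM FF a.

Section Frame.
Variables (a : chart T0M) (p : 'I_m).
Local Notation Ua := (@chart_image R m M a).
Local Notation f := (Fl a).

Definition kernel_vec z (j : 'I_n) : 'rV[R]_m :=
  flat f z 'e_p *: 'e_(lift p j) - flat f z 'e_(lift p j) *: 'e_p.

(** The n horizontal lifts of the kernel vectors followed by their n vertical lifts; the rank 2n is
    accordingly handled as n + n. *)
Definition frame (k : 'I_(n + n)) z : 'rV[R]_(m + m) :=
  match fintype.split k with
  | inl j => hlift f z (kernel_vec z j)
  | inr j => yvec (kernel_vec z j)
  end.

Lemma flat_kernel_vec z j : Ua z -> flat f z (kernel_vec z j) = 0.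
Proof.
move=> Uz; have lF := linear_flat (Ff a) Uz.
apply: etrans (linear_funB lF _ _) _.
have L (s t s' t' : R) : s = flat f z 'e_p * t' -> t = t' * flat f z 'e_p -> s - t = 0.
  by move=> -> ->; rewrite mulrC subrr.
exact: (L _ _ 0 _ (linear_funZ lF _ _) (linear_funZ lF _ _)).
Qed.

Lemma smooth_kernel_vec j : smooth_on Ua (kernel_vec^~ j).
Proof.
have oU := local_finsler_open (Ff a).
by apply: smoothB => //; apply: smooth_scale => //; [exact: (smooth_flat (Ff a))|
  exact: smooth_cst|exact: (smooth_flat (Ff a))|exact: smooth_cst].
Qed.

Lemma smooth_frame k : smooth_on Ua (frame k).
Proof.
have oU := local_finsler_open (Ff a).
rewrite /frame; case: (fintype.split k) => j.
  apply: (smooth_linear_family (A := hlift f) (X := kernel_vec^~ j)) => //.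
  - by move=> z Uz; exact: (linear_hlift (Ff a) Uz).
  - exact: (smooth_hlift (Ff a)).
  - exact: smooth_kernel_vec.
apply: smooth_linear_comp => //; first exact: linear_yvec.
exact: smooth_kernel_vec.
Qed.

Lemma loc_D_frame k z : Ua z -> loc_D f z (frame k z).
Proof.
move=> Uz; have lF := linear_flat (Ff a) Uz; rewrite /frame; case: (fintype.split k) => j.
all: set h := kernel_vec z j; have h0 : flat f z h = 0 := flat_kernel_vec j Uz.
  exact: (conj (etrans (congr1 (flat f z) (lsubmx_hlift f z h)) h0)
    (etrans (congr1 (flat f z) (vpart_hlift f z h)) (linear_fun0 lF))).
exact: (conj (etrans (congr1 (flat f z) (lsubmx_yvec h)) (linear_fun0 lF))
  (etrans (congr1 (flat f z) (vpart_yvec (Ff a) h Uz)) h0)).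
Qed.

Lemma frame_sum z (c : 'I_(n + n) -> R) : Ua z ->
  \sum_k c k *: frame k z =
  hlift f z (\sum_j c (lshift n j) *: kernel_vec z j) +
  yvec (\sum_j c (rshift n j) *: kernel_vec z j).
Proof.
move=> Uz; rewrite big_split_ord /=.
have L (s t s' t' : 'rV[R]_(m + m)) : s = s' -> t = t' -> s + t = s' + t'.
  by move=> -> ->.
apply: L.
  apply: (etrans _ (esym (linear_fun_sum (linear_hlift (Ff a) Uz) _ _))).
  by apply: eq_bigr => j _; rewrite /frame (unsplitK (inl j)).
apply: (etrans _ (esym (linear_fun_sum linear_yvec _ _))).
by apply: eq_bigr => j _; rewrite /frame (unsplitK (inr j)).
Qed.

Lemma frame_free z (c : 'I_(n + n) -> R) : Ua z -> flat f z 'e_p != 0 ->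
  \sum_k c k *: frame k z = 0 -> forall k, c k = 0.
Proof.
move=> Uz nz; rewrite frame_sum// => S0.
have h0 : \sum_j c (lshift n j) *: kernel_vec z j = 0.
  have := congr1 lsubmx S0.
  rewrite (linear_funD (@linear_lsubmx R m)) lsubmx_hlift lsubmx_yvec addr0.
  by rewrite (linear_fun0 (@linear_lsubmx R m)).
have v0 : \sum_j c (rshift n j) *: kernel_vec z j = 0.
  have lV := linear_vpart (Ff a) Uz.
  have := congr1 (vpart f z) S0.
  rewrite (linear_funD lV) vpart_hlift (vpart_yvec (Ff a) _ Uz) add0r.
  by rewrite (linear_fun0 lV).
have coef (d : 'I_n -> R) : \sum_j d j *: kernel_vec z j = 0 -> forall j, d j = 0.
  move=> d0 j; apply: (mulIf nz); rewrite mul0r -(kernel_frame_coord (flat f z) p d j).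
  by apply: etrans (congr1 (fun v : 'rV[R]_m => v 0 (lift p j)) d0) _; rewrite mxE.
move=> k; rewrite -[k]splitK; case: (fintype.split k) => j /=.
  exact: (coef _ h0).
exact: (coef _ v0).
Qed.

Lemma frame_span z e : Ua z -> flat f z 'e_p != 0 -> loc_D f z e ->
  exists c : 'I_(n + n) -> R, e = \sum_k c k *: frame k z.
Proof.
move=> Uz nz [h0 v0]; have lF := linear_flat (Ff a) Uz.
pose d (h : 'rV[R]_m) j := h 0 (lift p j) / flat f z 'e_p.
pose c (k : 'I_(n + n)) := match fintype.split k with
  | inl j => d (lsubmx e) j | inr j => d (vpart f z e) j end.
have cl j : c (lshift n j) = d (lsubmx e) j by rewrite /c (unsplitK (inl j)).
have cr j : c (rshift n j) = d (vpart f z e) j by rewrite /c (unsplitK (inr j)).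
have S1 : \sum_j c (lshift n j) *: kernel_vec z j = lsubmx e.
  apply: etrans _ (esym (kernel_frame lF nz h0)).
  by apply: eq_bigr => j _; rewrite cl.
have S2 : \sum_j c (rshift n j) *: kernel_vec z j = vpart f z e.
  apply: etrans _ (esym (kernel_frame lF nz v0)).
  by apply: eq_bigr => j _; rewrite cr.
exists c; apply: etrans _ (esym (frame_sum c Uz)); rewrite S1 S2.
exact: hlift_vpart.
Qed.

End Frame.

(** Off the null section flat(y) = g(y, y) > 0, so some y_p is nonzero. *)
Lemma exists_flat_neq0 a z : @chart_image R m M a z -> exists p, flat (Fl a) z 'e_p != 0.
Proof.
move=> Uz; have [_ y0] := (T0M_chart sM a z).1 Uz.
have /eqP yn0 := y0.
have pos := gform_pos (Ff a) Uz yn0.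
apply: contrapT => H.
have all0 p : flat (Fl a) z 'e_p = 0.
  by apply/eqP; apply/negPn/negP => nz; apply: H; exists p.
have E : flat (Fl a) z (rsubmx z) = 0.
  apply: etrans (linear_row_sum (linear_flat (Ff a) Uz) (rsubmx z)) _.
  by rewrite big1// => i _; rewrite all0 scaler0.
have L (s t : R) : s = t -> t = 0 -> 0 < s -> False by move=> -> ->; rewrite ltxx.
exact: L (gform_y (Ff a) (rsubmx z) Uz) E pos.
Qed.

Lemma smooth_distribution_D_F : smooth_distribution (2 * n) (D_F F).
Proof.
rewrite mul2n -addnn => u0 cu0; have [a au0] := carrier_dom sT cu0.
have Uz0 : @chart_image R m M a (coord a u0) by exists u0.
have [p pnz] := exists_flat_neq0 Uz0.
have oUa := local_finsler_open (Ff a).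
have o0 : open (~` [set (0 : R^o)]).
  rewrite openC; apply: accessible_closed_set1.
  by apply: hausdorff_accessible; exact: norm_hausdorff.
(* An index p with y_p nonzero at [u0] keeps this property on an open set, on which the frame built
   from p is valid. *)
pose B := @chart_image R m M a `&` (flat (Fl a))^~ 'e_p @^-1` (~` [set (0 : R^o)]).
have oB : open B.
  apply: (@open_preimage_on R R^o 'rV[R]_(m + m) _ _ ((flat (Fl a))^~ 'e_p) oUa o0).
  move=> z Uz; exact: (smooth_continuous (smooth_flat (Ff a) 'e_p) Uz).
pose U := [set u : point_of T0M | dom a u /\ B (coord a u)].
have oU : open_in U := open_in_chart sT a oB.
have UB u : U u -> [/\ dom a u, @chart_image R m M a (coord a u) &
    flat (Fl a) (coord a u) 'e_p != 0].
  by move=> [au [Uu /eqP nz]]; split.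
pose E (k : 'I_(n + n)) : field T0M := fun u => tangent_of a (frame a p k (coord a u)) u.
have EE k u : U u -> E k u a = frame a p k (coord a u).
  by move=> /UB[au _ _]; rewrite /E (tangent_ofE sT).
have sumE (c : 'I_(n + n) -> R) u : U u ->
    (\sum_k c k *: E k u) a = \sum_k c k *: frame a p k (coord a u).
  by move=> Uu; rewrite fct_sumE; apply: eq_bigr => k _; rewrite fctE EE.
have DE k u : U u -> D_F F u (E k u).
  move=> Uu; have [au Uz nz] := UB u Uu; apply/(D_FP sM FF _ au); split.
    exact: tangent_ofP.
  by rewrite EE//; exact: loc_D_frame.
exists U, E; split=> //.
- by split=> //; split=> //; exact/eqP.
- move=> k; apply: (smooth_field_chart sT oU) => u Uu.
    by have [au _ _] := UB u Uu; exact: tangent_ofP.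
  have [au _ _] := UB u Uu; exists a => //.
  have [_ oUimg] := oU.
  have sF : smooth_on (coord a @` (dom a `&` U)) (frame a p k).
    by apply: smooth_sub (smooth_frame a p k) => z [v [av _] <-]; exists v.
  apply: (smooth_eq_on (oUimg a)) sF => z /(imageP sT)[_ Uz zE].
  exact: (esym (etrans (EE k _ Uz) (congr1 (frame a p k) zE))).
- move=> u Uu c S0; have [au Uz nz] := UB u Uu.
  apply: (frame_free Uz nz); rewrite -sumE//.
  by rewrite S0.
move=> u Uu; have [au Uz nz] := UB u Uu; have cu := dom_carrier sT au.
apply/seteqP; split=> v.
  move=> Dv; have [tv lv] := (D_FP sM FF v au).1 Dv.
  have [c cE] := frame_span Uz nz lv; exists c.
  apply: (tangent_eq au tv); last by rewrite sumE.
  by apply: (tangent_sum sT) => k; have [] := (D_FP sM FF _ au).1 (DE k u Uu).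
by move=> [c ->]; apply: (D_F_sum sM FF) => // k; exact: DE.
Qed.

End Distribution.

Theorem corollary3p4 (R : realType) (m : nat) (M : atlas R m)
    (F : point_of (tangent_bundle M) -> R) :
  (2 <= m)%N ->
  smooth_manifold M ->
  finsler_function F ->
  scalar_flag_curvature F ->
  cr_structure (N := slit_tangent_bundle M) m.-1 2 (D_F F) (J_F F).
Proof.
(* With m = n + 1 the rank 2(m - 1) becomes 2n, and the kernel of a form on R^m is indexed by the n
   remaining coordinates. *)
case: m M F => [//|n] M F n1 mM FF SF; have [sM _ _] := mM.
split.
- exact: smooth_manifold_T0M.
- by split=> //; rewrite /= mul2n -addnn; lia.
- exact: smooth_distribution_D_F.
- by split; [exact: bundle_morphism_J_F|move=> u v; exact: J_F_J_F].
- by move=> X Y sX sY; exact: integrable_J_F.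
Qed.
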